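(* (a) For every $\alpha\in[0,1]$ there exist sequences of positive integers $(m_k)_{k\ge1},(n_k)_{k\ge1}$ satisfying Keane's condition such that the ergodic measures $\lambda_2,\lambda_3$ of the associated Keane type 4-interval exchange transformation satisfy $H_{dim}(\lambda_2,d_{\lambda_3})=\alpha$. (b) For every $\alpha\in[0,1]$ there exist sequences of positive integers $(m_k)_{k\ge1},(n_k)_{k\ge1}$ satisfying Keane's condition such that the ergodic measures $\lambda_2,\lambda_3$ of the associated Keane type 4-interval exchange transformation satisfy $H_{dim}(\lambda_3,d_{\lambda_2})=\alpha$.
   Context: **Keane type IETs.** For positive integers $m,n$ let $$A_{m,n}=\begin{pmatrix}0&0&1&1\\ m-1&m&0&0\\ n&n&n-1&n\\ 1&1&1&1\end{pmatrix}.$$ For a nonnegative nonzero vector $w$ let $|w|$ be the sum of its entries, and $\bar A_{m,n}v=A_{m,n}v/|A_{m,n}v|$. Let $\Delta_3=\{(l_1,\dots,l_4):l_i>0,\sum l_i=1\}$ and let $e_1,\dots,e_4$ be the standard basis of $\mathbb R^4$. Sequences $(m_k)_{k\ge1},(n_k)_{k\ge1}$ of positive integers satisfy *Keane's condition* if $3(n_k+1)\le m_k\le\frac12(n_{k+1}+1)$ for all $k\ge 1$ and $n_1>9$. By a theorem of Keane, in that case the limits $L_i=\lim_{r\to\infty}\bar A_{m_1,n_1}\bar A_{m_2,n_2}\cdots\bar A_{m_r,n_r}e_i\in\Delta_3$ exist for $i=2,3$. For any fixed $c\in[0,1]$ (the choice is immaterial) put $L=cL_2+(1-c)L_3=(l_1,l_2,l_3,l_4)$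 and let $T:[0,1)\to[0,1)$ be the 4-interval exchange transformation with permutation $(4213)$: $[0,1)$ is cut into consecutive half-open intervals $I_1,I_2,I_3,I_4$, from left to right, of lengths $l_1,\dots,l_4$, and $T$ translates each $I_j$ so that the images appear from left to right in the order $I_4,I_2,I_1,I_3$. Then (Keane) $T$ is minimal (every orbit is dense), not uniquely ergodic, and has two ergodic invariant Borel probability measures $\lambda_2,\lambda_3$, determined by $\lambda_i(I_j)=(L_i)_j$ for $j=1,\dots,4$, $i=2,3$. This $T$ is the Keane type 4-IET associated with $(m_k),(n_k)$. **Hausdorff dimension.** For a non-atomic fully supported Borel measure $\mu$ on $[0,1)$, $d_\mu$ is the metric on $[0,1)$ given by $d_\mu(a,b)=\mu([a,b])$ for $a\le b$. For a set $S\subset[0,1)$ and a metric $d$, $H^s(S)=\lim_{\delta\to0^+}\inf\{\sum_i \mathrm{diam}(U_i)^s\}$, the infimum being over countable covers of $S$ by open sets of $d$-diameter at most $\delta$, and $H_{dim}(S,d)=\inf\{s:H^s(S)=0\}$. For a Borel probability measure $\nu$ on $[0,1)$, $H_{dim}(\nu,d)=\inf\{H_{dim}(M,d): M\text{ Borel},\ \nu(M)=1\}$. *)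

(* Defs.v *)
From HB Require Import structures.
From mathcomp Require Export all_boot all_order all_algebra.
From mathcomp Require Export all_classical all_reals all_analysis.

Set Implicit Arguments.
Unset Strict Implicit.
Unset Printing Implicit Defensive.

Export Order.TTheory GRing.Theory Num.Theory.
Export numFieldNormedType.Exports.

Local Open Scope classical_set_scope.
Local Open Scope ring_scope.

(* Coordinates 1, 2, 3, 4 are the elements 0, 1, 2, 3 of 'I_4. Sequences
   (m_k)_{k >= 1} are functions nat -> nat whose value at 0 is never used. *)

Definition keane_matrix (R : realType) (m n : nat) : 'M[R]_4 :=
  \matrix_(i < 4, j < 4)
    nth 0 (nth [::]
      [:: [:: 0;         0;    1;         1   ];
          [:: m%:R - 1;  m%:R; 0;         0   ];
          [:: n%:R;      n%:R; n%:R - 1;  n%:R];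
          [:: 1;         1;    1;         1   ] ] i) j.

Definition weight (R : realType) (w : 'cV[R]_4) : R := \sum_(i < 4) w i 0.

Definition keane_step (R : realType) (m n : nat) (v : 'cV[R]_4) : 'cV[R]_4 :=
  (weight (keane_matrix R m n *m v))^-1 *: (keane_matrix R m n *m v).

(* Abar_{m_1,n_1} (Abar_{m_2,n_2} (... (Abar_{m_r,n_r} v))) *)
Definition keane_steps (R : realType) (m n : nat -> nat) (r : nat)
    (v : 'cV[R]_4) : 'cV[R]_4 :=
  foldr (fun k => keane_step (m k) (n k)) v (iota 1 r).

Definition keane_condition (m n : nat -> nat) : Prop :=
  [/\ forall k, (1 <= k)%N -> (0 < m k)%N /\ (0 < n k)%N,
      forall k, (1 <= k)%N ->
        (3 * (n k + 1) <= m k)%N /\ (2 * m k <= n k.+1 + 1)%N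
    & (9 < n 1)%N].

Definition simplex3 (R : realType) : set 'cV[R]_4 :=
  [set l | (forall i, 0 < l i 0) /\ \sum_(i < 4) l i 0 = 1].

(* L = lim_r Abar_{m_1,n_1} ... Abar_{m_r,n_r} e_i, and L lies in simplex3;
   i : 'I_4 is zero-based. *)
Definition keane_limit (R : realType) (m n : nat -> nat) (i : 'I_4)
    (L : 'cV[R]_4) : Prop :=
  simplex3 L /\
  (fun r : nat => keane_steps m n r (delta_mx i 0 : 'cV[R]_4)) @ \oo --> L.

Definition iet_left (R : realType) (l : 'cV[R]_4) (j : 'I_4) : R :=
  \sum_(i < 4 | (i < j)%N) l i 0.

Definition iet_interval (R : realType) (l : 'cV[R]_4) (j : 'I_4) : set R :=
  `[iet_left l j, iet_left l j + l j 0[.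

(* Zero-based position of T(I_j) among the images, whose left-to-right order
   is I_4, I_2, I_1, I_3. *)
Definition image_pos (j : 'I_4) : nat := nth 0%N [:: 2; 1; 3; 0]%N j.

Definition iet_image_left (R : realType) (l : 'cV[R]_4) (j : 'I_4) : R :=
  \sum_(i < 4 | (image_pos i < image_pos j)%N) l i 0.

(* For l in simplex3 this is the interval exchange on [0, 1[, extended to R by
   the identity. *)
Definition iet4213 (R : realType) (l : 'cV[R]_4) (x : R) : R :=
  x + \sum_(j < 4) (iet_image_left l j - iet_left l j) * \1_(iet_interval l j) x.

Definition unit_interval (R : realType) : set R := `[0, 1[.

(* A Borel probability measure on [0, 1[ is represented by a Borel probability
   measure on R carried by [0, 1[. *)
Definition carried_by_unit_interval (R : realType)
    (mu : probability (measurableTypeR R) R) : Prop :=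
  mu (@unit_interval R) = 1%E.

Definition invariant_measure (R : realType) (T : R -> R)
    (mu : probability (measurableTypeR R) R) : Prop :=
  forall B : set (measurableTypeR R), measurable B -> mu (T @^-1` B) = mu B.

Definition ergodic_measure (R : realType) (T : R -> R)
    (mu : probability (measurableTypeR R) R) : Prop :=
  invariant_measure T mu /\
  forall B : set (measurableTypeR R), measurable B -> T @^-1` B = B ->
    mu B = 0%E \/ mu B = 1%E.

(* lam2, lam3 are the two ergodic measures of the Keane type interval exchange
   of parameters m, n with length vector c L_2 + (1 - c) L_3. *)
Definition keane_measures (R : realType) (m n : nat -> nat) (c : R)
    (lam2 lam3 : probability (measurableTypeR R) R) : Prop :=
  exists L2 L3 : 'cV[R]_4,
    let L := c *: L2 + (1 - c) *: L3 in
    [/\ keane_limit m n (inord 1) L2 /\ keane_limit m n (inord 2) L3,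
        carried_by_unit_interval lam2 /\ carried_by_unit_interval lam3,
        ergodic_measure (iet4213 L) lam2 /\ ergodic_measure (iet4213 L) lam3,
        forall j, lam2 (iet_interval L j) = (L2 j 0)%:E
      & forall j, lam3 (iet_interval L j) = (L3 j 0)%:E].

Definition measure_dist (R : realType)
    (mu : probability (measurableTypeR R) R) (a b : R) : R :=
  fine (mu `[Num.min a b, Num.max a b]%classic).

(* Below, d is a metric on [0, 1[; its values elsewhere are irrelevant. *)

Definition dist_open (R : realType) (d : R -> R -> R) (U : set R) : Prop :=
  U `<=` @unit_interval R /\
  forall x, U x -> exists2 e : R, 0 < e &
    forall y, unit_interval y -> d x y < e -> U y.

(* Maximum with 0: the diameter of the empty set is 0, not -oo. *)
Definition diam (R : realType) (d : R -> R -> R) (U : set R) : \bar R :=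
  Order.max 0%E (ereal_sup [set (d p.1 p.2)%:E | p in U `*` U]).

(* The empty set contributes 0 also for s = 0 (note 0 `^ 0 = 1), so that
   sequences of open sets represent all countable covers, finite ones
   included. *)
Definition diam_pow (R : realType) (d : R -> R -> R) (s : R) (U : set R)
    : \bar R :=
  if U == set0 then 0%E else (diam d U `^ s)%E.

Definition hausdorff_premeasure (R : realType) (d : R -> R -> R) (s : R)
    (S : set R) (delta : R) : \bar R :=
  ereal_inf [set (\sum_(0 <= i <oo) diam_pow d s (U i))%E | U in
    [set U : nat -> set R |
      [/\ forall i, dist_open d (U i),
          forall i, (diam d (U i) <= delta%:E)%E
        & S `<=` \bigcup_i U i]]].

Definition hausdorff_measure (R : realType) (d : R -> R -> R) (s : R)
    (S : set R) : \bar R :=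
  lim (hausdorff_premeasure d s S delta @[delta --> 0^'+]).

Definition hausdorff_dim (R : realType) (d : R -> R -> R) (S : set R)
    : \bar R :=
  ereal_inf [set s%:E | s in [set s : R |
    0 <= s /\ hausdorff_measure d s S = 0%E]].

Definition hausdorff_dim_measure (R : realType)
    (nu : probability (measurableTypeR R) R) (d : R -> R -> R) : \bar R :=
  ereal_inf [set hausdorff_dim d M | M in
    [set M : set (measurableTypeR R) |
      [/\ measurable M, M `<=` @unit_interval R & nu M = 1%E]]].

(* Main.v *)
From HB Require Import structures.
Require Import Defs.
From mathcomp Require Import all_boot all_order all_algebra.
From mathcomp Require Import all_classical all_reals all_analysis.
From mathcomp Require Import measurable_realfun.
From mathcomp Require Import ring lra zify.
Set Implicit Arguments.
Unset Strict Implicit.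
Unset Printing Implicit Defensive.
Local Open Scope classical_set_scope.
Local Open Scope ring_scope.

(* The interval exchange is renormalized by Rauzy-Keane induction.  At level k
   the interval [0, 1[ is cut into "floors", each carrying one of four letters;
   the floors with letter i are the successive images of one interval, and there
   are h_k(i) of them, all of length l_k(i), where l_k = A_{m_{k+1},n_{k+1}} l_{k+1}.
   Both the left-to-right words of floors and the order in which the orbits visit
   them are explicit substitutions which depend on (m_k), (n_k) only, not on the
   lengths.  Hence lambda_2, lambda_3 are the images of Lebesgue measure under the
   monotone maps conjugating the exchanges with length vectors L_2, L_3 to T.

   The floors b = 2 (resp. c = 3) of level k have lambda_2- (resp. lambda_3-) mass
   at least 1 - O(4^-k).  Hence almost every point of lambda_2 lies in b-floors from
   some level on, and covering by them bounds H_dim(lambda_2, d_{lambda_3}) from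
   above.  Conversely, points all of whose floors are b-floors form a Cantor set of
   positive lambda_2-measure whose gaps at level k have lambda_3-length at least
   g_k = l_k(a), and the mass distribution principle bounds the dimension below.
   Both bounds only involve H_k = h_k(b) and X_k = h_{k+2}(c) / m_{k+1}: a b-floor
   has lambda_2-measure about 1 / H_k and lambda_3-diameter about 1 / X_k, and the
   dimension is alpha when X_k is about H_k^(1/alpha) and X_k is at least about H_k.
   The ratio n_{k+2} / m_{k+1} is free, so it can be adjusted to obtain this.  Part
   (b) is similar with H_k = h_k(c), X_k = h_{k+1}(b) / n_{k+1}, gaps l_k(b) and the
   ratio m_{k+1} / n_{k+1}. *)

(** Keane's condition compares consecutive parameters up to constants only. [growth_condition] makes
    the share of the mass outside the main tower at most 4^-k; this gives convergence, and the
    losses sum to less than 1/2, so the Cantor set has positive measure. Invariance and ergodicity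
    come from one principle: a measure of total mass t whose total discrepancy from t * mu over the
    floors of suitable levels is arbitrarily small equals t * mu. All but four floors per level are
    images of floors of their letter, whence invariance; an invariant set meets all floors of a
    tower in the same mass, and one tower carries almost everything, whence ergodicity. The obstacle
    to reaching alpha is that X_k can be prescribed only up to an error left by integrality, the
    growth condition and earlier parameters. It is at most a constant times H_k^(1 + 1/k), because a
    parameter of the previous level exceeds the k-th power of the quantity responsible. The excess
    1/k is harmless: for s < 1, H_k^((1 + 1/k) s) <= H_k eventually. Conversely H_k >= 2^(k^2) lets
    every fixed positive power of H_k beat 2^k, which makes the covering sums converge. *)

(* The letters name the coordinates 1, 2, 3, 4.  Levels start at 0: [M k] and [N k]
   stand for m_{k+1} and n_{k+1}. *)
Inductive letter := La | Lb | Lc | Ld.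

Definition letter_eqb (a b : letter) : bool :=
  match a, b with
  | La, La | Lb, Lb | Lc, Lc | Ld, Ld => true
  | _, _ => false
  end.

Lemma letter_eqP : Equality.axiom letter_eqb.
Proof. by case; case; constructor. Qed.

HB.instance Definition _ := hasDecEq.Build letter letter_eqP.

Definition keane_mul (R : realType) (m n : nat) (v : letter -> R) (a : letter) : R :=
  match a with
  | La => v Lc + v Ld
  | Lb => (m%:R - 1) * v La + m%:R * v Lb
  | Lc => n%:R * (v La + v Lb + v Ld) + (n%:R - 1) * v Lc
  | Ld => v La + v Lb + v Lc + v Ld
  end.

(** Stronger than Keane's condition ([growth_keane]). The factor 4^(k+1) makes [defect_b] geometric;
    the factor 16 does the same for [defect_c] through [heightbc_ratio]. *)
Definition growth_condition (M N : nat -> nat) : Prop :=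
  [/\ (100 <= N 0)%N,
      forall k, (16 * 4 ^ k.+1 * (N k).+1 <= M k)%N
    & forall k, (16 * M k <= N k.+1)%N].

(* The transpose of the Keane matrix, acting on the numbers of floors. *)
Definition next_height (R : realType) (m n : nat) (h : letter -> R) (a : letter) : R :=
  match a with
  | La => (m%:R - 1) * h Lb + n%:R * h Lc + h Ld
  | Lb => m%:R * h Lb + n%:R * h Lc + h Ld
  | Lc => h La + (n%:R - 1) * h Lc + h Ld
  | Ld => h La + n%:R * h Lc + h Ld
  end.

(** * Numbers of floors and their growth *)

Section Heights.
Variables (R : realType) (M N : nat -> nat).

Fixpoint height (k : nat) (a : letter) : R :=
  if k is k'.+1 then next_height (M k') (N k') (height k') a else 1.

Lemma heightS k : height k.+1 = next_height (M k) (N k) (height k).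
Proof. by []. Qed.

Definition dot (h v : letter -> R) : R :=
  h La * v La + h Lb * v Lb + h Lc * v Lc + h Ld * v Ld.

Lemma dot_heightS k v :
  dot (height k.+1) v = dot (height k) (keane_mul (M k) (N k) v).
Proof. by rewrite /dot /=; ring. Qed.

(* The vector A_{m_{k+1},n_{k+1}} ... A_{m_{k+d},n_{k+d}} e_i. *)
Fixpoint column (d k : nat) (i : letter) : letter -> R :=
  if d is d'.+1 then keane_mul (M k) (N k) (column d' k.+1 i)
  else fun a => (a == i)%:R.

Lemma columnS d k i a :
  column d.+1 k i a = keane_mul (M k) (N k) (column d k.+1 i) a.
Proof. by []. Qed.

Lemma dot_height_column d k i : dot (height k) (column d k i) = height (k + d) i.
Proof.
elim: d k => [|d IH] k; last by rewrite /= -dot_heightS IH addSnnS.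
rewrite addn0 /dot /=.
by case: i; rewrite /= ?mulr1 ?mulr0 ?addr0 ?add0r.
Qed.

(** The second column of the Keane matrix is (0, m, n, 1). While [columnS] lengthens the product on
    the left, this lengthens it on the right, where the limit is taken. [columnSc] uses the third
    column (1, 0, n - 1, 1) instead. *)
Lemma columnSb d k a : column d.+1 k Lb a =
  (M (k + d))%:R * column d k Lb a + (N (k + d))%:R * column d k Lc a
  + column d k Ld a.
Proof.
elim: d k a => [|d IH] k a.
  by rewrite addn0; case: a => /=; ring.
rewrite !columnS addnS -addSn.
by case: a; rewrite /keane_mul !IH; ring.
Qed.

Lemma columnSc d k a : column d.+1 k Lc a =
  column d k La a + ((N (k + d))%:R - 1) * column d k Lc a + column d k Ld a.
Proof.
elim: d k a => [|d IH] k a.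
  by rewrite addn0; case: a => /=; ring.
rewrite !columnS addnS -addSn.
by case: a; rewrite /keane_mul !IH; ring.
Qed.

Hypothesis MN : growth_condition M N.

Lemma growth_N k : (100 <= N k)%N.
Proof.
case: MN => N0 HM HN.
elim: k => [//|k IH].
have := HN k; have := HM k; have : (0 < 4 ^ k.+1)%N by rewrite expn_gt0.
move: (4 ^ k.+1)%N => x x0 h1 h2; nia.
Qed.

Lemma growth_M k : (100 <= M k)%N.
Proof.
case: MN => N0 HM HN; have := growth_N k.
have := HM k; have : (0 < 4 ^ k.+1)%N by rewrite expn_gt0.
move: (4 ^ k.+1)%N => x x0 h1 h2; nia.
Qed.

Lemma growth_NR k : 100 <= (N k)%:R :> R.
Proof. by rewrite (ler_nat _ 100) growth_N. Qed.

Lemma growth_MR k : 100 <= (M k)%:R :> R.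
Proof. by rewrite (ler_nat _ 100) growth_M. Qed.

Lemma growth_MNR k : 64 * 4 ^+ k * ((N k)%:R + 1) <= (M k)%:R :> R.
Proof.
case: MN => _ /(_ k) H _; move: H; rewrite -(ler_nat R) !natrM natrX -natr1 exprS.
by apply: le_trans; rewrite le_eqVlt; apply/orP; left; apply/eqP; ring.
Qed.

Lemma growth_NMR k : 16 * (M k)%:R <= (N k.+1)%:R :> R.
Proof. by case: MN => _ _ /(_ k); rewrite -(ler_nat R) natrM. Qed.

Lemma growth_4NM k : 64 * (N k)%:R <= (M k)%:R :> R.
Proof.
have := growth_MNR k; have := growth_NR k.
have : 1 <= (4 : R) ^+ k by rewrite exprn_ege1 // ler1n.
move: (4 ^+ k) => x; nra.
Qed.

Lemma height_order k :
  [/\ 1 <= height k Lc, height k Lc <= height k La,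
      height k La <= height k Lb
    & [/\ height k Lc <= height k Ld, height k Ld <= height k Lb,
          height k Ld <= 2 * height k Lc & height k Lb <= 2 * height k La]].
Proof.
elim: k => [|k [h1 h2 h3 [h4 h5 h6 h7]]]; first by (split; last split); rewrite /=; lra.
have := growth_NR k; have := growth_MR k; have := growth_4NM k.
set m : R := (M k)%:R; set n : R := (N k)%:R => H1 H2 H3.
rewrite /= -/m -/n.
by split; last split; nra.
Qed.

Lemma height_ge1 k a : 1 <= height k a.
Proof.
have [h1 h2 h3 [h4 h5 h6 h7]] := height_order k.
by case: a; lra.
Qed.

Lemma height_gt0 k a : 0 < height k a.
Proof. by apply: lt_le_trans (height_ge1 k a). Qed.

Lemma heightSb_ge k : (M k)%:R * height k Lb <= height k.+1 Lb.
Proof.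
have [h1 h2 h3 [h4 h5 h6 h7]] := height_order k.
by have := growth_NR k => /=; nra.
Qed.

Lemma heightSb_le k : height k.+1 Lb <= 2 * (M k)%:R * height k Lb.
Proof.
have [h1 h2 h3 [h4 h5 h6 h7]] := height_order k.
by have := growth_NR k; have := growth_4NM k => /=; nra.
Qed.

Lemma heightSc_ge k : ((N k)%:R - 1) * height k Lc <= height k.+1 Lc.
Proof.
have [h1 h2 h3 [h4 h5 h6 h7]] := height_order k.
by have := growth_NR k => /=; nra.
Qed.

Lemma height_ge_exp2 k a : 2 ^+ k <= height k a.
Proof.
suff H : 2 ^+ k <= height k Lc.
  apply: (le_trans H); have [h1 h2 h3 [h4 h5 h6 h7]] := height_order k.
  by case: a; lra.
elim: k => [//|k IH]; rewrite exprS.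
have H1 := heightSc_ge k; have H2 := growth_NR k; have H3 := height_ge1 k Lc.
apply: le_trans H1; apply: (@le_trans _ _ (2 * height k Lc)).
  by rewrite ler_pM2l.
by apply: ler_wpM2r; lra.
Qed.

(** The left side is the part of [height k.+1 Lb] that does not come from [Lb]; divided by that
    height, it is the weight of the minor columns in [fraction_stepb]. *)
Lemma defect_b k :
  ((N k)%:R * height k Lc + height k Ld) <= 32^-1 * (4^-1) ^+ k * height k.+1 Lb.
Proof.
have [h1 h2 h3 [h4 h5 h6 h7]] := height_order k.
have H1 := heightSb_ge k; have H2 := growth_MNR k; have H3 := growth_NR k.
have x0 : 0 < (4:R) ^+ k by rewrite exprn_gt0.
rewrite exprVn -mulrA [X in _ <= _ * X]mulrC mulrA ler_pdivlMr //.
rewrite [leRHS]mulrC ler_pdivlMr //.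
apply: le_trans H1; apply: (@le_trans _ _ (64 * 4 ^+ k * ((N k)%:R + 1) * height k Lb)).
  have uw : (N k)%:R * height k Lc + height k Ld <= ((N k)%:R + 1) * height k Lb.
    rewrite mulrDl mul1r lerD // ler_wpM2l //; lra.
  have w0 : 0 <= ((N k)%:R + 1) * height k Lb.
    by rewrite mulr_ge0 //; exact/ltW/height_gt0.
  rewrite -[leRHS]mulrA; move: (_ + _) (_ * height k Lb) uw w0 => u w uw w0.
  move: (4 ^+ k) x0 => x x0.
  have : u * x <= w * x by rewrite ler_pM2r.
  have : 0 <= w * x by rewrite mulr_ge0 // ltW.
  by lra.
by apply: ler_wpM2r => //; exact/ltW/height_gt0.
Qed.

(** From one level to the next the left side grows at most by the factor [2 * M k], and the product
    on the right at least by [N k.+1 - 1 >= 8 * M k]; the quotient 4 pays for the new factor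
    4^-1. *)
Lemma heightbc_ratio k :
  2 * height k Lb <= 32^-1 * (4^-1) ^+ k * (((N k)%:R - 1) * height k Lc).
Proof.
elim: k => [|k IH].
  rewrite /= expr0; have := growth_NR 0; lra.
have H1 := heightSc_ge k; have H2 := heightSb_le k; have H3 := growth_NR k.
have H4 := growth_NMR k; have H5 := growth_MR k.
have x0 : 0 < (4^-1:R) ^+ k by rewrite exprn_gt0 // invr_gt0.
rewrite exprS.
move: ((4^-1) ^+ k) x0 IH => x x0 IH.
have h0 := height_gt0 k Lc; have hb := height_gt0 k Lb.
apply: (@le_trans _ _ (2 * (2 * (M k)%:R * height k Lb))); first by rewrite ler_pM2l.
apply: (@le_trans _ _ (2 * (M k)%:R * (32^-1 * x * (((N k)%:R - 1) * height k Lc)))).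
  have -> : 2 * (2 * (M k)%:R * height k Lb) = 2 * (M k)%:R * (2 * height k Lb) by ring.
  by rewrite ler_wpM2l //; lra.
apply: (@le_trans _ _ (2 * (M k)%:R * (32^-1 * x * height k.+1 Lc))).
  by rewrite ler_wpM2l ?ler_wpM2l //; lra.
move: (height k.+1 Lc) (height_gt0 k.+1 Lc) => y y0.
have : 8 * (M k)%:R <= (N k.+1)%:R - 1 :> R by lra.
have xy : 0 < x * y by exact: mulr_gt0.
move: (_ - 1) => z zz.
have : 8 * (M k)%:R * (x * y) <= z * (x * y) by rewrite ler_wpM2r // ltW.
lra.
Qed.

Lemma defect_c k :
  (height k La + height k Ld) <= 32^-1 * (4^-1) ^+ k * height k.+1 Lc.
Proof.
have [h1 h2 h3 [h4 h5 h6 h7]] := height_order k.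
have H1 := heightSc_ge k; have H2 := heightbc_ratio k.
have x0 : 0 < (4^-1:R) ^+ k by rewrite exprn_gt0 // invr_gt0.
apply: (@le_trans _ _ (2 * height k Lb)); first by lra.
by apply: (le_trans H2); apply: ler_wpM2l => //; rewrite mulr_ge0 ?invr_ge0 ?ltW.
Qed.

End Heights.

(** * Limit length vectors *)

Section GeometricCauchy.
Variables (R : realType) (u : R^nat) (k : nat).
Hypothesis u_le1 : forall d, u d <= 1.
Hypothesis u_step : forall d, `|u d.+1 - u d| <= 32^-1 * 4^-1 ^+ (k + d).

(* Subtracting the tail of the geometric bound makes the sequence monotone. *)
Let v d := u d - 24^-1 * 4^-1 ^+ (k + d).

Let v_nd : nondecreasing_seq v.
Proof.
apply/nondecreasing_seqP => d; rewrite /v addnS exprS.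
have := u_step d; rewrite ler_norml => /andP[+ _].
by move: (4^-1 ^+ _) => x; lra.
Qed.

Let v_cvg : cvgn v.
Proof.
apply: nondecreasing_is_cvgn => //; exists 1 => _ [d _ <-].
by apply: le_trans (u_le1 d); rewrite /v gerBl mulr_ge0 ?exprn_ge0 ?invr_ge0.
Qed.

Let tail_cvg0 : (fun d => 24^-1 * 4^-1 ^+ (k + d)) @ \oo --> (0 : R).
Proof.
have -> : (fun d => 24^-1 * 4^-1 ^+ (k + d)) = geometric (24^-1 * 4^-1 ^+ k) (4^-1 : R).
  by apply/funext => d; rewrite /= exprD mulrA.
by apply: cvg_geometric; rewrite ger0_norm ?invr_ge0 // invf_lt1 // ltr1n.
Qed.

Let u_cvgv : u @ \oo --> limn v.
Proof.
rewrite -[limn v]addr0.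
have -> : u = (fun d => v d + 24^-1 * 4^-1 ^+ (k + d)).
  by apply/funext => d; rewrite /v subrK.
exact: cvgD.
Qed.

Lemma geometric_cauchy_cvg : cvgn u.
Proof. exact: cvgP u_cvgv. Qed.

(** The constant 24^-1 is 32^-1 times the sum 4/3 of the geometric series: the bound is the total of
    all steps after [u 0]. *)
Lemma geometric_cauchy_lim : u 0%N - 24^-1 * 4^-1 ^+ k <= limn u.
Proof.
rewrite (cvg_lim _ u_cvgv) //.
by have := nondecreasing_cvgn_le v_nd v_cvg 0%N; rewrite /v addn0.
Qed.

End GeometricCauchy.

Lemma convex_step (R : realType) (p q r x y z : R) :
  0 < p -> 0 <= q -> 0 <= r -> 0 <= x <= 1 -> 0 <= y <= 1 -> 0 <= z <= 1 ->
  `|(p * x + q * y + r * z) / (p + q + r) - x| <= (q + r) / (p + q + r).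
Proof.
move=> p0 q0 r0 /andP[x0 x1] /andP[y0 y1] /andP[z0 z1].
have W0 : 0 < p + q + r by lra.
have -> : (p * x + q * y + r * z) / (p + q + r) - x =
    (q * (y - x) + r * (z - x)) / (p + q + r) by field; lra.
rewrite normrM [X in _ * X]gtr0_norm ?invr_gt0 // ler_pM2r ?invr_gt0 //.
by rewrite ler_norml; apply/andP; split; nra.
Qed.

Section Lengths.
Variables (R : realType) (M N : nat -> nat).
Hypothesis MN : growth_condition M N.
Local Notation h := (height R M N).
Local Notation col := (column R M N).

(** Dividing by the height gives the floors of level k total length 1 ([dot_height_fraction]). Hence
    [h k a * fraction d k i a], the total length of the [a]-floors, lies in [0, 1], and the Cauchy
    estimate is made for it. *)
Definition fraction (d k : nat) (i a : letter) : R := col d k i a / h (k + d) i.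

Lemma column_ge0 d k i a : 0 <= col d k i a.
Proof.
elim: d k a => [|d IH] k a /=; first exact: ler0n.
have := growth_NR R MN k; have := growth_MR R MN k.
have Ha := IH k.+1 La; have Hb := IH k.+1 Lb.
have Hc := IH k.+1 Lc; have Hd := IH k.+1 Ld.
move=> m1 n1; have {m1} : 0 <= (M k)%:R - 1 :> R by lra.
have {n1} : 0 <= (N k)%:R - 1 :> R by lra.
by case: a => /=; move: (_ - 1) (_ - 1) => x y x0 y0;
  do ?[exact: ler0n|assumption|apply: addr_ge0|apply: mulr_ge0].
Qed.

Lemma fraction_ge0 d k i a : 0 <= fraction d k i a.
Proof. by rewrite divr_ge0 ?column_ge0 // ltW // height_gt0. Qed.

Lemma dot_height_fraction d k i : dot (h k) (fraction d k i) = 1.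
Proof.
have H := dot_height_column R M N d k i.
have h0 := height_gt0 R MN (k + d) i.
rewrite /dot /fraction !mulrA -!mulrDl -/(dot _ _) H divff //.
by rewrite gt_eqF.
Qed.

Lemma height_fraction d k i a : 0 <= h k a * fraction d k i a <= 1.
Proof.
have H b : 0 <= h k b * fraction d k i b.
  by rewrite mulr_ge0 ?fraction_ge0 // ltW // height_gt0.
rewrite H /=; have := dot_height_fraction d k i; rewrite /dot.
by have := H La; have := H Lb; have := H Lc; have := H Ld; case: a; lra.
Qed.

(** By [columnSb] the new vector is the mean of the vectors of b, c, d with weights M h(b), N h(c),
    h(d), and [defect_b] bounds the share of the last two. *)
Lemma fraction_stepb d k a :
  `|h k a * fraction d.+1 k Lb a - h k a * fraction d k Lb a| <=
  32^-1 * 4^-1 ^+ (k + d).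
Proof.
have e : h k a * fraction d.+1 k Lb a =
  ((M (k + d))%:R * h (k + d) Lb * (h k a * fraction d k Lb a)
   + (N (k + d))%:R * h (k + d) Lc * (h k a * fraction d k Lc a)
   + h (k + d) Ld * (h k a * fraction d k Ld a)) /
  ((M (k + d))%:R * h (k + d) Lb + (N (k + d))%:R * h (k + d) Lc + h (k + d) Ld).
  rewrite /fraction columnSb addnS /=.
  have := height_gt0 R MN (k + d) Lb; have := height_gt0 R MN (k + d) Lc.
  have := height_gt0 R MN (k + d) Ld; have := height_gt0 R MN (k + d).+1 Lb => /=.
  by move=> *; field; rewrite !gt_eqF.
rewrite e; have Mp := growth_MR R MN (k + d); have Np := growth_NR R MN (k + d).
apply: le_trans (convex_step _ _ _ _ _ _) _; rewrite ?height_fraction //.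
- by rewrite mulr_gt0 ?height_gt0 //; lra.
- by rewrite mulr_ge0 // ltW // height_gt0.
- by rewrite ltW // height_gt0.
rewrite ler_pdivrMr; last exact: (height_gt0 R MN (k + d).+1 Lb).
exact: (defect_b R MN (k + d)).
Qed.

Lemma fraction_stepc d k a :
  `|h k a * fraction d.+1 k Lc a - h k a * fraction d k Lc a| <=
  32^-1 * 4^-1 ^+ (k + d).
Proof.
have e : h k a * fraction d.+1 k Lc a =
  (((N (k + d))%:R - 1) * h (k + d) Lc * (h k a * fraction d k Lc a)
   + h (k + d) La * (h k a * fraction d k La a)
   + h (k + d) Ld * (h k a * fraction d k Ld a)) /
  (((N (k + d))%:R - 1) * h (k + d) Lc + h (k + d) La + h (k + d) Ld).
  rewrite /fraction columnSc addnS /=.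
  rewrite [X in _ / X](_ : _ = ((N (k + d))%:R - 1) * h (k + d) Lc + h (k + d) La + h (k + d) Ld); last by ring.
  have := height_gt0 R MN (k + d) La; have := height_gt0 R MN (k + d) Lc.
  have := height_gt0 R MN (k + d) Ld.
  have := height_gt0 R MN (k + d).+1 Lc => /=.
  have -> : h (k + d) La + ((N (k + d))%:R - 1) * h (k + d) Lc + h (k + d) Ld =
    ((N (k + d))%:R - 1) * h (k + d) Lc + h (k + d) La + h (k + d) Ld by ring.
  by move=> *; field; rewrite !gt_eqF.
rewrite e; have Mp := growth_MR R MN (k + d); have Np := growth_NR R MN (k + d).
apply: le_trans (convex_step _ _ _ _ _ _) _; rewrite ?height_fraction //.
- by rewrite mulr_gt0 ?height_gt0 //; lra.
- by rewrite ltW // height_gt0.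
- by rewrite ltW // height_gt0.
have -> : ((N (k + d))%:R - 1) * h (k + d) Lc + h (k + d) La + h (k + d) Ld =
  h (k + d).+1 Lc by rewrite /=; ring.
rewrite ler_pdivrMr; last exact: (height_gt0 R MN (k + d).+1 Lc).
exact: (defect_c R MN (k + d)).
Qed.

Lemma fraction_mul d k i a :
  fraction d.+1 k i a = keane_mul (M k) (N k) (fraction d k.+1 i) a.
Proof. by rewrite /fraction columnS addnS addSn; case: a => /=; ring. Qed.

Definition limit_length (i : letter) (k : nat) (a : letter) : R :=
  limn (fun d => fraction d k i a).

(* Only the floors of these letters carry almost all the mass of an ergodic measure. *)
Definition heavy (i : letter) : bool := (i == Lb) || (i == Lc).

Lemma fraction_step d k i a : heavy i ->
  `|h k a * fraction d.+1 k i a - h k a * fraction d k i a| <=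
  32^-1 * 4^-1 ^+ (k + d).
Proof. by case/orP => /eqP ->; [exact: fraction_stepb|exact: fraction_stepc]. Qed.

Section Heavy.
Variable i : letter.
Hypothesis hi : heavy i.
Local Notation l := (limit_length i).

Let hfraction_cvg k a : cvgn (fun d => h k a * fraction d k i a).
Proof.
apply: (@geometric_cauchy_cvg _ _ k) => d.
  by case/andP: (height_fraction d k i a).
exact: fraction_step.
Qed.

Lemma fraction_cvg k a : (fun d => fraction d k i a) @ \oo --> l k a.
Proof.
have h0 := height_gt0 R MN k a.
suff : cvgn (fun d => fraction d k i a) by [].
have -> : (fun d => fraction d k i a) =
    (fun d => (h k a)^-1 * (h k a * fraction d k i a)).
  by apply/funext => d; rewrite mulKf // gt_eqF.
exact: is_cvgMl_tmp.
Qed.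

(** At d = 0 the letter [i] carries the whole length, and all later steps together remove at most
    24^-1 4^-k. Ergodicity and both dimension bounds rest on this concentration. *)
Lemma height_limit_length k : 1 - 24^-1 * 4^-1 ^+ k <= h k i * l k i.
Proof.
have e0 : h k i * fraction 0 k i i = 1.
  by rewrite /fraction /= addn0 eqxx mul1r mulfV // gt_eqF // height_gt0.
have := geometric_cauchy_lim (u := fun d => h k i * fraction d k i i) (k := k).
rewrite e0.
have -> : limn (fun d => h k i * fraction d k i i) = h k i * l k i.
  by apply: cvg_lim => //; apply: cvgMl_tmp; exact: fraction_cvg.
apply=> d; first by case/andP: (height_fraction d k i i).
exact: fraction_step.
Qed.

Lemma limit_length_ge0 k a : 0 <= l k a.
Proof.
by apply: limr_ge; [exact: fraction_cvg|
  apply: nearW => d; exact: fraction_ge0].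
Qed.

Lemma limit_length_mul k a : l k a = keane_mul (M k) (N k) (l k.+1) a.
Proof.
have H : (fun d => fraction d.+1 k i a) @ \oo --> l k a.
  by have := @fraction_cvg k a; rewrite -cvg_shiftS.
apply: (cvg_unique _ H) => //; rewrite (funext (fun d => fraction_mul d k i a)).
have F b := @fraction_cvg k.+1 b.
by case: a {H} => /=; do ?[exact: F|apply: cvgMl_tmp|apply: cvgD].
Qed.

Lemma limit_length_dot k : dot (h k) (l k) = 1.
Proof.
have H : (fun d => dot (h k) (fraction d k i)) @ \oo --> dot (h k) (l k).
  by rewrite /dot; do ?[exact: fraction_cvg|apply: cvgMl_tmp|apply: cvgD].
rewrite -(cvg_lim _ H) //; under eq_fun do rewrite dot_height_fraction.
by rewrite lim_cst.
Qed.

End Heavy.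

(** The floor lengths, at all levels, of an exchange of total length 1 that can be induced forever.
    The normalisation at level 0 passes to every level ([system_dot]). *)
Definition length_system (l : nat -> letter -> R) : Prop :=
  [/\ forall k a, l k a = keane_mul (M k) (N k) (l k.+1) a,
      forall k a, 0 < l k a
    & dot (h 0) (l 0) = 1].

Lemma limit_length_system i : heavy i -> length_system (limit_length i).
Proof.
move=> hi; have ge0 := limit_length_ge0 hi; have E := limit_length_mul hi.
(* The last row of the Keane matrix is all ones, so coordinate d is the sum of the next lengths,
   which cannot all vanish because their weighted sum is 1. Positivity then spreads to a, and from a
   to b and c. *)
have d0 k : 0 < limit_length i k Ld.
  rewrite E /=; have := limit_length_dot hi k.+1; rewrite /dot.
  have := ge0 k.+1 La; have := ge0 k.+1 Lb.
  have := ge0 k.+1 Lc; have := ge0 k.+1 Ld.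
  rewrite !le_eqVlt => /predU1P[<-|?]; last by move=> *; apply: ltr_wpDl; rewrite ?addr_ge0 ?ge0.
  move=> /predU1P[<-|?]; last by move=> *; rewrite addr0 ltr_wpDl ?addr_ge0 ?ge0.
  move=> /predU1P[<-|?]; last by move=> *; rewrite !addr0 ltr_wpDl ?ge0.
  move=> /predU1P[<-|?]; last by move=> *; rewrite !addr0.
  by rewrite !mulr0 !addr0 => /esym/eqP; rewrite oner_eq0.
have a0 k : 0 < limit_length i k La by rewrite E /= ltr_wpDl.
split=> // [k a|]; last exact: limit_length_dot.
have := growth_NR R MN k; have := growth_MR R MN k => Mk Nk.
case: a => //; rewrite E /=.
  by apply: ltr_pwDl; [apply: mulr_gt0 => //; lra|apply: mulr_ge0].
apply: ltr_pwDl; first by rewrite mulr_gt0 ?ltr_wpDl ?addr_ge0 ?ge0 //; lra.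
by apply: mulr_ge0 => //; lra.
Qed.

Lemma length_system_convex (l l' : nat -> letter -> R) (c : R) : 0 <= c <= 1 ->
  length_system l -> length_system l' ->
  length_system (fun k a => c * l k a + (1 - c) * l' k a).
Proof.
move=> /andP[c0 c1] [E P S] [E' P' S']; split => [k a|k a|].
- by rewrite E E'; case: a => /=; ring.
- have := P k a; have := P' k a; move: (l k a) (l' k a) => x y; nra.
- by move: S S'; rewrite /dot /= => S S'; nra.
Qed.

Section System.
Variable l : nat -> letter -> R.
Hypothesis lsys : length_system l.

Lemma system_dot k : dot (h k) (l k) = 1.
Proof.
case: lsys => E _ S; elim: k => [//|k IH].
rewrite dot_heightS -[RHS]IH; congr dot; apply/funext => a.
by rewrite E.
Qed.

Lemma system_gt0 k a : 0 < l k a.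
Proof. by case: lsys. Qed.

Lemma system_height_le1 k a : h k a * l k a <= 1.
Proof.
have H b : 0 < h k b * l k b by rewrite mulr_gt0 ?height_gt0 ?system_gt0.
have := system_dot k; rewrite /dot.
by have := H La; have := H Lb; have := H Lc; have := H Ld; case: a; lra.
Qed.

Lemma system_le_height k a : l k a <= (h k a)^-1.
Proof.
by rewrite -[leRHS]div1r ler_pdivlMr ?height_gt0 // mulrC system_height_le1.
Qed.

Lemma system_le_exp2 k a : l k a <= 2^-1 ^+ k.
Proof.
apply: le_trans (system_le_height k a) _.
by rewrite exprVn lef_pV2 ?posrE ?exprn_gt0 ?height_gt0 // height_ge_exp2.
Qed.

End System.

(** At level j + 1 the entry c is at least [N j.+1 - 1] times the entry d, which dominates a and b.
    As [N j.+1 >= 16 * M j], the entry c alone exceeds [M j] times (a + b), hence the entry b of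
    level j, and it is a summand of the entry d of level j. *)
Lemma limit_lengthc_le k : limit_length Lc k Lb <= limit_length Lc k Ld.
Proof.
suff H d j : col d j Lc Lb <= col d j Lc Ld.
  apply: ler_lim; [exact: fraction_cvg|exact: fraction_cvg|].
  apply: nearW => d; rewrite /fraction ler_pM2r ?H // invr_gt0.
  exact: height_gt0.
elim: d j => [//|d IH] j; rewrite !columnS /keane_mul.
(* The estimates of the entries a and c unfold the column once more; with a single factor the
   inequality is 0 <= 1. *)
case: d IH => [|d] IH; first by rewrite /=; lra.
have S0 : 0 <= col d.+1 j.+1 Lc Ld by exact: column_ge0.
have a0 : 0 <= col d.+1 j.+1 Lc La by exact: column_ge0.
have b0 : 0 <= col d.+1 j.+1 Lc Lb by exact: column_ge0.
have le_a : col d.+1 j.+1 Lc La <= col d.+1 j.+1 Lc Ld.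
  rewrite !columnS /= lerD2r lerDr addr_ge0 //; exact: column_ge0.
have le_c : ((N j.+1)%:R - 1) * col d.+1 j.+1 Lc Ld <= col d.+1 j.+1 Lc Lc.
  rewrite !columnS /=; have := column_ge0 d j.+2 Lc => pos.
  have := pos La; have := pos Lb; have := pos Ld; lra.
move: (IH j.+1) le_a le_c S0 a0 b0.
move: (col d.+1 j.+1 Lc La) (col d.+1 j.+1 Lc Lb) (col d.+1 j.+1 Lc Lc).
move: (col d.+1 j.+1 Lc Ld) => e a b c.
have := growth_NMR R MN j; have := growth_MR R MN j.
move: (M j)%:R (N j.+1)%:R => m n m0 nm be ae ec e0 a0 b0.
have H1 : m * b <= m * e by rewrite ler_wpM2l //; lra.
have H2 : m * a <= m * e by rewrite ler_wpM2l //; lra.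
have H3 : 2 * m * e <= (n - 1) * e by rewrite ler_wpM2r //; lra.
lra.
Qed.

Lemma limit_lengthb_le k :
  limit_length Lb k Ld <= limit_length Lb k Lc <= limit_length Lb k Lb.
Proof.
have H d j : col d j Lb Ld <= col d j Lb Lc <= col d j Lb Lb.
  elim: d j => [|d IH] j; first by rewrite /= lexx ler01.
  rewrite !columnS /keane_mul; have /andP[] := IH j.+1.
  have := growth_NR R MN j; have := growth_4NM R MN j.
  have := column_ge0 d j.+1 Lb La; have := column_ge0 d j.+1 Lb Ld.
  move: (col d j.+1 Lb La) (col d j.+1 Lb Lb) (col d j.+1 Lb Lc) (col d j.+1 Lb Ld).
  move: (M j)%:R (N j)%:R => m n a b c e e0 a0 mn n0 ec cb.
  have H1 : 100 * a <= n * a by rewrite ler_wpM2r.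
  have H2 : 100 * b <= n * b by rewrite ler_wpM2r //; lra.
  have H3 : 100 * c <= n * c by rewrite ler_wpM2r //; lra.
  have H4 : 100 * e <= n * e by rewrite ler_wpM2r //; lra.
  have H5 : 64 * n * a <= m * a by rewrite ler_wpM2r.
  have H6 : 64 * n * b <= m * b by rewrite ler_wpM2r //; lra.
  have H7 : n * c <= n * b by rewrite ler_wpM2l //; lra.
  have H8 : n * e <= n * b by rewrite ler_wpM2l //; lra.
  by apply/andP; split; lra.
have le a b : (forall d, col d k Lb a <= col d k Lb b) ->
    limit_length Lb k a <= limit_length Lb k b.
  move=> ab; apply: ler_lim; [exact: fraction_cvg|exact: fraction_cvg|].
  apply: nearW => d; rewrite /fraction ler_pM2r ?ab // invr_gt0.
  exact: height_gt0.
by apply/andP; split; apply: le => d; case/andP: (H d k).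
Qed.

(** Origin of X_k in part (a): a b-floor consists of at most M_k pairs of an a- and a b-floor, each
    no longer than a d-floor of level k + 1, and that d-floor holds four floors of level k + 2, each
    of length at most 1 / h_(k+2)(c). Hence 8 = 2 * 4. *)
Lemma limit_lengthc_upper k :
  limit_length Lc k Lb <= 8 * (M k)%:R / h k.+2 Lc.
Proof.
have hc : heavy Lc by [].
have sys := limit_length_system hc; have [E P _] := sys.
have le_b j := limit_lengthc_le j.
have up j := system_le_height sys j.
have [h1 h2 h3 [h4 h5 h6 h7]] := height_order R MN k.+2.
have sum4 : limit_length Lc k.+1 Ld <= 4 / h k.+2 Lc.
  rewrite E /=; have := le_b k.+2.
  have := up k.+2 La; have := up k.+2 Lc; have := up k.+2 Ld.
  have : (h k.+2 La)^-1 <= (h k.+2 Lc)^-1 by rewrite lef_pV2 ?posrE ?height_gt0.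
  have : (h k.+2 Ld)^-1 <= (h k.+2 Lc)^-1 by rewrite lef_pV2 ?posrE ?height_gt0.
  lra.
have le_a : limit_length Lc k.+1 La <= limit_length Lc k.+1 Ld.
  rewrite [leLHS]E [leRHS]E /=.
  by have := P k.+2 La; have := P k.+2 Lb; lra.
rewrite E /=; have := growth_MR R MN k.
have := le_b k.+1; have := P k.+1 La.
move: (limit_length Lc k.+1 La) (limit_length Lc k.+1 Lb) le_a sum4.
move: (limit_length Lc k.+1 Ld) => e a b ae e4 a0 be m0.
apply: (@le_trans _ _ ((M k)%:R * (2 * e))).
  by rewrite mulrBl mul1r addrAC -mulrDr lerBlDr ler_wpDr ?ler_wpM2l //; lra.
apply: (@le_trans _ _ ((M k)%:R * (8 / h k.+2 Lc))); last by rewrite mulrCA mulrA.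
by rewrite ler_wpM2l //; lra.
Qed.

(** Counterpart for part (b): a c-floor is at most N_k times the sum of the four lengths of level k
    + 1. In units of 1 / h_(k+1)(b), a contributes at most 2 and each of b, c, d at most 1, as d <=
    c <= b. *)
Lemma limit_lengthb_upper k :
  limit_length Lb k Lc <= 5 * (N k)%:R / h k.+1 Lb.
Proof.
have hb : heavy Lb by [].
have sys := limit_length_system hb; have [E P _] := sys.
have up j := system_le_height sys j.
have [h1 h2 h3 [h4 h5 h6 h7]] := height_order R MN k.+1.
have inv : (h k.+1 La)^-1 <= 2 / h k.+1 Lb.
  rewrite -[leLHS]div1r ler_pdivrMr ?height_gt0 // mulrAC ler_pdivlMr ?height_gt0 //.
  by rewrite mul1r.
rewrite E /=; have /andP[ec cb] := limit_lengthb_le k.+1.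
have := up k.+1 La; have := up k.+1 Lb.
have a0 := P k.+1 La; have b0 := P k.+1 Lb; have c0 := P k.+1 Lc; have d0 := P k.+1 Ld.
have := growth_NR R MN k.
move: (limit_length Lb k.+1 La) (limit_length Lb k.+1 Lb) a0 b0 ec cb => a b a0 b0.
move: (limit_length Lb k.+1 Lc) (limit_length Lb k.+1 Ld) c0 d0 => c e c0 e0 ec cb n0 bb aa.
have sum5 : a + b + c + e <= 5 / h k.+1 Lb by lra.
apply: (@le_trans _ _ ((N k)%:R * (a + b + c + e))); first by lra.
apply: (@le_trans _ _ ((N k)%:R * (5 / h k.+1 Lb))); last by rewrite mulrCA mulrA.
by rewrite ler_wpM2l.
Qed.

Lemma limit_length_half i k : heavy i -> (2 * h k i)^-1 <= limit_length i k i.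
Proof.
move=> hi; have := height_limit_length hi k; have h0 := height_gt0 R MN k i.
have : 24^-1 * 4^-1 ^+ k <= 2^-1 :> R.
  apply: (@le_trans _ _ (24^-1 * 1)); last by lra.
  by rewrite ler_wpM2l ?invr_ge0 // exprn_ile1 ?invr_ge0 // invf_le1 // ler1n.
rewrite invfM ler_pdivrMr // mulrC; lra.
Qed.

(** An a-floor contains a c-floor of the next level, which has at least half of the maximal possible
    length. *)
Lemma limit_lengthc_lower k : (2 * h k.+2 Lc)^-1 <= limit_length Lc k.+1 La.
Proof.
have hc : heavy Lc by []; have [E P _] := limit_length_system hc.
apply: le_trans (limit_length_half k.+2 hc) _.
by rewrite [leRHS]E /= lerDl ltW.
Qed.

Definition letter_of (j : 'I_4) : letter := nth La [:: La; Lb; Lc; Ld] j.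

Definition to_vector (v : letter -> R) : 'cV[R]_4 := \col_j v (letter_of j).

Lemma weight_to_vector v : weight (to_vector v) = v La + v Lb + v Lc + v Ld.
Proof. by rewrite /weight !big_ord_recl big_ord0 !mxE /letter_of /= addr0 !addrA. Qed.

Lemma keane_matrix_mul m n v :
  keane_matrix R m n *m to_vector v = to_vector (keane_mul m n v).
Proof.
apply/colP => j; rewrite !mxE !big_ord_recl big_ord0 !mxE /letter_of.
by case: j => -[|[|[|[|]]]] //= _; ring.
Qed.

(** Passes from levels counted from 0 to sequences indexed from 1; the value at 0 is a dummy. *)
Definition from0 (s : nat -> nat) : nat -> nat := fun k => s k.-1.

(** The normalised action forgets scalar factors, so normalising after each matrix or once at the
    end gives the same vector. *)
Lemma keane_steps_column d k i :
  foldr (fun k => keane_step (from0 M k) (from0 N k)) (to_vector (col 0 0 i))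
    (iota k.+1 d) =
  (weight (to_vector (col d k i)))^-1 *: to_vector (col d k i).
Proof.
elim: d k => [|d IH] k.
  rewrite /= weight_to_vector -[LHS]scale1r; congr (_ *: _).
  by case: i => /=; rewrite !(addr0, add0r) invr1.
have cd v : to_vector (keane_mul (M k) (N k) v) = keane_matrix R (M k) (N k) *m to_vector v.
  by rewrite keane_matrix_mul.
rewrite [LHS]/= IH /keane_step /from0 /= cd -scalemxAr.
have sc (s : R) (v : 'cV[R]_4) : weight (s *: v) = s * weight v.
  by rewrite /weight mulr_sumr; apply: eq_bigr => j _; rewrite mxE.
set w := weight (to_vector (col d k.+1 i)).
have w0 : w != 0.
  rewrite /w weight_to_vector; apply: lt0r_neq0.
  have := dot_height_column R M N d k.+1 i; rewrite /dot.
  have := height_gt0 R MN (k.+1 + d) i.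
  have c0 := column_ge0 d k.+1 i.
  move: (c0 La) (c0 Lb) (c0 Lc) (c0 Ld).
  move: (col d k.+1 i La) (col d k.+1 i Lb) (col d k.+1 i Lc) (col d k.+1 i Ld).
  move=> x y z t x0 y0 z0 t0 hp e.
  have [le0|//] := lerP (x + y + z + t) 0.
  have xe : x = 0 by lra.
  have ye : y = 0 by lra.
  have ze : z = 0 by lra.
  have te : t = 0 by lra.
  by move: hp; rewrite -e xe ye ze te !mulr0 !addr0 ltxx.
by rewrite sc scalerA invfM invrK [w * _]mulrC mulrK // unitfE.
Qed.

(** At level 0 all heights are 1, so the weight of a column is its dot product with the heights,
    which is the denominator of [fraction]. *)
Lemma keane_steps_fraction d i :
  keane_steps (from0 M) (from0 N) d (to_vector (col 0 0 i)) =
  to_vector (fraction d 0 i).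
Proof.
rewrite /keane_steps keane_steps_column; apply/colP => j; rewrite !mxE.
rewrite /fraction mulrC; congr (_ / _).
by rewrite -dot_height_column /dot weight_to_vector /= !mul1r.
Qed.

Lemma keane_limit_length i (j : 'I_4) : heavy i -> letter_of j = i ->
  keane_limit (from0 M) (from0 N) j (to_vector (limit_length i 0)).
Proof.
move=> hi ji; have [_ P _] := limit_length_system hi; split.
  split=> [j'|]; first by rewrite mxE.
  rewrite -/(weight _) weight_to_vector -[RHS](limit_length_dot hi 0).
  by rewrite /dot /= !mul1r.
have -> : delta_mx j 0 = to_vector (col 0 0 i).
  apply/colP => j'; rewrite !mxE eqxx andbT -ji /letter_of /=; congr (_%:R).
  by case: j j' {ji} => -[|[|[|[|]]]] //= ? [] [|[|[|[|]]]].
under eq_fun do rewrite keane_steps_fraction.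
apply/cvg_mx_entourageP => A entA.
have H : \forall d \near \oo, forall a, A (limit_length i 0 a, fraction d 0 i a).
  have Ha a : \forall d \near \oo, A (limit_length i 0 a, fraction d 0 i a).
    by have /cvg_app_entourageP := @fraction_cvg i hi 0 a; apply.
  by near=> d; case; near: d; exact: Ha.
by apply: filterS H => d H j1 j2; rewrite !mxE inE; exact: H.
Unshelve. all: by end_near.
Qed.

End Lengths.

(** * Words of floors *)

(* The floors of level k + 1 inside a floor of level k, from left to right.  The
   induced exchange has the mirrored combinatorics at every other level, which the
   boolean [o] records: the words for [true] and [false] are mirror images. *)
Definition patternb (q : nat) : letter := if odd q then La else Lb.

Definition patternc (o : bool) (q : nat) : letter :=
  nth La (if o then [:: Ld; Lb; La; Lc] else [:: La; Lb; Ld; Lc]) (q %% 4).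

(** The periodic words stop one letter short of a full period: 2 m - 1 letters contain m times b and
    m - 1 times a, and 4 n - 1 letters contain n times each of a, b, d and n - 1 times c, as the
    rows of the Keane matrix demand. *)
Definition child_word (o : bool) (m n : nat) (a : letter) : seq letter :=
  match a with
  | La => if o then [:: Lc; Ld] else [:: Ld; Lc]
  | Lb => mkseq patternb (m.*2).-1
  | Lc => mkseq (patternc o) (4 * n).-1
  | Ld => if o then [:: La; Lb; Lc; Ld] else [:: Ld; Lc; Lb; La]
  end.

Section Letters.
Variable R : realType.

Definition lensum (v : letter -> R) (s : seq letter) : R := \sum_(a <- s) v a.

Lemma lensum_cat v s1 s2 : lensum v (s1 ++ s2) = lensum v s1 + lensum v s2.
Proof. by rewrite /lensum big_cat. Qed.

Lemma lensum_cons v a s : lensum v (a :: s) = v a + lensum v s.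
Proof. by rewrite /lensum big_cons. Qed.

Lemma lensum_nil v : lensum v [::] = 0.
Proof. by rewrite /lensum big_nil. Qed.

Lemma lensum_ge0 v s : (forall a, 0 <= v a) -> 0 <= lensum v s.
Proof. by move=> v0; apply: sumr_ge0. Qed.

Lemma lensum_take_mkseq v f q n : (q <= n)%N ->
  lensum v (take q (mkseq f n)) = \sum_(i <- iota 0 q) v (f i).
Proof. by move=> qn; rewrite /lensum /mkseq -map_take take_iota (minn_idPl qn) big_map. Qed.

Lemma sum_patternb (v : letter -> R) j :
  \sum_(i <- iota 0 j.*2) v (patternb i) = j%:R * (v La + v Lb).
Proof.
elim: j => [|j IH]; first by rewrite big_nil mul0r.
rewrite doubleS -addn2 iotaD big_cat /= IH big_cons big_cons big_nil.
by rewrite add0n /patternb /= odd_double /= -natr1; ring.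
Qed.

Lemma sum_patternc (v : letter -> R) o j :
  \sum_(i <- iota 0 (4 * j)) v (patternc o i) =
  j%:R * (v La + v Lb + v Lc + v Ld).
Proof.
elim: j => [|j IH]; first by rewrite big_nil mul0r.
rewrite mulnS addnC iotaD big_cat /= IH !big_cons big_nil add0n /patternc.
have e i : ((4 * j + i) %% 4 = i %% 4)%N by rewrite mulnC modnMDl.
have := e 0%N; have := e 1%N; have := e 2%N; have := e 3%N.
rewrite addn0 addn1 addn2 addn3 => -> -> -> ->; rewrite -natr1.
by case: (o) => /=; ring.
Qed.

Lemma lensum_child (v : letter -> R) o m n a : (0 < m)%N -> (0 < n)%N ->
  lensum v (child_word o m n a) = keane_mul m n v a.
Proof.
move=> m0 n0; case: a => /=.
- by case: o; rewrite !lensum_cons lensum_nil; ring.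
- rewrite -[mkseq _ _]take_size size_mkseq lensum_take_mkseq //.
  case: m m0 => [//|m] _; have -> : (m.+1.*2.-1 = m.*2 + 1)%N by lia.
  rewrite iotaD big_cat /= sum_patternb big_cons big_nil add0n addr0.
  by rewrite /patternb odd_double -natr1; ring.
- rewrite -[mkseq _ _]take_size size_mkseq lensum_take_mkseq //.
  have := sum_patternc v o n.
  have -> : (4 * n = (4 * n).-1 + 1)%N by lia.
  rewrite iotaD big_cat /= big_cons big_nil add0n addr0.
  have e : ((4 * n).-1 %% 4 = 3)%N by lia.
  rewrite addn1 /= {2}/patternc e => H.
  rewrite [LHS](_ : _ = n%:R * (v La + v Lb + v Lc + v Ld) - v Lc).
    by ring.
  by rewrite -H; case: (o) => /=; ring.
- by case: o; rewrite !lensum_cons lensum_nil; ring.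
Qed.

End Letters.

Section Words.
Variables (M N : nat -> nat).

Definition word_at (k : nat) (a : letter) : seq letter :=
  child_word (odd k) (M k) (N k) a.

Fixpoint words (k : nat) : seq letter :=
  if k is k'.+1 then flatten (map (word_at k') (words k'))
  else [:: La; Lb; Lc; Ld].

Definition letter_at k p : letter := nth La (words k) p.

(** Index, at level k + 1, of the leftmost floor inside floor [p] of level k. *)
Definition start (k p : nat) : nat := size (flatten (map (word_at k) (take p (words k)))).

Lemma startS k p : (p < size (words k))%N ->
  start k p.+1 = (start k p + size (word_at k (letter_at k p)))%N.
Proof.
by move=> pk; rewrite /start (take_nth La pk) map_rcons flatten_rcons size_cat.
Qed.

Lemma start_le k p p' : (p <= p')%N -> (p' <= size (words k))%N ->
  (start k p <= start k p')%N.
Proof.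
move=> + pk; elim: p' pk => [|p' IH] pk; first by rewrite leqn0 => /eqP ->.
rewrite leq_eqVlt => /predU1P[->//|]; rewrite ltnS => /IH H.
by rewrite startS //; apply: leq_trans (leq_addr _ _); apply: H; exact: ltnW.
Qed.

Lemma size_wordsS k : size (words k.+1) = start k (size (words k)).
Proof. by rewrite /start take_size. Qed.

Lemma start_lt k p p' q : (p < p')%N -> (p' <= size (words k))%N ->
  (q < size (word_at k (letter_at k p)))%N -> (start k p + q < start k p')%N.
Proof.
move=> pp pk qk; have pk' : (p < size (words k))%N by exact: leq_trans pk.
by apply: (@leq_trans (start k p.+1)); [rewrite startS // ltn_add2l|exact: start_le].
Qed.

Lemma index_lt k p q : (p < size (words k))%N ->
  (q < size (word_at k (letter_at k p)))%N -> (start k p + q < size (words k.+1))%N.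
Proof. by move=> pk qk; rewrite size_wordsS start_lt. Qed.

Lemma index_split k i : (i < size (words k.+1))%N ->
  exists p q, [/\ (p < size (words k))%N,
    (q < size (word_at k (letter_at k p)))%N & i = (start k p + q)%N].
Proof.
rewrite size_wordsS.
suff H n : (n <= size (words k))%N -> (i < start k n)%N ->
    exists p q, [/\ (p < n)%N, (q < size (word_at k (letter_at k p)))%N
      & i = (start k p + q)%N] by move=> /(H _ (leqnn _)).
elim: n => [|n IH] nk; first by rewrite /start take0.
rewrite startS // => lt; have [/(IH (ltnW nk))[p [q [pn qk e]]]|ge] := ltnP i (start k n).
  by exists p, q; split => //; exact: ltnW.
by exists n, (i - start k n)%N; split => //; lia.
Qed.

Lemma take_wordsS k p q : (p < size (words k))%N ->
  (q <= size (word_at k (letter_at k p)))%N ->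
  take (start k p + q) (words k.+1) =
  flatten (map (word_at k) (take p (words k))) ++ take q (word_at k (letter_at k p)).
Proof.
move=> pk qk.
have -> : words k.+1 = flatten (map (word_at k) (take p (words k))) ++
    word_at k (letter_at k p) ++ flatten (map (word_at k) (drop p.+1 (words k))).
  rewrite -[LHS]/(flatten (map (word_at k) (words k))).
  rewrite -[in LHS](cat_take_drop p (words k)) (drop_nth La pk).
  by rewrite map_cat flatten_cat.
rewrite take_cat /start ltnNge leq_addr /= addKn take_cat.
case: ltnP => // qk'; have -> : q = size (word_at k (letter_at k p)) by apply/eqP; rewrite eqn_leq qk.
by rewrite subnn take0 cats0 take_size.
Qed.

Lemma letter_atS k p q : (p < size (words k))%N ->
  (q < size (word_at k (letter_at k p)))%N ->
  letter_at k.+1 (start k p + q) = nth La (word_at k (letter_at k p)) q.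
Proof.
move=> pk qk; rewrite /letter_at.
rewrite -(@nth_take (start k p + q.+1)) ?ltn_add2l // take_wordsS //.
rewrite nth_cat /start ltnNge leq_addr /= addKn nth_take //.
Qed.

Section Positions.
Variables (R : realType).
Hypothesis MN : growth_condition M N.

(** Left endpoint of floor [p]. Only the lengths depend on [l], the index does not, which allows
    different exchanges to be compared endpoint by endpoint. *)
Definition pos (l : nat -> letter -> R) (k p : nat) : R :=
  lensum (l k) (take p (words k)).

Lemma pos0 l k : pos l k 0 = 0.
Proof. by rewrite /pos take0 lensum_nil. Qed.

Lemma posD1 l k p : (p < size (words k))%N ->
  pos l k p.+1 = pos l k p + l k (letter_at k p).
Proof.
by move=> pk; rewrite /pos (take_nth La pk) -cats1 lensum_cat lensum_cons lensum_nil addr0.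
Qed.

Lemma lensum_words (v : letter -> R) k : lensum v (words k) = dot (height R M N k) v.
Proof.
have MNp j : (0 < M j)%N /\ (0 < N j)%N.
  by have := growth_M MN j; have := growth_N MN j; lia.
elim: k v => [|k IH] v.
  by rewrite /dot /= !lensum_cons lensum_nil !mul1r addr0 !addrA.
rewrite dot_heightS -IH /=; elim: (words k) => [|a s IHs]; first by rewrite !lensum_nil.
have [? ?] := MNp k.
by rewrite /= lensum_cat lensum_cons IHs lensum_child.
Qed.

Section System.
Variable l : nat -> letter -> R.
Hypothesis lsys : length_system M N l.

Lemma pos_size k : pos l k (size (words k)) = 1.
Proof. by rewrite /pos take_size lensum_words; exact: system_dot. Qed.

Lemma lensum_word_at k a : lensum (l k.+1) (word_at k a) = l k a.
Proof.
have [E _ _] := lsys; rewrite E lensum_child //.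
  by have := growth_M MN k; lia.
by have := growth_N MN k; lia.
Qed.

Lemma posS k p q : (p < size (words k))%N ->
  (q <= size (word_at k (letter_at k p)))%N ->
  pos l k.+1 (start k p + q) =
  pos l k p + lensum (l k.+1) (take q (word_at k (letter_at k p))).
Proof.
move=> pk qk; rewrite /pos take_wordsS // lensum_cat; congr (_ + _).
elim: (take p _) => [|a s IH]; first by rewrite !lensum_nil.
by rewrite /= lensum_cat lensum_cons IH lensum_word_at.
Qed.

Lemma pos_start k p : (p <= size (words k))%N -> pos l k.+1 (start k p) = pos l k p.
Proof.
rewrite leq_eqVlt => /predU1P[->|pk]; first by rewrite -size_wordsS !pos_size.
by rewrite -[start k p]addn0 posS // take0 lensum_nil addr0.
Qed.

Lemma pos_lt k p p' : (p < p')%N -> (p' <= size (words k))%N -> pos l k p < pos l k p'.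
Proof.
have l0 a : 0 < l k a by case: lsys.
elim: p' => [//|p' IH]; rewrite ltnS leq_eqVlt => /predU1P[->|pp] pk.
  by rewrite posD1 // ltrDl.
by rewrite posD1 // ltr_wpDr // ?ltW // IH // ltnW.
Qed.

Lemma pos_le k p p' : (p <= p')%N -> (p' <= size (words k))%N -> pos l k p <= pos l k p'.
Proof. by rewrite leq_eqVlt => /predU1P[->//|pp pk]; exact/ltW/pos_lt. Qed.

Lemma pos_ltW k p p' : (p <= size (words k))%N -> pos l k p < pos l k p' -> (p < p')%N.
Proof.
by move=> pk; rewrite ltNge; apply: contraNltn => pp; exact: pos_le.
Qed.

Lemma pos_ge0 k p : 0 <= pos l k p.
Proof. by apply: lensum_ge0 => a; case: lsys => _ l0 _; exact: ltW. Qed.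

Lemma pos_le1 k p : pos l k p <= 1.
Proof.
have [pk|pk] := leqP p (size (words k)); first by rewrite -(pos_size k) pos_le.
by rewrite /pos take_oversize ?(ltnW pk) // -(pos_size k) /pos take_size.
Qed.

Lemma pos_cover k y : 0 <= y < 1 ->
  exists2 p, (p < size (words k))%N & pos l k p <= y < pos l k p.+1.
Proof.
move=> /andP[y0 y1].
suff H n : (n <= size (words k))%N -> y < pos l k n ->
    exists2 p, (p < n)%N & pos l k p <= y < pos l k p.+1.
  by apply: H; rewrite ?pos_size.
elim: n => [|n IH] nk; first by rewrite pos0 ltNge y0.
have [le|lt] := lerP (pos l k n) y; first by exists n => //; rewrite le.
by move=> _; have [p pn H] := IH (ltnW nk) lt; exists p => //; exact: ltnW.
Qed.

Lemma pos_unique k p p' y : (p < size (words k))%N -> (p' < size (words k))%N ->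
  pos l k p <= y < pos l k p.+1 -> pos l k p' <= y < pos l k p'.+1 -> p = p'.
Proof.
move=> pk pk' /andP[h1 h2] /andP[h3 h4].
have := pos_ltW (ltnW pk) (le_lt_trans h1 h4).
by have := pos_ltW (ltnW pk') (le_lt_trans h3 h2); lia.
Qed.

End System.

(** One index [D] serves all length systems at once, so an inequality between endpoints of different
    levels can be carried from one exchange to another through a common finer level. *)
Lemma pos_descendant k K p : (k <= K)%N -> (p <= size (words k))%N ->
  exists2 D, (D <= size (words K))%N
    & forall l, length_system M N l -> pos l K D = pos l k p.
Proof.
elim: K => [|K IH]; first by rewrite leqn0 => /eqP -> pk; exists p.
rewrite leq_eqVlt => /predU1P[-> pk|]; first by exists p.
rewrite ltnS => /IH H /H[D DK HD]; exists (start K D).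
  by rewrite size_wordsS start_le.
by move=> l lsys; rewrite pos_start // HD.
Qed.

End Positions.
End Words.

(** * Return itineraries of the induced exchange *)

Lemma child_word_rev m n a : child_word true m n a = rev (child_word false m n a).
Proof.
case: a => //=.
- apply: (@eq_from_nth _ La); rewrite ?size_rev !size_mkseq // => i im.
  rewrite nth_rev ?size_mkseq // !nth_mkseq //; last by lia.
  by rewrite /patternb; congr (if _ then _ else _); lia.
- apply: (@eq_from_nth _ La); rewrite ?size_rev !size_mkseq // => i im.
  rewrite nth_rev ?size_mkseq // !nth_mkseq //; last by lia.
  rewrite /patternc.
  have H : ((i %% 4 < 3) && (((4 * n).-1 - i.+1) %% 4 == 2 - i %% 4) ||
      (i %% 4 == 3) && (((4 * n).-1 - i.+1) %% 4 == 3))%N by lia.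
  move: (i %% 4)%N (((4 * n).-1 - i.+1) %% 4)%N H => r r'.
  by case: r => [|[|[|[|r]]]] //=; rewrite ?orbF => /eqP ->.
Qed.

(* [(a, q) \in visits m n b] when the q-th letter of the word of [a] is [b]; the
   order is that in which an interval of type [b] visits the intervals of the
   previous level before it returns. *)
Definition visits (m n : nat) (b : letter) : seq (letter * nat) :=
  match b with
  | La => (Ld, 3) :: [seq (Lb, j.*2.+1) | j <- iota 0 m.-1]
                  ++ [seq (Lc, 4 * j) | j <- iota 0 n]
  | Lb => (Ld, 2) :: [seq (Lb, j.*2) | j <- iota 0 m]
                  ++ [seq (Lc, (4 * j).+1) | j <- iota 0 n]
  | Lc => (Ld, 1) :: (La, 1) :: [seq (Lc, (4 * j).+3) | j <- iota 0 n.-1]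
  | Ld => (Ld, 0) :: (La, 0) :: [seq (Lc, (4 * j).+2) | j <- iota 0 n]
  end%N.

Lemma mem_visits m n a q : (q < size (child_word false m n a))%N ->
  (a, q) \in visits m n (nth La (child_word false m n a) q).
Proof.
case: a => /=.
- by case: q => [|[|]].
- rewrite size_mkseq => qm; rewrite nth_mkseq // /patternb.
  case: ifP => oq /=; rewrite inE mem_cat /=; apply/orP; left; apply/mapP.
    by exists q./2; rewrite ?mem_iota; [lia|congr pair; lia].
  by exists q./2; rewrite ?mem_iota; [lia|congr pair; lia].
- rewrite size_mkseq => qm; rewrite nth_mkseq // /patternc.
  have : (q = 4 * (q %/ 4) + q %% 4)%N by lia.
  have : (q %% 4 < 4)%N by rewrite ltn_mod.
  case: (q %% 4)%N => [|[|[|[|]]]] // _ e; rewrite /= !inE ?mem_cat; apply/orP; right;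
    apply/orP; right; apply/mapP; exists (q %/ 4)%N; rewrite ?mem_iota; try lia;
    by congr pair; lia.
- by case: q => [|[|[|[|]]]].
Qed.

Lemma visitsP m n b a q : (0 < m)%N -> (0 < n)%N -> (a, q) \in visits m n b ->
  (q < size (child_word false m n a))%N /\ nth La (child_word false m n a) q = b.
Proof.
move=> m0 n0.
have vb j : (j < m.*2.-1)%N -> (j < size (child_word false m n Lb))%N /\
    nth La (child_word false m n Lb) j = patternb j.
  by move=> jm /=; rewrite size_mkseq nth_mkseq.
have vc j r : (4 * j + r < (4 * n).-1)%N -> (r < 4)%N ->
    (4 * j + r < size (child_word false m n Lc))%N /\
    nth La (child_word false m n Lc) (4 * j + r) = nth La [:: La; Lb; Ld; Lc] r.
  move=> jm r4 /=; rewrite size_mkseq nth_mkseq // /patternc.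
  by split=> //; rewrite mulnC modnMDl modn_small.
case: b; rewrite /= !inE ?mem_cat.
- case/orP => [/eqP[-> ->] //|/orP[]] /mapP[j]; rewrite mem_iota => jm [-> ->].
    have [|s1 s2] := vb j.*2.+1; first by lia.
    by split; rewrite ?s2 // /patternb /= odd_double.
  by have := vc j 0%N; rewrite addn0; apply => //; lia.
- case/orP => [/eqP[-> ->] //|/orP[]] /mapP[j]; rewrite mem_iota => jm [-> ->].
    have [|s1 s2] := vb j.*2; first by lia.
    by split; rewrite ?s2 // /patternb /= odd_double.
  by have := vc j 1%N; rewrite addn1; apply => //; lia.
- case/or3P => [/eqP[-> ->] //|/eqP[-> ->]//|] /mapP[j]; rewrite mem_iota => jm [-> ->].
  by have := vc j 3%N; rewrite addn3; apply => //; lia.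
- case/or3P => [/eqP[-> ->] //|/eqP[-> ->]//|] /mapP[j]; rewrite mem_iota => jm [-> ->].
  by have := vc j 2%N; rewrite addn2; apply => //; lia.
Qed.

Section Offsets.
Variables (R : realType) (v : letter -> R).

Definition offset (m n : nat) (e : letter * nat) : R :=
  lensum v (take e.2 (child_word false m n e.1)).

Lemma lensum_rev (s : seq letter) : lensum v (rev s) = lensum v s.
Proof. by apply: perm_big; rewrite perm_rev. Qed.

Lemma lensum_take_rev (s : seq letter) q : (q < size s)%N ->
  lensum v (take ((size s).-1 - q) (rev s)) =
  lensum v s - lensum v (take q s) - v (nth La s q).
Proof.
move=> qs; rewrite take_rev.
have -> : (size s - ((size s).-1 - q) = q.+1)%N by lia.
rewrite -[in X in _ = lensum _ X - _ - _](cat_take_drop q.+1 s) lensum_cat.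
rewrite (take_nth La qs) -cats1 lensum_cat lensum_cons lensum_nil.
by rewrite lensum_rev; ring.
Qed.

Lemma offsetb m n j : (j.*2 <= m.*2.-1)%N ->
  offset m n (Lb, j.*2) = j%:R * (v La + v Lb).
Proof. by move=> jm; rewrite /offset lensum_take_mkseq // sum_patternb. Qed.

Lemma offsetb1 m n j : (j.*2.+1 <= m.*2.-1)%N ->
  offset m n (Lb, j.*2.+1) = j%:R * (v La + v Lb) + v Lb.
Proof.
move=> jm; rewrite /offset lensum_take_mkseq // -addn1 iotaD big_cat.
rewrite sum_patternb big_cons big_nil /= addr0.
by rewrite add0n /patternb odd_double.
Qed.

Lemma offsetc m n j r : (4 * j + r <= (4 * n).-1)%N -> (r < 4)%N ->
  offset m n (Lc, 4 * j + r)%N =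
  j%:R * (v La + v Lb + v Lc + v Ld) + lensum v (take r [:: La; Lb; Ld]).
Proof.
move=> jm r4; rewrite /offset lensum_take_mkseq // iotaD big_cat.
rewrite sum_patternc add0n; congr (_ + _).
have e i : ((4 * j + i) %% 4 = i %% 4)%N by rewrite mulnC modnMDl.
have := e 0%N; have := e 1%N; have := e 2%N; have := e 3%N.
rewrite addn0 addn1 addn2 addn3 /patternc => e3 e2 e1 e0.
case: r r4 jm => [|[|[|[|]]]] //= _ _; rewrite ?big_nil ?big_cons ?big_nil ?lensum_cons ?lensum_nil //;
  by rewrite /patternc ?e0 ?e1 ?e2 ?e3.
Qed.

End Offsets.

Section Itinerary.
Variable R : realType.
Implicit Types v : letter -> R.

Definition total v : R := v La + v Lb + v Lc + v Ld.

Definition before v (a : letter) : R :=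
  match a with
  | La => 0
  | Lb => v La
  | Lc => v La + v Lb
  | Ld => v La + v Lb + v Lc
  end.

Definition image_before v (a : letter) : R :=
  match a with
  | La => v Ld + v Lb
  | Lb => v Ld
  | Lc => v Ld + v Lb + v La
  | Ld => 0
  end.

(* Left endpoint of the mirror image of [x, x + len[ in an interval of length [tot]. *)
Definition orient (o : bool) (tot x len : R) : R := if o then tot - x - len else x.

Lemma path_map_iota (T : Type) (J : rel T) (f : nat -> T) i n x :
  ((0 < n)%N -> J x (f i)) ->
  (forall j, (i <= j)%N -> (j.+1 < i + n)%N -> J (f j) (f j.+1)) ->
  path J x (map f (iota i n)).
Proof.
elim: n i x => [//|n IH] i x H0 H /=.
rewrite H0 //= IH // => [n0|j ij jn]; first by apply: H; lia.
by apply: H; lia.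
Qed.

Lemma last_map_iota (T : Type) (f : nat -> T) i n x :
  (0 < n)%N -> last x (map f (iota i n)) = f (i + n.-1)%N.
Proof. by case: n => [//|n] _; rewrite -addn1 iotaD map_cat last_cat addn1. Qed.

Section Step.
Variables (m n : nat) (w : letter -> R).
Hypotheses (m2 : (1 < m)%N) (n2 : (1 < n)%N).
Let v := keane_mul m n w.
Local Notation off := (offset w m n).

(* T maps the last floor of the tower of [e.1] onto the bottom of the next tower visited:
   the returning subinterval of [e] is the starting subinterval of [e']. *)
Definition junction : rel (letter * nat) := fun e e' =>
  image_before v e.1 + off e == before v e'.1 + off e'.

Let offd q : off (Ld, q) = lensum w (take q [:: Ld; Lc; Lb; La]).
Proof. by []. Qed.

Let offa q : off (La, q) = lensum w (take q [:: Ld; Lc]).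
Proof. by []. Qed.

Let offb j : (j < m)%N -> off (Lb, j.*2) = j%:R * (w La + w Lb).
Proof. by move=> jm; rewrite offsetb //; lia. Qed.

Let offb1 j : (j < m.-1)%N -> off (Lb, j.*2.+1) = j%:R * (w La + w Lb) + w Lb.
Proof. by move=> jm; rewrite offsetb1 //; lia. Qed.

Let offc j r : (4 * j + r <= (4 * n).-1)%N -> (r < 4)%N ->
  off (Lc, (4 * j + r)%N) =
  j%:R * (w La + w Lb + w Lc + w Ld) + lensum w (take r [:: La; Lb; Ld]).
Proof. exact: offsetc. Qed.

Let offc0 j : (j < n)%N -> off (Lc, (4 * j)%N) = j%:R * (w La + w Lb + w Lc + w Ld).
Proof.
move=> jn; have := @offc j 0%N; rewrite addn0 lensum_nil addr0; apply => //; lia.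
Qed.

Let offc1 j : (j < n)%N ->
  off (Lc, (4 * j).+1) = j%:R * (w La + w Lb + w Lc + w Ld) + w La.
Proof.
move=> jn; have := @offc j 1%N; rewrite addn1 /= lensum_cons lensum_nil addr0.
by apply => //; lia.
Qed.

Let offc2 j : (j < n)%N ->
  off (Lc, (4 * j).+2) = j%:R * (w La + w Lb + w Lc + w Ld) + (w La + w Lb).
Proof.
move=> jn; have := @offc j 2%N; rewrite addn2 /= !lensum_cons lensum_nil addr0.
by apply => //; lia.
Qed.

Let offc3 j : (j < n.-1)%N ->
  off (Lc, (4 * j).+3) = j%:R * (w La + w Lb + w Lc + w Ld) + (w La + w Lb + w Ld).
Proof.
move=> jn; have := @offc j 3%N; rewrite addn3 /= !lensum_cons lensum_nil addr0 !addrA.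
by apply => //; lia.
Qed.

Let natm : (m.-1)%:R = m%:R - 1 :> R.
Proof. by rewrite -subn1 natrB // ltnW. Qed.

Let natm2 : (m.-2)%:R = m%:R - 2 :> R.
Proof. by rewrite -subn2 natrB. Qed.

Let natn : (n.-1)%:R = n%:R - 1 :> R.
Proof. by rewrite -subn1 natrB // ltnW. Qed.

Let natn2 : (n.-2)%:R = n%:R - 2 :> R.
Proof. by rewrite -subn2 natrB. Qed.

Definition first_visit (b : letter) : letter * nat :=
  (Ld, match b with La => 3 | Lb => 2 | Lc => 1 | Ld => 0 end)%N.

Definition last_visit (b : letter) : letter * nat :=
  (Lc, match b with
       | La => 4 * n.-1
       | Lb => (4 * n.-1).+1
       | Lc => (4 * n.-2).+3
       | Ld => (4 * n.-1).+2
       end)%N.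

Lemma visits_first b : visits m n b = first_visit b :: behead (visits m n b).
Proof. by case: b. Qed.

(** The exchange is induced on its last interval, of letter d and length [v Ld = total w]. The right
    side is a mirrored position: read from right to left, the new intervals stand in the order a, b,
    c, d. *)
Lemma first_visit_offset b :
  before v Ld + off (first_visit b) = total v - before w b - w b.
Proof.
rewrite /first_visit offd /total; case: b; rewrite /= ?lensum_cons lensum_nil /=; ring.
Qed.

Lemma last_visit_last b : last (first_visit b) (behead (visits m n b)) = last_visit b.
Proof.
have n0 : (0 < n)%N by exact: ltnW.
have n10 : (0 < n.-1)%N by rewrite -subn1 subn_gt0.
by case: b; rewrite /= ?last_cat last_map_iota.
Qed.

(** The returns fill the same interval with the images in the mirrored order of d, b, a, c. Together
    with [first_visit_offset] this makes the induced map a mirrored (4213) exchange, which is why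
    the orientation alternates. *)
Lemma last_visit_offset b :
  image_before v Lc + off (last_visit b) = total v - image_before w b - w b.
Proof.
rewrite /last_visit; case: b.
- by rewrite offc0 ?natn /total /v /=; [ring|lia].
- by rewrite offc1 ?natn /total /v /=; [ring|lia].
- by rewrite offc3 ?natn2 /total /v /=; [ring|lia].
- by rewrite offc2 ?natn /total /v /=; [ring|lia].
Qed.

(** T moves I_b to the right by [v Ld - v La = w La + w Lb] and I_c by [v Ld = total w]. These are
    the periods of the words of b and c, so an orbit runs through each word one period at a time. *)
Lemma visits_path b : path junction (first_visit b) (behead (visits m n b)).
Proof.
have m0' : (0 < m)%N by exact: ltnW.
have m10 : (0 < m.-1)%N by rewrite -subn1 subn_gt0.
case: b => /=; rewrite ?cat_path /first_visit.
- apply/andP; split.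
    apply: path_map_iota => [m0|j _ jm]; apply/eqP; rewrite /= ?offd ?offb1 /=; try lia.
      by rewrite !lensum_cons lensum_nil /v /=; ring.
    by rewrite /v /= -natr1; ring.
  rewrite last_map_iota // add0n; apply: path_map_iota => [_|j _ jn].
    by apply/eqP; rewrite /= offb1 ?offc0 ?natm2 /v /=; [ring|lia|lia].
  by apply/eqP; rewrite /= !offc0 /v /= -?natr1; [ring|lia|lia].
- apply/andP; split.
    apply: path_map_iota => [m0|j _ jm]; apply/eqP; rewrite /= ?offd ?offb /=; try lia.
      by rewrite !lensum_cons lensum_nil /v /=; ring.
    by rewrite /v /= -natr1; ring.
  rewrite last_map_iota // add0n; apply: path_map_iota => [_|j _ jn].
    by apply/eqP; rewrite /= offb ?offc1 ?natm /v /=; [ring|lia|lia].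
  by apply/eqP; rewrite /= !offc1 /v /= -?natr1; [ring|lia|lia].
- apply/andP; split.
    by apply/eqP; rewrite offd offa /= !lensum_cons lensum_nil /v /=; ring.
  apply: path_map_iota => [n0|j _ jn]; apply/eqP; rewrite /= ?offa ?offc3 /=; try lia.
    by rewrite !lensum_cons lensum_nil /v /=; ring.
  by rewrite /v /= -natr1; ring.
- apply/andP; split.
    by apply/eqP; rewrite offd offa /= !lensum_nil /v /=; ring.
  apply: path_map_iota => [n0|j _ jn]; apply/eqP; rewrite /= ?offa ?offc2 /=; try lia.
    by rewrite !lensum_nil /v /=; ring.
  by rewrite /v /= -natr1; ring.
Qed.

End Step.
End Itinerary.

(** * Towers *)

Section Translation.
Variables (R : realType) (T : R -> R).

Definition translates (len x z : R) : Prop :=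
  forall y, x <= y < x + len -> T y = y + (z - x).

Fixpoint translates_along (len x : R) (s : seq R) (z : R) : Prop :=
  if s is y :: s' then translates len x y /\ translates_along len y s' z
  else translates len x z.

Lemma translates_along_cat len x s y s' z :
  translates_along len x s y -> translates_along len y s' z ->
  translates_along len x (s ++ y :: s') z.
Proof. by elim: s x => [|u s IH] x //= [H1 H2] H3; split => //; exact: IH. Qed.

Lemma translates_along_shift len len' o x s z :
  0 <= o -> o + len' <= len -> translates_along len x s z ->
  translates_along len' (x + o) [seq y + o | y <- s] (z + o).
Proof.
move=> o0 ol.
have sh u u' : translates len u u' -> translates len' (u + o) (u' + o).
  move=> H y /andP[y1 y2]; rewrite H; last by apply/andP; split; lra.
  by congr (_ + _); ring.
by elim: s x => [|u s IH] x /=; [exact: sh|case=> /sh ? /IH].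
Qed.

End Translation.

Section Towers.
Variables (R : realType) (M N : nat -> nat).
Hypothesis MN : growth_condition M N.
Variable l : nat -> letter -> R.
Hypothesis lsys : length_system M N l.
Local Notation T := (iet4213 (to_vector (l 0))).
Local Notation word := (word_at M N).
Local Notation W := (words M N).
Local Notation letterW := (letter_at M N).
Local Notation P := (pos M N l).

(** The positions in [visits] refer to the unmirrored words; at odd levels the words are reversed
    and positions count from the right. *)
Definition visit_index k (e : letter * nat) : nat :=
  if odd k then ((size (word k e.1)).-1 - e.2)%N else e.2.

Definition index_of (a : letter) : nat :=
  match a with La => 0 | Lb => 1 | Lc => 2 | Ld => 3 end%N.

(* The floors of the tower of [a], in the order of the orbit. *)
Fixpoint tower (k : nat) (a : letter) : seq nat :=
  if k is k'.+1 then
    flatten [seq [seq (start M N k' p + visit_index k' e)%N | p <- tower k' e.1]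
            | e <- visits (M k') (N k') a]
  else [:: index_of a].

Lemma visit_indexP k b e : e \in visits (M k) (N k) b ->
  (visit_index k e < size (word k e.1))%N /\ nth La (word k e.1) (visit_index k e) = b.
Proof.
case: e => a q /visitsP[].
- by have := growth_M MN k; lia.
- by have := growth_N MN k; lia.
move=> qs nq; rewrite /visit_index /word_at /=.
case: (odd k) => //; rewrite child_word_rev size_rev; split; first by lia.
rewrite nth_rev; last by lia.
by rewrite -[RHS]nq; congr nth; lia.
Qed.

Lemma mem_visit_index k a q : (q < size (word k a))%N ->
  exists2 e, e \in visits (M k) (N k) (nth La (word k a) q)
    & e.1 = a /\ visit_index k e = q.
Proof.
rewrite /word_at => qs; rewrite /visit_index /word_at.
case: (odd k) qs => qs; last by exists (a, q) => //; exact: mem_visits.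
move: qs; rewrite child_word_rev size_rev => qs.
exists (a, (size (child_word false (M k) (N k) a)).-1 - q)%N => /=.
  rewrite nth_rev //.
  have e : ((size (child_word false (M k) (N k) a)).-1 - q =
            size (child_word false (M k) (N k) a) - q.+1)%N by lia.
  by rewrite -e; apply: mem_visits; lia.
by split=> //; rewrite child_word_rev size_rev; lia.
Qed.

Lemma towerP k a p : p \in tower k a -> (p < size (W k))%N /\ letterW k p = a.
Proof.
elim: k a p => [|k IH] a p /=.
  by rewrite inE => /eqP ->; case: a.
move=> /flattenP[s /mapP[e ev ->] /mapP[p' /IH[ps' lp'] ->]].
have [qs nq] := visit_indexP ev.
have qs' : (visit_index k e < size (word k (letterW k p')))%N by rewrite lp'.
by rewrite index_lt // letter_atS // lp'.
Qed.

Lemma mem_tower k p : (p < size (W k))%N -> p \in tower k (letterW k p).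
Proof.
elim: k p => [|k IH] p; first by case: p => [|[|[|[|]]]].
move=> /index_split[p' [q [ps qs ->]]]; rewrite letter_atS //.
have [e ev [e1 e2]] := mem_visit_index qs.
apply/flattenP; exists [seq (start M N k p + visit_index k e)%N | p <- tower k e.1].
  by apply/mapP; exists e.
by apply/mapP; exists p'; [rewrite e1 IH|rewrite e2].
Qed.

(* Left endpoint of the interval on which T is induced at level k. *)
Fixpoint corner (k : nat) : R :=
  if k is k'.+1 then corner k' + (if odd k' then 0 else before (l k') Ld) else 0.

(** Left end of the interval of letter [a] in the exchange induced at level k; [return_pos] is the
    left end of its image under the first return map. *)
Definition base_pos k a := corner k + orient (odd k) (total (l k)) (before (l k) a) (l k a).

Definition return_pos k a :=
  corner k + orient (odd k) (total (l k)) (image_before (l k) a) (l k a).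

Definition visit_offset k (e : letter * nat) : R :=
  lensum (l k.+1) (take (visit_index k e) (word k e.1)).

Let lE k : l k = keane_mul (M k) (N k) (l k.+1).
Proof. by apply/funext => a; case: lsys. Qed.

Lemma visit_offsetE k b e : e \in visits (M k) (N k) b ->
  visit_offset k e =
  orient (odd k) (l k e.1) (offset (l k.+1) (M k) (N k) e) (l k.+1 b).
Proof.
case: e => a q; rewrite /visit_offset /visit_index /offset /= => ev.
have [qs nq] : (q < size (child_word false (M k) (N k) a))%N /\
    nth La (child_word false (M k) (N k) a) q = b.
  by apply: visitsP ev; [have := growth_M MN k; lia|have := growth_N MN k; lia].
have := lensum_word_at MN lsys k a; rewrite /word_at /orient.
case: (odd k) => //; rewrite child_word_rev size_rev lensum_take_rev // nq => <-.
by rewrite lensum_rev.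
Qed.

Lemma visit_offset_bound k b e : e \in visits (M k) (N k) b ->
  0 <= visit_offset k e /\ visit_offset k e + l k.+1 b <= l k e.1.
Proof.
move=> /visit_indexP[qs nq]; have l0 a : 0 <= l k.+1 a by case: lsys => _ H _; exact: ltW.
split; first exact: lensum_ge0.
rewrite -(lensum_word_at MN lsys k e.1) -[in leRHS](cat_take_drop (visit_index k e) (word k e.1)).
rewrite lensum_cat lerD2l (drop_nth La) // nq lensum_cons lerDl.
exact: lensum_ge0.
Qed.

Lemma junction_pos k b e e' :
  e \in visits (M k) (N k) b -> e' \in visits (M k) (N k) b ->
  junction (M k) (N k) (l k.+1) e e' ->
  return_pos k e.1 + visit_offset k e = base_pos k e'.1 + visit_offset k e'.
Proof.
move=> ev ev' /eqP; rewrite -lE (visit_offsetE ev) (visit_offsetE ev').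
rewrite /return_pos /base_pos /orient; case: (odd k) => H; last by rewrite -!addrA H.
by move: (offset _ _ _ e) (offset _ _ _ e') H => x x' H; lra.
Qed.

Definition tower_climbs k a := exists p s,
  [/\ tower k a = p :: s, P k p = base_pos k a
    & translates_along T (l k a) (base_pos k a) [seq P k q | q <- s] (return_pos k a)].

(** The part of the new tower that lies over one visit is a narrower copy of the tower of [e.1],
    shifted by a constant offset. *)
Lemma tower_climbs_segment k b e : e \in visits (M k) (N k) b ->
  tower_climbs k e.1 -> exists p s,
  [/\ [seq (start M N k p + visit_index k e)%N | p <- tower k e.1] = p :: s,
      P k.+1 p = base_pos k e.1 + visit_offset k e
    & translates_along T (l k.+1 b) (base_pos k e.1 + visit_offset k e)
        [seq P k.+1 q | q <- s] (return_pos k e.1 + visit_offset k e)].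
Proof.
move=> ev [p [s [ts Pp H]]].
have [qs nq] := visit_indexP ev; have [ge0 ol] := visit_offset_bound ev.
have E q : q \in tower k e.1 ->
    P k.+1 (start M N k q + visit_index k e)%N = P k q + visit_offset k e.
  by move=> /towerP[ps lp]; rewrite posS // ?lp // ltnW.
exists (start M N k p + visit_index k e)%N,
  [seq (start M N k q + visit_index k e)%N | q <- s]; split; first by rewrite ts.
  by rewrite E ?Pp // ts mem_head.
rewrite -map_comp.
rewrite (eq_in_map _ (fun q => P k q + visit_offset k e) _).1.
  by rewrite (map_comp (fun x => x + visit_offset k e)); exact: translates_along_shift H.
by move=> q qs' /=; rewrite E // ts inE qs' orbT.
Qed.

Lemma tower_climbs_path k b e es :
  (forall a, tower_climbs k a) ->
  {subset e :: es <= visits (M k) (N k) b} ->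
  path (junction (M k) (N k) (l k.+1)) e es -> exists p s,
  [/\ flatten [seq [seq (start M N k p + visit_index k e)%N | p <- tower k e.1]
              | e <- e :: es] = p :: s,
      P k.+1 p = base_pos k e.1 + visit_offset k e
    & translates_along T (l k.+1 b) (base_pos k e.1 + visit_offset k e)
        [seq P k.+1 q | q <- s]
        (return_pos k (last e es).1 + visit_offset k (last e es))].
Proof.
move=> climbs; elim: es e => [|e' es IH] e sub /=.
  move=> _; have [|p [s [H1 H2 H3]]] := @tower_climbs_segment k b e _ (climbs e.1).
    by apply: sub; rewrite mem_head.
  by exists p, s; rewrite cats0.
move=> /andP[J Jp].
have ev : e \in visits (M k) (N k) b by apply: sub; rewrite mem_head.
have ev' : e' \in visits (M k) (N k) b by apply: sub; rewrite !inE eqxx orbT.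
have [p [s [H1 H2 H3]]] := tower_climbs_segment ev (climbs e.1).
have [|p' [s' [H1' H2' H3']]] := IH e' _ Jp.
  by move=> x xs; apply: sub; rewrite inE xs orbT.
exists p, (s ++ p' :: s'); split => //; first by rewrite H1 -H1'.
rewrite map_cat /= H2'; apply: translates_along_cat; last exact: H3'.
by rewrite -(junction_pos ev ev' J).
Qed.

Lemma pos_index_of a : P 0 (index_of a) = before (l 0) a.
Proof.
by case: a; rewrite /pos /= ?lensum_cons ?lensum_nil /=; ring.
Qed.

Lemma iet_left_before (v : letter -> R) (j : 'I_4) :
  iet_left (to_vector v) j = before v (letter_of j).
Proof.
rewrite /iet_left big_mkcond !big_ord_recl big_ord0 !mxE.
by case: j => -[|[|[|[|]]]] //= _; ring.
Qed.

Lemma iet_image_left_before (v : letter -> R) (j : 'I_4) :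
  iet_image_left (to_vector v) j = image_before v (letter_of j).
Proof.
rewrite /iet_image_left big_mkcond !big_ord_recl big_ord0 !mxE.
by case: j => -[|[|[|[|]]]] //= _; ring.
Qed.

Lemma iet4213_translates a :
  translates T (l 0 a) (before (l 0) a) (image_before (l 0) a).
Proof.
have [_ l0 _] := lsys; have la := l0 0%N La; have lb := l0 0%N Lb.
have lc := l0 0%N Lc; have ld := l0 0%N Ld.
move=> y ya; rewrite /iet4213; congr (_ + _).
have E c : (before (l 0) c <= y < before (l 0) c + l 0 c) = (c == a).
  have [->|ca] := eqVneq c a; first by rewrite ya.
  apply/negbTE/negP => /andP[y1 y2]; move/andP: ya => [y3 y4].
  by case: c a ca y1 y2 y3 y4 => [] [] //=; lra.
have I j : \1_(iet_interval (to_vector (l 0)) j) y = (letter_of j == a)%:R :> R.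
  by rewrite indicE mem_setE in_itv /= !iet_left_before mxE E.
rewrite (eq_bigr (fun j => (image_before (l 0) (letter_of j) -
    before (l 0) (letter_of j)) * (letter_of j == a)%:R)); last first.
  by move=> j _; rewrite I iet_left_before iet_image_left_before.
rewrite !big_ord_recl big_ord0 /letter_of /=.
by case: a {ya E I} => /=; ring.
Qed.

(** The segments over successive visits are glued at their junctions; the first visit provides the
    new base and the last one the new return. *)
Lemma climbs k a : tower_climbs k a.
Proof.
elim: k a => [|k IH] b.
  exists (index_of b), [::]; split => //.
    by rewrite pos_index_of /base_pos /= add0r.
  by rewrite /base_pos /return_pos /= !add0r; exact: iet4213_translates.
have m2 : (1 < M k)%N by have := growth_M MN k; lia.
have n2 : (1 < N k)%N by have := growth_N MN k; lia.
have sub : {subset first_visit b :: behead (visits (M k) (N k) b) <= visits (M k) (N k) b}.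
  by rewrite -visits_first.
have [p [s [H1 H2 H3]]] := tower_climbs_path IH sub (visits_path (l k.+1) m2 n2 b).
have dt : l k Ld = total (l k.+1) by rewrite lE.
(* The orientation flips: what is mirrored at level k is plain at level k + 1 and conversely, while
   [corner] moves to the left end of the new inducing interval. *)
have e1 : base_pos k Ld + visit_offset k (first_visit b) = base_pos k.+1 b.
  rewrite (@visit_offsetE k b); last by apply: sub; rewrite mem_head.
  have := first_visit_offset (M k) (N k) (l k.+1) b; rewrite -lE.
  rewrite /base_pos /= /orient; move: (offset _ _ _ _) => x; rewrite /total in dt *.
  by case: (odd k) => /=; lra.
have e2 : return_pos k Lc + visit_offset k (last_visit (N k) b) = return_pos k.+1 b.
  rewrite (@visit_offsetE k b); last by apply: sub; rewrite -(last_visit_last (M k) n2) mem_last.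
  have := last_visit_offset (l k.+1) m2 n2 b; rewrite -lE.
  rewrite /return_pos /= /orient; move: (offset _ _ _ _) => x; rewrite /total in dt *.
  by case: (odd k) => /=; lra.
exists p, s; split; first by rewrite -H1 -visits_first.
  by rewrite H2 -e1.
by move: H3; rewrite last_visit_last //= e1 e2.
Qed.

Definition maps_floor k p' p : Prop := forall y,
  P k p' <= y < P k p'.+1 -> P k p <= T y < P k p.+1.

Lemma translates_maps_floor k p p' : (p < size (W k))%N -> (p' < size (W k))%N ->
  letterW k p' = letterW k p -> translates T (l k (letterW k p)) (P k p') (P k p) ->
  maps_floor k p' p.
Proof.
move=> pk pk' e tr y; rewrite !posD1 // e => yp; rewrite tr //.
by move/andP: yp => [y1 y2]; apply/andP; split; lra.
Qed.

(* Along a tower, every floor but the lowest is the image of the floor below. *)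
Lemma tower_sorted k a :
  exists p s, tower k a = p :: s /\ path (fun p' p => `[< maps_floor k p' p >]) p s.
Proof.
have [p [s [ts Pp tr]]] := climbs k a; exists p, s; split => //.
have : {subset p :: s <= tower k a} by rewrite ts.
move: tr; rewrite -Pp {Pp ts}; elim: s p => [//|q s IH] p /= [tr H] sub.
have [pk lp] := towerP (sub p (mem_head _ _)).
have qs : q \in tower k a by apply: sub; rewrite !inE eqxx orbT.
have [qk lq] := towerP qs.
apply/andP; split.
  by apply/asboolP; apply: translates_maps_floor; rewrite ?lp ?lq.
by apply: IH => // x xs; apply: sub; rewrite inE xs orbT.
Qed.

Lemma tower_const (f : nat -> R) k a :
  (forall p p', (p < size (W k))%N -> (p' < size (W k))%N ->
    letterW k p = a -> letterW k p' = a -> maps_floor k p' p -> f p' = f p) ->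
  forall p p', (p < size (W k))%N -> (p' < size (W k))%N ->
    letterW k p = a -> letterW k p' = a -> f p = f p'.
Proof.
move=> H; have [p0 [s [ts sp]]] := tower_sorted k a.
suff E p : (p < size (W k))%N -> letterW k p = a -> f p = f p0.
  by move=> p p' pk pk' lp lp'; rewrite E // E.
move=> pk lp; have := mem_tower pk; rewrite lp ts.
have : {subset p0 :: s <= tower k a} by rewrite ts.
elim: s p0 sp {ts pk lp} => [|q s IH] p0 /=; first by rewrite inE => _ _ /eqP ->.
move=> /andP[/asboolP mf sp] sub; rewrite inE => /predU1P[->//|pqs].
have [pk lp] := towerP (sub _ (mem_head _ _)).
have [qk lq] : (q < size (W k))%N /\ letterW k q = a.
  by apply: towerP; apply: sub; rewrite !inE eqxx orbT.
rewrite (H q p0 qk pk lq lp mf); apply: IH => // x xs; apply: sub.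
by rewrite inE xs orbT.
Qed.

(** Only the lowest floor of a tower may fail to be the image of a floor of its letter. This leaves
    four exceptions per level, whose mass tends to 0. *)
Lemma floor_preimage k p : (p < size (W k))%N ->
  p = head 0%N (tower k (letterW k p)) \/
  exists p', [/\ (p' < size (W k))%N, letterW k p' = letterW k p & maps_floor k p' p].
Proof.
move=> pk; have := mem_tower pk; have [p0 [s [ts sp]]] := tower_sorted k (letterW k p).
rewrite ts inE => /predU1P[->|ps]; [by left|right].
have sub : {subset p0 :: s <= tower k (letterW k p)} by rewrite ts.
move: ps sub sp; elim: s p0 {ts} => [//|q s IH] p0.
rewrite inE => ps sub /= /andP[/asboolP mf sp].
have [pq|pq] := eqVneq p q.
  have [pk0 lp0] := towerP (sub p0 (mem_head _ _)).
  by exists p0; split => //; rewrite pq.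
have ps' : p \in s by move: ps; rewrite (negbTE pq).
by apply: (IH q) => // x xs; apply: sub; rewrite inE xs orbT.
Qed.

End Towers.

(** * Invariant measures *)

Section FloorMeasure.
Variables (R : realType) (M N : nat -> nat).
Hypothesis MN : growth_condition M N.
Local Notation W := (words M N).
Local Notation letterW := (letter_at M N).
Local Notation P := (pos M N).

Definition floor (l : nat -> letter -> R) k p : set R := `[P l k p, P l k p.+1[.

Section Conjugacy.
Variables (l l' : nat -> letter -> R).
Hypotheses (lsys : length_system M N l) (lsys' : length_system M N l').

Definition lower_ends (y : R) : set R :=
  [set x | exists k p, [/\ (p <= size (W k))%N, P l' k p <= y & x = P l k p]].

Definition conjugacy (y : R) : R := sup (lower_ends y).

Lemma lower_ends_ubound y : ubound (lower_ends y) 1.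
Proof. by move=> _ [k [p [_ _ ->]]]; exact: pos_le1. Qed.

Lemma conjugacy_ge y k p : (p <= size (W k))%N -> P l' k p <= y -> P l k p <= conjugacy y.
Proof.
move=> pk py; apply: ub_le_sup; last by exists k, p.
by exists 1; exact: lower_ends_ubound.
Qed.

Lemma conjugacy_nondecreasing : nondecreasing_fun conjugacy.
Proof.
move=> y1 y2 y12.
have [[x [k [p [pk py xe]]]]|/set0P/negP/negPn/eqP e] := pselect (lower_ends y1 !=set0).
  apply: ge_sup; first by exists x, k, p.
  move=> _ [k' [p' [pk' py' ->]]]; apply: conjugacy_ge => //.
  exact: le_trans y12.
(* No endpoint lies below a negative number, and the supremum of the empty set is 0 by
   convention. *)
rewrite [leLHS]/conjugacy e sup0.
have [[x [k [p [pk py xe]]]]|/set0P/negP/negPn/eqP e'] := pselect (lower_ends y2 !=set0).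
  by apply: le_trans (conjugacy_ge pk py); exact: pos_ge0.
by rewrite /conjugacy e' sup0.
Qed.

Lemma conjugacy_floor k p y : (p < size (W k))%N ->
  floor l' k p y -> floor l k p (conjugacy y).
Proof.
rewrite /floor /= !in_itv /= => pk /andP[py yp].
rewrite conjugacy_ge ?(ltnW pk) //=.
(* The value must stay strictly below the right end. At a level whose floors are shorter than the
   distance from [y] to that end, the floor of [y] ends strictly before it, and the right end of
   that floor bounds all of [lower_ends y]. *)
have [n n0 len] : exists2 n, (k <= n)%N & forall a, l' n a < P l' k p.+1 - y.
  have gap : 0 < P l' k p.+1 - y by rewrite subr_gt0.
  have : (fun n => 2^-1 ^+ n : R) @ \oo --> 0.
    by apply: cvg_expr; rewrite ger0_norm ?invr_ge0 // invf_lt1 // ltr1n.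
  move=> /cvgr_lt /(_ _ gap) [n0 _ H]; exists (maxn k n0); first exact: leq_maxl.
  by move=> a; apply: le_lt_trans (system_le_exp2 MN lsys' _ _) (H _ (leq_maxr _ _)).
have y01 : 0 <= y < 1.
  by rewrite (le_trans _ py) ?pos_ge0 //= (lt_le_trans yp) // pos_le1.
have [i iW /andP[iy yi]] := pos_cover MN lsys' n y01.
have [D DW HD] := pos_descendant R MN n0 pk.
have iD : (i.+1 < D)%N.
  apply: (pos_ltW lsys' (k := n)) => //.
  by rewrite HD // posD1 //; have := len (letterW n i); lra.
apply: le_lt_trans (_ : P l n i.+1 < _); last by rewrite -(HD l) // pos_lt.
apply: ge_sup; first by exists (P l k p), k, p; split => //; exact: ltnW.
move=> _ [k1 [p1 [pk1 py1 ->]]].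
have [D1 DW1 HD1] := pos_descendant R MN (leq_maxl k1 n) pk1.
have [D2 DW2 HD2] := pos_descendant R MN (leq_maxr k1 n) iW.
rewrite -(HD1 l) // -(HD2 l) //; apply: pos_le => //.
apply/ltnW/(pos_ltW lsys' (k := maxn k1 n)) => //.
by rewrite HD1 // HD2 //; exact: le_lt_trans yi.
Qed.

Lemma conjugacy1 : conjugacy 1 = 1.
Proof.
apply/eqP; rewrite eq_le; apply/andP; split.
  apply: ge_sup; last exact: lower_ends_ubound.
  by exists (P l 0 0), 0%N, 0%N; rewrite pos0.
by rewrite -[leLHS](pos_size MN lsys 0) conjugacy_ge // pos_size.
Qed.

(** Negative numbers are sent to 0, into the first floor, hence the intersection with [0, 1]. The
    point 1 is sent to 1, outside every floor. *)
Lemma conjugacy_preimage k p : (p < size (W k))%N ->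
  conjugacy @^-1` floor l k p `&` `[0, 1] = floor l' k p.
Proof.
move=> pk; apply/seteqP; split => y; last first.
  move=> yp; split; first exact: conjugacy_floor.
  move: yp; rewrite /floor /= !in_itv /= => /andP[py yp].
  by rewrite (le_trans _ py) ?pos_ge0 //= (le_trans (ltW yp)) // pos_le1.
move=> [/= Gy]; rewrite in_itv /= [y <= 1]le_eqVlt => /andP[y0 /predU1P[y1|y1]].
  move: Gy; rewrite /floor y1 conjugacy1 /= in_itv /= => /andP[_].
  by rewrite ltNge pos_le1.
have [|i iW iy] := @pos_cover M N R MN l' lsys' k y; first by rewrite y0.
have := @conjugacy_floor k i y iW; rewrite /floor /= !in_itv /= => /(_ iy) Gi.
by move: Gy; rewrite /floor /= in_itv /= => /(pos_unique lsys iW pk Gi) <-.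
Qed.

Lemma exists_floor_measure : exists mu : probability (measurableTypeR R) R,
  forall k p, (p < size (W k))%N -> mu (floor l k p) = (l' k (letterW k p))%:E.
Proof.
have mG : measurable_fun [set: measurableTypeR R] (conjugacy : measurableTypeR R -> measurableTypeR R).
  by apply: nondecreasing_measurable => //; exact: conjugacy_nondecreasing.
pose X : {mfun measurableTypeR R >-> measurableTypeR R} :=
  HB.pack (conjugacy : measurableTypeR R -> measurableTypeR R) (isMeasurableFun.Build _ _ _ _ _ mG).
exists (distribution (uniform_prob (@ltr01 R)) X) => k p pk.
rewrite -[LHS]/(uniform_prob (@ltr01 R) (conjugacy @^-1` floor l k p)).
rewrite /uniform_prob integral_uniform_pdf.
rewrite conjugacy_preimage //.
have le01 y : floor l' k p y -> 0 <= y <= 1.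
  rewrite /floor /= in_itv /= => /andP[py yp].
  by rewrite (le_trans _ py) ?pos_ge0 //= (le_trans (ltW yp)) // pos_le1.
rewrite (eq_integral (cst 1%E)) /=; last first.
  by move=> y; rewrite inE => /le01 y01; rewrite /uniform_pdf y01 subr0 invr1.
rewrite integral_cst ?mul1e; last exact: measurable_itv.
have : lebesgue_measure (floor l' k p) = (P l' k p.+1 - P l' k p)%:E.
  by rewrite /floor lebesgue_measure_itv /= lte_fin pos_lt.
by rewrite posD1 // addrAC subrr add0r.
Qed.

End Conjugacy.
End FloorMeasure.

(** * Invariance and ergodicity by approximation on floors *)

Section FloorSums.
Variables (R : realType) (M N : nat -> nat).
Hypothesis MN : growth_condition M N.
Local Notation W := (words M N).
Local Notation letterW := (letter_at M N).
Local Notation P := (pos M N).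
Local Notation floor := (@floor R M N).

Lemma sum_letters (v : letter -> R) k :
  \sum_(q < size (W k)) v (letterW k q) = dot (height R M N k) v.
Proof. by rewrite -lensum_words // /lensum (big_nth La) big_mkord. Qed.

Variable l : nat -> letter -> R.
Hypothesis lsys : length_system M N l.

Lemma measurable_floor k p : measurable (floor l k p : set (measurableTypeR R)).
Proof. exact: measurable_itv. Qed.

Lemma measure_floors (nu : {measure set (measurableTypeR R) -> \bar R}) k p p' :
  (p <= p')%N -> (p' <= size (W k))%N ->
  nu `[P l k p, P l k p'[%classic = (\sum_(p <= q < p') nu (floor l k q))%E.
Proof.
elim: p' => [|p' IH]; first by rewrite leqn0 => /eqP -> _; rewrite big_geq // set_itvco0 measure0.
rewrite leq_eqVlt => /predU1P[-> _|]; first by rewrite big_geq // set_itvco0 measure0.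
rewrite ltnS => pp pk; rewrite big_nat_recr //= -IH ?(ltnW pk) //.
rewrite -measureU //; [|exact: measurable_itv|].
  congr (nu _); rewrite /floor; apply/seteqP; split => y /=; rewrite !in_itv /=.
    move=> /andP[y1 y2]; have [y3|y3] := ltrP y (P l k p').
      by left; rewrite y1.
    by right.
  move=> [/andP[y1 y2]|/andP[y1 y2]].
    by rewrite y1 /= (lt_trans y2) // pos_lt.
  by rewrite y2 andbT (le_trans _ y1) // pos_le // ltnW.
apply/seteqP; split => y //=; rewrite !in_itv /= => -[/andP[_ y1] /andP[y2 _]].
by move: (lt_le_trans y1 y2); rewrite ltxx.
Qed.

Lemma ray_floors k x : exists p p', [/\ (p <= p')%N, (p' <= size (W k))%N, (p' <= p.+1)%N,
  `[P l k 0, P l k p[ `<=` `]-oo, x[ & `[P l k p', P l k (size (W k))[ `<=` ~` `]-oo, x[].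
Proof.
have [x0|x0] := lerP x 0.
  exists 0%N, 0%N; split => //; first by rewrite set_itvco0.
  move=> y /=; rewrite !in_itv /= pos0 => /andP[y0 _]; apply/negP; rewrite -leNgt.
  exact: le_trans y0.
have [x1|x1] := lerP 1 x.
  exists (size (W k)), (size (W k)); split => //; last by rewrite set_itvco0.
  move=> y /=; rewrite !in_itv /= pos_size // => /andP[_ y1].
  exact: lt_le_trans x1.
have [|p pk /andP[px xp]] := @pos_cover M N R MN l lsys k x; first by rewrite ltW.
exists p, p.+1; split => // y /=; rewrite !in_itv /= => /andP[y1 y2].
  exact: lt_le_trans px.
by apply/negP; rewrite -leNgt (le_trans (ltW xp)).
Qed.

Variable l' : nat -> letter -> R.
Hypothesis lsys' : length_system M N l'.

Definition floor_error (nu : set (measurableTypeR R) -> \bar R) (c : R) k : R :=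
  \sum_(q < size (W k)) `|fine (nu (floor l k q)) - c * l' k (letterW k q)|.

(** The floors inside the ray bound its mass from below; those outside bound the mass of the
    complement, which the total mass c turns into an upper bound. The factor 2 counts the floor
    error and the single undecided floor. *)
Lemma ray_estimate (nu : {measure set (measurableTypeR R) -> \bar R}) (c e : R) k p p' x :
  nu setT = c%:E -> floor_error nu c k <= e -> (forall a, c * l' k a <= e) ->
  (p <= p')%N -> (p' <= size (W k))%N -> (p' <= p.+1)%N ->
  `[P l k 0, P l k p[ `<=` `]-oo, x[ ->
  `[P l k p', P l k (size (W k))[ `<=` ~` `]-oo, x[ ->
  `|fine (nu `]-oo, x[%classic) - c * P l' k p| <= 2 * e.
Proof.
move=> nuT err ce pp' p'k p1 sub1 sub2.
have finnu A : measurable A -> nu A \is a fin_num.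
  move=> mA; rewrite ge0_fin_numE //; apply: (@le_lt_trans _ _ (nu setT)).
    by apply: le_measure; rewrite ?inE.
  by rewrite nuT ltry.
have nuR A : measurable A -> nu A = (fine (nu A))%:E by move=> mA; rewrite fineK // finnu.
have sumnu i j : (i <= j)%N -> (j <= size (W k))%N ->
    fine (nu `[P l k i, P l k j[%classic) = \sum_(i <= q < j) fine (nu (floor l k q)).
  move=> ij jk; rewrite measure_floors // sum_fine // => q _.
  by apply: finnu; exact: measurable_floor.
have suml' i j : (i <= j)%N -> (j <= size (W k))%N ->
    P l' k j - P l' k i = \sum_(i <= q < j) l' k (letterW k q).
  elim: j => [|j IHj]; first by rewrite leqn0 => /eqP ->; rewrite subrr big_geq.
  rewrite leq_eqVlt => /predU1P[-> _|]; first by rewrite subrr big_geq.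
  by rewrite ltnS => ij jk; rewrite big_nat_recr //= -IHj ?(ltnW jk) // posD1 // addrAC.
have sumerr i j : (i <= j)%N -> (j <= size (W k))%N ->
    `|fine (nu `[P l k i, P l k j[%classic) - c * (P l' k j - P l' k i)| <= e.
  move=> ij jk; rewrite sumnu // suml' // mulr_sumr -sumrB.
  apply: le_trans (ler_norm_sum _ _ _) (le_trans _ err).
  rewrite /floor_error -(big_mkord xpredT (fun q => `|fine (nu (floor l k q)) - c * l' k (letterW k q)|)).
  rewrite [leRHS](big_cat_nat (leq0n i) (leq_trans ij jk)) /=.
  rewrite [X in _ <= _ + X](big_cat_nat ij jk) /=.
  by rewrite addrCA lerDl addr_ge0 // sumr_ge0.
have mray : measurable (`]-oo, x[%classic : set (measurableTypeR R)) by exact: measurable_itv.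
have lenu A B : measurable A -> measurable B -> A `<=` B -> fine (nu A) <= fine (nu B).
  by move=> mA mB AB; rewrite fine_le ?finnu // le_measure ?inE.
have low := lenu _ _ (measurable_itv _) mray sub1.
have high := lenu _ _ (measurable_itv _) (measurableC mray) sub2.
have compl : fine (nu `]-oo, x[%classic) + fine (nu (~` `]-oo, x[%classic)) = c.
  rewrite -fineD ?finnu //; last exact: measurableC.
  rewrite -measureU ?setUv ?setICr //; last exact: measurableC.
  by rewrite [X in fine X]nuT.
have pk : (p <= size (W k))%N by exact: leq_trans p'k.
have := sumerr 0%N p (leq0n _) pk; rewrite (pos0 _ _ l') subr0.
have := sumerr p' (size (W k)) p'k (leqnn _); rewrite (pos_size MN lsys').
have pp1 : c * P l' k p' - c * P l' k p <= e.
  move: p1; rewrite leq_eqVlt => /predU1P[p'p|p'p].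
    move: p'k; rewrite p'p => pk'; rewrite posD1 // mulrDr addrAC subrr add0r.
    exact: ce.
  have -> : p' = p by apply/eqP; rewrite eqn_leq pp' andbT.
  rewrite subrr; apply: le_trans err; apply: sumr_ge0 => q _; exact: normr_ge0.
rewrite !ler_norml => /andP[h1 h2] /andP[h3 h4].
by apply/andP; split; lra.
Qed.

(** Rays form a generating pi-system, and [ray_estimate] holds for both [nu] and c times [mu]. It
    serves for invariance, with [nu] the image of [mu] and c = 1, and for ergodicity, with [nu] the
    restriction of [mu] to an invariant set. *)
Lemma floors_determine (mu : probability (measurableTypeR R) R)
    (nu : {measure set (measurableTypeR R) -> \bar R}) (c : R) :
  (forall k p, (p < size (W k))%N -> mu (floor l k p) = (l' k (letterW k p))%:E) ->
  0 <= c -> nu setT = c%:E ->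
  (forall e, 0 < e -> exists2 k, floor_error nu c k <= e & forall a, c * l' k a <= e) ->
  forall A, measurable A -> nu A = (c%:E * mu A)%E.
Proof.
move=> muE c0 nuT err A mA.
pose cmu := mscale (NngNum c0) mu.
suff : nu A = cmu A by [].
have cmuT : cmu setT = c%:E.
  by rewrite /cmu /mscale /= probability_setT mule1.
have cmu_err k : floor_error cmu c k = 0.
  rewrite /floor_error big1 // => q _; rewrite /cmu /mscale /= muE ?ltn_ord //.
  by rewrite subrr normr0.
apply: (@measure_unique _ R (measurableTypeR R) (@RGenInftyO.G R) (fun n => `]-oo, n%:R[%classic)) => //.
- exact: RGenInftyO.measurableE.
- move=> _ _ [x ->] [y ->]; exists (Num.min x y).
  apply/seteqP; split => z /=; rewrite !in_itv /= lt_min; first by move=> [-> ->].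
  by move=> /andP.
- by move=> n; exists n%:R.
- apply/seteqP; split => // x _; exists (Num.truncn `|x|).+1 => //=.
  rewrite in_itv /=; apply: le_lt_trans (ler_norm x) _; exact: truncnS_gt.
- move=> _ [x ->].
  have finE (m : {measure set (measurableTypeR R) -> \bar R}) : m setT = c%:E ->
      m `]-oo, x[%classic = (fine (m `]-oo, x[%classic))%:E.
    move=> mT; rewrite fineK // ge0_fin_numE //; apply: (@le_lt_trans _ _ (m setT)).
      by apply: le_measure; rewrite ?inE //; exact: measurable_itv.
    by rewrite mT ltry.
  rewrite finE // [RHS]finE //; congr (_%:E); apply/eqP; rewrite -subr_eq0 -normr_le0.
  apply/ler_addgt0Pr => e e0; rewrite add0r.
  have [|k err_k ce] := err (e / 4); first by rewrite divr_gt0.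
  have [p [p' [pp' p'k p1 s1 s2]]] := ray_floors k x.
  have := ray_estimate nuT err_k ce pp' p'k p1 s1 s2.
  have := @ray_estimate cmu c (e / 4) k p p' x cmuT _ ce pp' p'k p1 s1 s2.
  rewrite cmu_err => H; have {H} := H (ltW (divr_gt0 e0 (ltr0n R 4))).
  rewrite !ler_norml => /andP[h1 h2] /andP[h3 h4].
  by apply/andP; split; lra.
- move=> n; apply: (@le_lt_trans _ _ (nu setT)); last by rewrite nuT ltry.
  by apply: le_measure; rewrite ?inE //; exact: measurable_itv.
Qed.

Lemma sum_eq_le1 n h : \sum_(q < n) (q == h :> nat)%:R <= 1 :> R.
Proof.
elim: n => [|n IH]; first by rewrite big_ord0.
rewrite big_ord_recr /=; have [<-|nh] := eqVneq n h; last by rewrite addr0.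
rewrite big1 ?add0r // => q _; suff /negbTE -> : (q != n :> nat) by [].
by rewrite neq_ltn ltn_ord.
Qed.

Section InvariantErgodic.
Variable mu : probability (measurableTypeR R) R.
Hypothesis muE : forall k p, (p < size (W k))%N ->
  mu (floor l k p) = (l' k (letterW k p))%:E.
Local Notation T := (iet4213 (to_vector (l 0))).

Lemma measurable_iet (L : 'cV[R]_4) :
  measurable_fun setT (iet4213 L : measurableTypeR R -> measurableTypeR R).
Proof.
apply: measurable_funD; first exact: measurable_id.
apply: measurable_sum => j; apply: measurable_funM; first exact: measurable_cst.
by apply: measurable_indic; exact: measurable_itv.
Qed.

Lemma measurable_preimage (B : set (measurableTypeR R)) : measurable B ->
  measurable (T @^-1` B : set (measurableTypeR R)).
Proof. by move=> mB; rewrite -[X in measurable X]setTI; exact: measurable_iet. Qed.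

Lemma fine_mu_le (A B : set (measurableTypeR R)) : measurable A -> measurable B ->
  A `<=` B -> fine (mu A) <= fine (mu B).
Proof.
by move=> mA mB AB; rewrite fine_le ?fin_num_measure // le_measure ?inE.
Qed.

Lemma sum_floors_le1 (nu : probability (measurableTypeR R) R) k :
  \sum_(q < size (W k)) fine (nu (floor l k q)) <= 1.
Proof.
rewrite -(big_mkord xpredT (fun q => fine (nu (floor l k q)))) sum_fine; last first.
  by move=> q _; rewrite fin_num_measure //; exact: measurable_floor.
rewrite -measure_floors //.
have mI : measurable (`[P l k 0, P l k (size (W k))[%classic : set (measurableTypeR R)).
  exact: measurable_itv.
by rewrite -lee_fin fineK ?fin_num_measure // probability_le1.
Qed.

Lemma sum_lengths k : \sum_(q < size (W k)) l' k (letterW k q) = 1.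
Proof. by rewrite sum_letters; exact: system_dot. Qed.

Lemma exp2_small (e : R) : 0 < e -> exists k, 2^-1 ^+ k <= e.
Proof.
move=> e0; have : (fun n => 2^-1 ^+ n : R) @ \oo --> 0.
  by apply: cvg_expr; rewrite ger0_norm ?invr_ge0 // invf_lt1 // ltr1n.
by move=> /cvgr_le /(_ _ e0) [k _ H]; exists k; exact: (H k (leqnn k)).
Qed.

Lemma floor_measure_carried : carried_by_unit_interval mu.
Proof.
have -> : carried_by_unit_interval mu =
    (mu `[P l 0 0, P l 0 (size (W 0))[%classic = 1%E) by rewrite pos0 pos_size.
rewrite measure_floors // big_mkord (eq_bigr (fun q : 'I_(size (W 0)) => (l' 0 (letterW 0 q))%:E)).
  by rewrite sumEFin sum_lengths.
by move=> q _; exact: muE.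
Qed.

(** Let [nu] be the image of [mu] under T. A floor that is the image of a floor has [nu]-mass at
    least its [mu]-mass, and the total [nu]-mass of the floors is not larger than 1. So the excesses
    are paid for by deficits, which occur only at the lowest floors. *)
Lemma floor_measure_invariant : invariant_measure T mu.
Proof.
pose X : {mfun measurableTypeR R >-> measurableTypeR R} :=
  HB.pack (T : measurableTypeR R -> measurableTypeR R)
    (isMeasurableFun.Build _ _ _ _ _ (measurable_iet (to_vector (l 0)))).
pose nu := distribution mu X.
move=> B mB; suff : nu B = mu B by [].
rewrite -[RHS]mul1e; apply: floors_determine => //; first exact: probability_setT.
move=> e e0; have [|k ke] := @exp2_small (e / 8); first by rewrite divr_gt0.
have small a : l' k a <= e / 8 by apply: le_trans (system_le_exp2 MN lsys' k a) ke.
exists k; last by move=> a; rewrite mul1r; apply: le_trans (small a) _; lra.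
pose heads q := \sum_(a <- [:: La; Lb; Lc; Ld]) (q == head 0%N (tower M N k a))%:R * l' k a.
have l0 a : 0 < l' k a by exact: system_gt0 lsys' k a.
have heads0 q : 0 <= heads q by apply: sumr_ge0 => a _; rewrite mulr_ge0 // ltW.
(* The difference is negative only at a lowest floor, where it is at least [- heads q]. So its
   absolute value is at most the difference plus [2 * heads q], and the differences sum to at most
   0. *)
have bound (q : 'I_(size (W k))) : `|fine (nu (floor l k q)) - 1 * l' k (letterW k q)| <=
    (fine (nu (floor l k q)) - l' k (letterW k q)) + 2 * heads q.
  rewrite mul1r; have nu0 : 0 <= fine (nu (floor l k q)) by apply: fine_ge0; exact: measure_ge0.
  have [qh|[q' [q'k lq mf]]] := floor_preimage MN lsys (ltn_ord q).
    have : l' k (letterW k q) <= heads q.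
      rewrite /heads (big_rem (letterW k q)) /=; last by case: (letterW k q).
      rewrite -qh eqxx mul1r lerDl; apply: sumr_ge0 => a _.
      by rewrite mulr_ge0 // ltW.
    have := l0 (letterW k q); move: (fine _) (l' k _) (heads q) nu0 => x y z x0 y0 yz.
    by rewrite ler_norml; apply/andP; split; lra.
  have : l' k (letterW k q) <= fine (nu (floor l k q)).
    rewrite -lq -[leLHS]/(fine (_%:E)) -muE //; apply: fine_mu_le.
    - exact: measurable_floor.
    - by apply: measurable_preimage; exact: measurable_floor.
    - by move=> y; rewrite /floor /= !in_itv /=; exact: mf.
  have := heads0 q; move: (fine _) (l' k _) (heads q) => x y z z0 yx.
  by rewrite ger0_norm; lra.
apply: le_trans (ler_sum _ (fun q _ => bound q)) _.
rewrite big_split sumrB /= sum_lengths.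
have H1 := sum_floors_le1 nu k.
suff H2 : \sum_(q < size (W k)) 2 * heads q <= e.
  by move: H1 H2; rewrite /nu; move: (\sum_(q < _) _) (\sum_(q < _) _) => x y; lra.
rewrite -mulr_sumr exchange_big /= !big_cons big_nil -!mulr_suml.
have E a : (\sum_(q < size (W k)) (q == head 0%N (tower M N k a) :> nat)%:R) * l' k a <= e / 8.
  apply: le_trans (small a); rewrite -[leRHS]mul1r ler_wpM2r ?sum_eq_le1 //.
  exact: ltW.
by have := E La; have := E Lb; have := E Lc; have := E Ld; lra.
Qed.

(** Climbing one floor cannot decrease the mass of the part in B, as [mu] and B are invariant; the
    same holds for the complement of B, and both floors have the same total mass. *)
Lemma floor_ratio_const (B : set (measurableTypeR R)) k a :
  measurable B -> T @^-1` B = B ->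
  forall p p', (p < size (W k))%N -> (p' < size (W k))%N ->
    letterW k p = a -> letterW k p' = a ->
    fine (mu (floor l k p `&` B)) = fine (mu (floor l k p' `&` B)).
Proof.
move=> mB TB; apply: (tower_const MN lsys (f := fun p => fine (mu (floor l k p `&` B)))).
move=> p p' pk p'k lp lp' mf.
have le C : measurable C -> T @^-1` C = C ->
    fine (mu (floor l k p' `&` C)) <= fine (mu (floor l k p `&` C)).
  move=> mC TC.
  have mp : measurable (floor l k p `&` C).
    by apply: measurableI => //; exact: measurable_floor.
  rewrite -[in leRHS](floor_measure_invariant mp); apply: fine_mu_le.
  - by apply: measurableI => //; exact: measurable_floor.
  - exact: measurable_preimage.
  - move=> y [yp yC]; split; last by rewrite -TC in yC.
    by move: yp; rewrite /floor /= !in_itv /=; exact: mf.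
apply/eqP; rewrite eq_le le //=.
have mCB : measurable (~` B) by exact: measurableC.
have := le _ mCB; rewrite -preimage_setC TB => /(_ erefl).
have split_mu q : (q < size (W k))%N -> l' k (letterW k q) =
    fine (mu (floor l k q `&` B)) + fine (mu (floor l k q `&` ~` B)).
  move=> qk; have mq := measurable_floor k q.
  have m1 : measurable (floor l k q `&` B) by exact: measurableI.
  have m2 : measurable (floor l k q `&` ~` B) by exact: measurableI.
  rewrite -fineD ?fin_num_measure // -measureU //; last first.
    by rewrite setIACA setICr setI0.
  by rewrite -setIUr setUv setIT -[LHS]/(fine (_%:E)) -muE.
have := split_mu p pk; have := split_mu p' p'k; rewrite lp lp'; lra.
Qed.

(** [floors_determine] is applied to the restriction of [mu] to B. The differences [f] are constant
    on the tower of [a] and sum to 0 over all floors, so their absolute sum is at most twice the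
    mass outside this tower. Evaluating at B gives c = c^2. *)
Lemma floor_measure_ergodic a :
  (forall k, 1 - 24^-1 * 4^-1 ^+ k <= height R M N k a * l' k a) ->
  ergodic_measure T mu.
Proof.
move=> conc; split; first exact: floor_measure_invariant.
move=> B mB TB; pose c := fine (mu B).
have muB : mu B = c%:E by rewrite fineK // fin_num_measure.
have c0 : 0 <= c by apply: fine_ge0; exact: measure_ge0.
have c1 : c <= 1 by rewrite -lee_fin -muB probability_le1.
suff H A : measurable A -> mrestr mu mB A = (c%:E * mu A)%E.
  have := H B mB; rewrite /mrestr setIid muB -EFinM => -[cc].
  have /eqP : c * (1 - c) = 0 by rewrite mulrBr mulr1 -cc subrr.
  rewrite mulf_eq0 => /orP[/eqP ->|]; first by left.
  by rewrite subr_eq0 => /eqP <-; right.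
apply: floors_determine => //; first by rewrite -[LHS]/(mu (setT `&` B)) setTI.
move=> e e0.
have [|k ke] := @exp2_small (e / 8); first by rewrite divr_gt0.
have l0 b : 0 < l' k b by exact: system_gt0 lsys' k b.
have small b : l' k b <= e / 8 by apply: le_trans (system_le_exp2 MN lsys' k b) ke.
exists k; last first.
  move=> b; apply: le_trans (_ : l' k b <= _).
    by rewrite -[leRHS]mul1r ler_wpM2r // ltW.
  by apply: le_trans (small b) _; lra.
pose f q := fine (mrestr mu mB (floor l k q)) - c * l' k (letterW k q).
have mfB q : measurable (floor l k q `&` B : set (measurableTypeR R)).
  by apply: measurableI => //; exact: measurable_floor.
have f_le q : (q < size (W k))%N -> `|f q| <= l' k (letterW k q).
  move=> qk; have h0 : 0 <= fine (mu (floor l k q `&` B)).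
    by apply: fine_ge0; exact: measure_ge0.
  have h1 : fine (mu (floor l k q `&` B)) <= l' k (letterW k q).
    rewrite -[leRHS]/(fine (_%:E)) -muE //; apply: fine_mu_le => //.
    exact: measurable_floor.
  have h2 : 0 <= c * l' k (letterW k q) <= l' k (letterW k q).
    apply/andP; split; first by rewrite mulr_ge0 // ltW.
    by rewrite -[leRHS]mul1r ler_wpM2r // ltW.
  by rewrite /f /mrestr ler_norml; apply/andP; split; lra.
have f_const q q' : (q < size (W k))%N -> (q' < size (W k))%N ->
    letterW k q = a -> letterW k q' = a -> f q = f q'.
  move=> qk q'k lq lq'; rewrite /f /mrestr lq lq'; congr (_ - _).
  exact: (floor_ratio_const mB TB qk q'k lq lq').
pose bad := \sum_(q < size (W k) | letterW k q != a) l' k (letterW k q).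
have bad_le : bad <= 24^-1 * 4^-1 ^+ k.
  have -> : bad = 1 - height R M N k a * l' k a; last by have := conc k; lra.
  have /= E := sum_letters (fun b => if b != a then l' k b else 0) k.
  rewrite /bad big_mkcond /= E -(system_dot lsys' k) /dot; case: (a) => /=; ring.
have sum0 : \sum_(q < size (W k)) f q = 0.
  rewrite sumrB -mulr_sumr sum_lengths mulr1; apply/eqP; rewrite subr_eq0; apply/eqP.
  rewrite -(big_mkord xpredT (fun q => fine (mrestr mu mB (floor l k q)))) sum_fine; last first.
    by move=> q _; exact: (fin_num_measure mu _ (mfB q)).
  rewrite -measure_floors // /mrestr pos0 pos_size // /c; congr fine.
  have mI : measurable (`[0, 1[%classic : set (measurableTypeR R)) by exact: measurable_itv.
  have carried := floor_measure_carried.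
  have : mu (~` `[0, 1[%classic) = 0%E.
    by rewrite probability_setC // [X in (1 - X)%E]carried subee.
  move=> null; rewrite -[in RHS](setIT B) -(setUv `[0, 1[%classic) setIUr measureU //; last first.
  - by rewrite setIACA setICr setI0.
  - by apply: measurableI => //; exact: measurableC.
  - exact: measurableI.
  rewrite [X in (_ + X)%E](_ : _ = 0%E) ?adde0 1?setIC //.
  apply/eqP; rewrite eq_le measure_ge0 andbT -null le_measure ?inE //.
    by apply: measurableI => //; exact: measurableC.
  exact: measurableC.
have good : \sum_(q < size (W k) | letterW k q == a) `|f q| =
    `|\sum_(q < size (W k) | letterW k q == a) f q|.
  have [/existsP[q0 /eqP lq0]|no] := boolP [exists q : 'I_(size (W k)), letterW k q == a].
    rewrite (eq_bigr (fun=> `|f q0|)); last first.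
      by move=> q /eqP lq; rewrite (f_const q q0).
    rewrite [in RHS](eq_bigr (fun=> f q0)); last first.
      by move=> q /eqP lq; rewrite (f_const q q0).
    by rewrite !sumr_const normrMn.
  have no' (q : 'I_(size (W k))) : (letterW k q == a) = false.
    by apply/negP => lq; move/negP: no; apply; apply/existsP; exists q.
  by rewrite !big_pred0 ?normr0.
have e2 : 2 * bad <= e.
  have : 4^-1 ^+ k <= 2^-1 ^+ k :> R.
    by rewrite lerXn2r ?nnegrE ?invr_ge0 // lef_pV2 ?posrE // ler_nat.
  lra.
apply: le_trans e2; rewrite /floor_error (bigID (fun q : 'I__ => letterW k q == a)) /=.
rewrite -/(f _).
have E1 : \sum_(q < size (W k) | letterW k q != a) `|f q| <= bad.
  by apply: ler_sum => q _; exact: f_le.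
rewrite [X in X + _]good mulr_natl mulr2n lerD //.
have -> : \sum_(q < size (W k) | letterW k q == a) f q =
    - \sum_(q < size (W k) | letterW k q != a) f q.
  apply/eqP; rewrite -addr_eq0; move: sum0.
  by rewrite (bigID (fun q : 'I__ => letterW k q == a)) /= => ->.
by rewrite normrN; apply: le_trans E1; exact: ler_norm_sum.
Qed.

End InvariantErgodic.
End FloorSums.

(** * Hausdorff dimension *)

Section HausdorffGeneral.
Variables (R : realType) (d : R -> R -> R).

Lemma diam_ge0 U : (0 <= diam d U)%E.
Proof. by rewrite /diam le_max lexx. Qed.

Lemma diam_ge U x y : U x -> U y -> ((d x y)%:E <= diam d U)%E.
Proof.
move=> Ux Uy; rewrite /diam le_max; apply/orP; right.
by apply: ereal_sup_ubound; exists (x, y).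
Qed.

Lemma diam_le U r : 0 <= r -> (forall x y, U x -> U y -> d x y <= r) ->
  (diam d U <= r%:E)%E.
Proof.
move=> r0 H; rewrite /diam ge_max lee_fin r0 /=.
by apply: ge_ereal_sup => _ [[x y] [Ux Uy] <-]; rewrite lee_fin H.
Qed.

Lemma diam_set0 : diam d set0 = 0%E.
Proof.
apply/eqP; rewrite eq_le diam_ge0 andbT; apply: diam_le => //.
Qed.

Lemma diam_pow_ge0 s U : (0 <= diam_pow d s U)%E.
Proof. by rewrite /diam_pow; case: ifP => // _; exact: poweR_ge0. Qed.

Lemma diam_pow_set0 s : diam_pow d s set0 = 0%E.
Proof. by rewrite /diam_pow eqxx. Qed.

Lemma diam_pow_le s U r : 0 <= s -> 0 <= r -> (diam d U <= r%:E)%E ->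
  (diam_pow d s U <= (r `^ s)%:E)%E.
Proof.
move=> s0 r0 dr; rewrite /diam_pow; case: ifP => _; first by rewrite lee_fin powR_ge0.
by rewrite -poweR_EFin; apply: gt0_ler_poweR => //;
  rewrite in_itv /= leey andbT ?lee_fin ?diam_ge0.
Qed.

Lemma hausdorff_premeasure_ge0 s S delta : (0 <= hausdorff_premeasure d s S delta)%E.
Proof.
apply: le_ereal_inf_tmp => _ [U _ <-]; apply: nneseries_ge0 => i _ _; exact: diam_pow_ge0.
Qed.

Lemma hausdorff_premeasure_nonincreasing s S :
  nonincreasing_fun (hausdorff_premeasure d s S).
Proof.
move=> a b ab; apply: ereal_inf_le_tmp => _ [U [oU dU SU] <-].
exists U => //; split => // i; apply: le_trans (dU i) _; rewrite lee_fin //.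
Qed.

Lemma hausdorff_measure_cvg s S :
  hausdorff_premeasure d s S delta @[delta --> 0^'+] --> hausdorff_measure d s S.
Proof.
apply: nonincreasing_at_right_is_cvge; apply: nearW => x y z _ _.
exact: hausdorff_premeasure_nonincreasing.
Qed.

Lemma hausdorff_measure_eq0 s S :
  (forall delta, 0 < delta -> hausdorff_premeasure d s S delta = 0%E) ->
  hausdorff_measure d s S = 0%E.
Proof.
move=> H; apply: (cvg_unique _ (@hausdorff_measure_cvg s S)) => //.
apply: cvg_near_cst; near=> x; apply: H; near: x; exact: nbhs_right_gt.
Unshelve. all: by end_near. Qed.

Lemma hausdorff_measure_ge s S delta0 x : 0 < delta0 ->
  (forall delta, 0 < delta < delta0 -> (x <= hausdorff_premeasure d s S delta)%E) ->
  (x <= hausdorff_measure d s S)%E.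
Proof.
move=> d0 H; apply: (cvge_to_ge (@hausdorff_measure_cvg s S)).
near=> y; apply: H; apply/andP; split; near: y.
  exact: nbhs_right_gt.
exact: nbhs_right_lt.
Unshelve. all: by end_near. Qed.

Lemma nneseries_double (f : nat -> nat -> \bar R) :
  (forall i j, (0 <= f i j)%E) ->
  exists e : nat -> nat * nat, (forall x, exists j, e j = x) /\
    (\sum_(0 <= j <oo) f (e j).1 (e j).2 = \sum_(0 <= i <oo) \sum_(0 <= j <oo) f i j)%E.
Proof.
move=> f0; have /card_esym/ppcard_eqP[e] := card_nat2.
exists e; split.
  by move=> x; exists (e^-1%FUN x); rewrite invK // inE.
rewrite nneseries_esumT //.
rewrite [RHS]nneseries_esumT; last by move=> i; exact: nneseries_ge0.
have -> : (fun i => (\sum_(0 <= j <oo) f i j)%E) = (fun i => \esum_(j in [set: nat]) f i j)%E.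
  by apply/funext => i; rewrite nneseries_esumT.
rewrite esum_esum //.
rewrite -(@reindex_esum R nat (nat * nat)%type setT ([set: nat] `*`` (fun=> setT)) e (fun k => f k.1 k.2)) //.
have -> : [set: nat] `*`` (fun=> [set: nat]) = setT by apply/seteqP; split.
by split.
Qed.

Lemma finite_nneseries_le (f : nat -> \bar R) n (c : R) : 0 <= c ->
  (forall i, (0 <= f i)%E) -> (forall i, (i < n)%N -> (f i <= c%:E)%E) ->
  (forall i, (n <= i)%N -> f i = 0%E) ->
  (\sum_(0 <= i <oo) f i <= (n%:R * c)%:E)%E.
Proof.
move=> c0 f0 fc fn; apply: lime_le; first exact: is_cvg_nneseries.
apply: nearW => m; apply: (@le_trans _ _ ((minn m n)%:R * c)%:E); last first.
  by rewrite lee_fin ler_wpM2r // ler_nat geq_minr.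
elim: m => [|m IH]; first by rewrite big_geq // min0n mul0r.
rewrite big_nat_recr //=; have [mn|nm] := ltnP m n.
  have -> : minn m.+1 n = (minn m n).+1 by lia.
  by rewrite -natr1 mulrDl mul1r EFinD leeD // fc.
have -> : minn m.+1 n = minn m n by lia.
by rewrite fn // adde0.
Qed.

Lemma hausdorff_measure_limsup_cover (V : nat -> nat -> set R) (n : nat -> nat)
    (D : nat -> R) (s C : R) (K : nat) (M : set R) : 0 <= s ->
  (forall k i, dist_open d (V k i)) ->
  (forall k, 0 <= D k) ->
  (forall k i, (diam d (V k i) <= (D k)%:E)%E) ->
  (forall e, 0 < e -> exists K0, forall k, (K0 <= k)%N -> D k <= e) ->
  (forall k, (K <= k)%N -> (n k)%:R * D k `^ s <= C * 2^-1 ^+ k) ->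
  (forall x k, M x -> exists k' i, [/\ (k <= k')%N, (i < n k')%N & V k' i x]) ->
  hausdorff_measure d s M = 0%E.
Proof.
move=> s0 oV D0 dV D_small nD MV; apply: hausdorff_measure_eq0 => delta delta0.
apply/eqP; rewrite eq_le hausdorff_premeasure_ge0 andbT.
apply/lee_addgt0Pr => e e0; rewrite add0e.
have [K0 HK0] := D_small delta delta0.
have [k1 Ck1] : exists k1, 2 * `|C| * 2^-1 ^+ k1 <= e.
  have : (fun n => (2 * `|C|) * 2^-1 ^+ n : R) @ \oo --> 0.
    by apply: cvg_geometric; rewrite ger0_norm ?invr_ge0 // invf_lt1 // ltr1n.
  by move=> /cvgr_le /(_ _ e0) [k1 _ H]; exists k1; exact: (H k1 (leqnn k1)).
pose k0 := maxn K (maxn K0 k1).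
(* Surplus indices receive the empty set, which contributes 0 even for s = 0. *)
pose G k i := if (i < n (k0 + k))%N then V (k0 + k)%N i else set0.
have oG k i : dist_open d (G k i).
  by rewrite /G; case: ifP => // _; split.
have dG k i : (diam d (G k i) <= (D (k0 + k)%N)%:E)%E.
  by rewrite /G; case: ifP => // _; rewrite diam_set0 lee_fin.
have [enum [enum_surj enum_sum]] := nneseries_double (fun k i => diam_pow_ge0 s (G k i)).
apply: ge_ereal_inf; eexists.
  exists (fun j => G (enum j).1 (enum j).2); last by [].
  split=> [j|j|x Mx]; first exact: oG.
    by apply: le_trans (dG _ _) _; rewrite lee_fin HK0 // /k0; lia.
  have [k' [i [k0k' ik' Vx]]] := MV x k0 Mx.
  have [j ej] := enum_surj ((k' - k0)%N, i); exists j => //.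
  by rewrite ej /G /= subnKC // ik'.
rewrite enum_sum.
have C0 : 0 <= 2 * `|C| * 2^-1 ^+ k1 :> R by rewrite !mulr_ge0 // exprn_ge0 // invr_ge0.
apply: (@le_trans _ _ (\sum_(0 <= k <oo) (e / (2 ^ (k + 1))%:R)%:E)%E); last first.
  have := @cvg_geometric_eseries_half R e 0; rewrite expr0 divr1 => /cvg_lim.
  by rewrite /eseries /= => ->.
apply: lee_nneseries => [k _ _|k _]; first by apply: nneseries_ge0 => i _ _; exact: diam_pow_ge0.
apply: (@le_trans _ _ ((n (k0 + k)%N)%:R * D (k0 + k)%N `^ s)%:E).
  apply: finite_nneseries_le => [|i|i ik|i ik].
  - exact: powR_ge0.
  - exact: diam_pow_ge0.
  - by apply: diam_pow_le.
  - by rewrite /G ltnNge ik /= diam_pow_set0.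
rewrite lee_fin; apply: le_trans (nD _ _) _; first by rewrite /k0; lia.
apply: (@le_trans _ _ (`|C| * 2^-1 ^+ (k1 + k))).
  apply: (@le_trans _ _ (`|C| * 2^-1 ^+ (k0 + k))).
    by rewrite ler_wpM2r ?ler_norm // exprn_ge0 // invr_ge0.
  rewrite ler_wpM2l // ler_wiXn2l ?invr_ge0 // ?invf_le1 ?ler1n // /k0; lia.
rewrite exprD mulrA addn1 natrX exprS invfM mulrA -exprVn.
by rewrite ler_wpM2r ?exprn_ge0 ?invr_ge0 // ler_pdivlMr // mulrC mulrA.
Qed.

End HausdorffGeneral.

(** * The mass distribution principle *)

Section MassDistribution.
Variables (R : realType) (d : R -> R -> R) (mu : probability (measurableTypeR R) R).
Variables (G : set (measurableTypeR R)) (u g : nat -> R) (s C : R) (K : nat).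
Hypotheses (mG : measurable G) (muG : 2^-1 <= fine (mu G)).
Hypotheses (u0 : forall k, 0 < u k) (g0 : forall k, 0 < g k).
Hypothesis u_small : forall e, 0 < e -> exists k, u k <= e.
Hypothesis g_small : forall e, 0 < e -> exists2 k, (K <= k)%N & g k.+1 <= e.
(* [u k] and [g k] are the mass of a cell of level k and the least gap between cells. *)
Hypothesis cells : forall k (U : set R) r, U `<=` @unit_interval R -> 0 <= r ->
  (forall x y, U x -> U y -> d x y <= r) ->
  exists V : set (measurableTypeR R),
    [/\ measurable V, U `&` G `<=` V & fine (mu V) <= (1 + r / g k) * u k].
Hypotheses (s01 : 0 <= s <= 1) (C0 : 0 < C).
Hypothesis scale : forall k, (K <= k)%N ->
  u k `^ (1 - s) * (u k.+1 / g k.+1) `^ s <= C.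

Lemma min_powR (a b : R) : 0 < a -> 0 < b -> Num.min a b <= a `^ (1 - s) * b `^ s.
Proof.
move=> a0 b0; move/andP: s01 => [s0 s1].
have split_pow x : 0 < x -> x = x `^ (1 - s) * x `^ s.
  move=> x0; rewrite -powRD; last by rewrite (gt_eqF x0) implybT.
  by rewrite subrK powRr1 // ltW.
have [ab|ba] := lerP a b.
  by rewrite [leLHS]split_pow // ler_wpM2l ?powR_ge0 // ge0_ler_powR ?nnegrE ?(ltW a0) ?(ltW b0).
rewrite [leLHS]split_pow // ler_wpM2r ?powR_ge0 //.
by rewrite ge0_ler_powR ?nnegrE ?subr_ge0 ?(ltW a0) ?(ltW b0) // ltW.
Qed.

(** If r is the diameter and g_(k+1) <= r < g_k, level k gives mass at most 2 u_k, as fewer than two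
    gaps fit, and level k + 1 gives at most 2 r u_(k+1) / g_(k+1). The minimum is at most the
    geometric mean with weights 1 - s and s, which produces r^s. *)
Lemma mass_bound (U : set R) : U `<=` @unit_interval R -> (diam d U < (g K)%:E)%E ->
  exists V : set (measurableTypeR R),
    [/\ measurable V, U `&` G `<=` V & (mu V <= (2 * C)%:E * diam_pow d s U)%E].
Proof.
move=> U01 dU; have [->|Une] := eqVneq U set0.
  by exists set0; split; rewrite ?measure0 ?set0I ?diam_pow_set0 ?mule0.
pose r := fine (diam d U).
have dE : diam d U = r%:E.
  by rewrite fineK // ge0_fin_numE ?diam_ge0 // (lt_trans dU) // ltry.
have r0 : 0 <= r by rewrite -lee_fin -dE diam_ge0.
have rg : r < g K by rewrite -lte_fin -dE.
have dUr x y : U x -> U y -> d x y <= r.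
  by move=> Ux Uy; rewrite -lee_fin -dE; exact: diam_ge.
have -> : diam_pow d s U = (r `^ s)%:E by rewrite /diam_pow (negbTE Une) dE poweR_EFin.
have [s0 s1] : 0 <= s /\ s <= 1 by apply/andP.
have muE V : measurable V -> mu V = (fine (mu V))%:E.
  by move=> mV; rewrite fineK // fin_num_measure.
(* With diameter 0 every level gives a cover of mass at most u_k; the intersection of these covers
   is null, which also settles s = 0. *)
have [re|rpos] := eqVneq r 0.
  have [V HV] : {V : nat -> set (measurableTypeR R) & forall k,
      [/\ measurable (V k), U `&` G `<=` V k & fine (mu (V k)) <= u k]}.
    apply: (@choice _ _ (fun k V => [/\ measurable V, U `&` G `<=` V & fine (mu V) <= u k])).
    move=> k; have [V [mV UV fV]] := cells k U01 r0 dUr; exists V; split => //.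
    by apply: le_trans fV _; rewrite re mul0r addr0 mul1r.
  have mcap : measurable (\bigcap_k V k).
    by apply: bigcapT_measurable => k; case: (HV k).
  exists (\bigcap_k V k); split => //.
    by move=> x Ux k _; case: (HV k) => _ H _; exact: H.
  rewrite muE // -EFinM lee_fin; apply: (@le_trans _ _ 0).
    apply/ler_addgt0Pr => e e0; rewrite add0r; have [k ke] := u_small e0.
    apply: le_trans ke; case: (HV k) => mV _ H; apply: le_trans H.
    rewrite fine_le ?fin_num_measure // le_measure ?inE //.
    by move=> x; apply.
  by rewrite !mulr_ge0 ?powR_ge0 // ltW.
have {}rpos : 0 < r by rewrite lt_neqAle eq_sym rpos.
have ex_k : exists k, (K <= k)%N && (g k.+1 <= r).
  by have [k Kk gk] := g_small rpos; exists k; rewrite Kk.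
(* The least such k is the scale sought; when it equals [K], the inequality r < g_k comes from the
   bound on the diameter. *)
case: (ex_minnP ex_k) => k /andP[Kk gk] kmin.
have rk : r < g k.
  move: Kk; rewrite leq_eqVlt => /predU1P[<- //|]; case: k gk kmin => [//|k] gk kmin Kk.
  rewrite ltNge; apply/negP => gr.
  by have := kmin k; rewrite gr andbT -ltnS => /(_ Kk); rewrite ltnn.
have fin_bound : Num.min (2 * u k) (2 * (r / g k.+1) * u k.+1) <= 2 * C * r `^ s.
  have a0 : 0 < u k by [].
  have b0 : 0 < r * (u k.+1 / g k.+1) by rewrite mulr_gt0 // divr_gt0.
  have -> : 2 * (r / g k.+1) * u k.+1 = 2 * (r * (u k.+1 / g k.+1)) by ring.
  rewrite -minr_pMr // -!mulrA ler_pM2l //.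
  apply: le_trans (min_powR a0 b0) _; rewrite powRM ?divr_ge0 ?(ltW (u0 _)) ?(ltW (g0 _)) //.
  by rewrite mulrCA mulrC ler_wpM2r ?powR_ge0 // scale.
have [H|H] := lerP (2 * u k) (2 * (r / g k.+1) * u k.+1).
  have [V [mV UV fV]] := cells k U01 r0 dUr; exists V; split => //.
  rewrite muE // -EFinM lee_fin; apply: le_trans fV _; apply: le_trans fin_bound.
  rewrite (min_idPl H) ler_pM2r // -[leRHS]/(1 + 1) lerD2l ler_pdivrMr // mul1r; exact: ltW.
have [V [mV UV fV]] := cells k.+1 U01 r0 dUr; exists V; split => //.
rewrite muE // -EFinM lee_fin; apply: le_trans fV _; apply: le_trans fin_bound.
rewrite (min_idPr (ltW H)) ler_pM2r // mulr_natl mulr2n lerD2r.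
by rewrite ler_pdivlMr // mul1r.
Qed.

(** The part of M in G has mass at least 1/2, and a set of the cover accounts for at most 2 C times
    its diameter power, whence 1 / (4 C). *)
Lemma hausdorff_measure_lower (M : set (measurableTypeR R)) :
  measurable M -> mu M = 1%E -> ((4 * C)^-1%:E <= hausdorff_measure d s M)%E.
Proof.
move=> mM muM; apply: (@hausdorff_measure_ge _ _ _ _ (g K)) => // delta /andP[d0 dK].
apply: le_ereal_inf_tmp => _ [U [oU dU MU] <-].
have [V HV] : {V : nat -> set (measurableTypeR R) & forall i,
    [/\ measurable (V i), U i `&` G `<=` V i & (mu (V i) <= (2 * C)%:E * diam_pow d s (U i))%E]}.
  apply: (@choice _ _ (fun i V => [/\ measurable V, U i `&` G `<=` V
    & (mu V <= (2 * C)%:E * diam_pow d s (U i))%E])) => i.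
  apply: mass_bound; first by case: (oU i).
  by apply: le_lt_trans (dU i) _; rewrite lte_fin.
have mMG : measurable (M `&` G) by exact: measurableI.
have muMG : mu (M `&` G) = mu G.
  have mMc : measurable (~` M) by exact: measurableC.
  have null : mu (~` M) = 0%E by rewrite probability_setC // [X in (1 - X)%E]muM subee.
  rewrite -[in RHS](setIT G) -(setUv M) setIUr measureU //; last first.
  - by rewrite setIACA setICr setI0.
  - exact: measurableI.
  - exact: measurableI.
  rewrite [X in (_ + X)%E](_ : _ = 0%E) ?adde0 1?setIC //.
  apply/eqP; rewrite eq_le measure_ge0 andbT -null le_measure ?inE //.
  exact: measurableI.
have : (mu (M `&` G) <= \sum_(0 <= i <oo) mu (V i))%E.
  apply: measure_sigma_subadditive => //; first by move=> i; case: (HV i).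
  by move=> x [/MU[i _ Uix] Gx]; exists i => //; case: (HV i) => _ H _; exact: H.
rewrite muMG => le1.
have : (mu G <= (2 * C)%:E * \sum_(0 <= i <oo) diam_pow d s (U i))%E.
  apply: (le_trans le1); rewrite -nneseriesZl; last by move=> i _; exact: diam_pow_ge0.
  by apply: lee_nneseries => [i _ _|i _]; [exact: measure_ge0|case: (HV i)].
have : (2^-1%:E <= mu G)%E by rewrite -[mu G]fineK ?fin_num_measure // lee_fin.
move=> H1 H2; have := le_trans H1 H2.
rewrite muleC -lee_pdivrMr ?mulr_gt0 //.
by apply: le_trans; rewrite -EFinM lee_fin !invfM; lra.
Qed.

End MassDistribution.

Section MeasureDistance.
Variables (R : realType) (nu : probability (measurableTypeR R) R).
Local Notation d := (measure_dist nu).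

Lemma measure_dist_sym x y : d x y = d y x.
Proof. by rewrite /measure_dist minC maxC. Qed.

Lemma fine_prob_le (A B : set (measurableTypeR R)) : measurable A -> measurable B ->
  A `<=` B -> fine (nu A) <= fine (nu B).
Proof.
by move=> mA mB AB; rewrite fine_le ?fin_num_measure // le_measure ?inE.
Qed.

Lemma fine_probU (A B : set (measurableTypeR R)) : measurable A -> measurable B ->
  fine (nu (A `|` B)) <= fine (nu A) + fine (nu B).
Proof.
move=> mA mB; rewrite -fineD ?fin_num_measure // fine_le ?fin_num_measure //.
- exact: measurableU.
- by rewrite fin_numD !fin_num_measure.
- exact: measureU2.
Qed.

Lemma measure_dist_triangle x y z : d x z <= d x y + d y z.
Proof.
apply: le_trans (fine_probU _ _); try exact: measurable_itv.
apply: fine_prob_le; [exact: measurable_itv|by apply: measurableU; exact: measurable_itv|].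
move=> t /=; rewrite !in_itv /= !ge_min !le_max => /andP[h1 h2].
case/orP: (le_total t y) => ty.
  by case/orP: h1 => h1; [left|right]; rewrite h1 ty ?orbT.
by case/orP: h2 => h2; [left|right]; rewrite h2 ty ?orbT.
Qed.

Definition dist_ball (x r : R) : set R := [set y | unit_interval y /\ d x y < r].

Lemma dist_ball_open x r : dist_open d (dist_ball x r).
Proof.
split=> [y []//|y [y01 dy]]; exists (r - d x y); first by rewrite subr_gt0.
move=> z z01 dz; split => //; apply: le_lt_trans (measure_dist_triangle x y z) _.
by rewrite -ltrBrDl.
Qed.

Lemma dist_ball_diam x r : 0 <= r -> (diam d (dist_ball x r) <= (2 * r)%:E)%E.
Proof.
move=> r0; apply: diam_le; first by rewrite mulr_ge0.
move=> y z [_ dy] [_ dz]; apply: le_trans (measure_dist_triangle y x z) _.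
rewrite (measure_dist_sym y x); lra.
Qed.

End MeasureDistance.

(** * Dimension bounds for a measure given on floors *)

Section FloorDimension.
Variables (R : realType) (M N : nat -> nat).
Hypothesis MN : growth_condition M N.
Local Notation W := (words M N).
Local Notation letterW := (letter_at M N).
Local Notation P := (pos M N).
Local Notation floor := (@floor R M N).
Variables (l l' l'' : nat -> letter -> R).
Hypotheses (lsys : length_system M N l) (lsys' : length_system M N l')
  (lsys'' : length_system M N l'').
Variables (mu nu : probability (measurableTypeR R) R).
Hypothesis muE : forall k p, (p < size (W k))%N ->
  mu (floor l k p) = (l' k (letterW k p))%:E.
Hypothesis nuE : forall k p, (p < size (W k))%N ->
  nu (floor l k p) = (l'' k (letterW k p))%:E.
Variable a : letter.
Hypothesis conc : forall k, 1 - 24^-1 * 4^-1 ^+ k <= height R M N k a * l' k a.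
Local Notation d := (measure_dist nu).

Lemma floor_unit k q : floor l k q `<=` @unit_interval R.
Proof.
move=> y; rewrite /floor /unit_interval /= !in_itv /= => /andP[h1 h2].
by rewrite (le_trans _ h1) ?pos_ge0 //= (lt_le_trans h2) // pos_le1.
Qed.

Lemma floor_dist k q x y : (q < size (W k))%N -> floor l k q x -> floor l k q y ->
  d x y <= l'' k (letterW k q).
Proof.
move=> qk; rewrite /floor /= !in_itv /= => /andP[x1 x2] /andP[y1 y2].
rewrite -[leRHS]/(fine (_%:E)) -nuE //.
apply: fine_prob_le; [exact: measurable_itv|exact: measurable_floor|].
move=> t; rewrite /floor /= !in_itv /= ge_min le_max => /andP[t1 t2].
apply/andP; split; first by case/orP: t1; apply: le_trans.
by case/orP: t2 => /le_lt_trans; apply.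
Qed.

Lemma pos_measure (m : probability (measurableTypeR R) R) (lm : nat -> letter -> R) k i j :
  (forall p, (p < size (W k))%N -> m (floor l k p) = (lm k (letterW k p))%:E) ->
  (i <= j)%N -> (j <= size (W k))%N ->
  m `[P l k i, P l k j[%classic = (P lm k j - P lm k i)%:E.
Proof.
move=> mE ij jk; rewrite measure_floors //.
elim: j ij jk => [|j IH]; first by rewrite leqn0 => /eqP -> _; rewrite big_geq // subrr.
rewrite leq_eqVlt => /predU1P[-> _|]; first by rewrite big_geq // subrr.
rewrite ltnS => ij jk; rewrite big_nat_recr //= IH ?(ltnW jk) // mE // -EFinD.
by rewrite posD1 // addrAC.
Qed.

Lemma pos_dist k i j x y : (i <= j)%N -> (j <= size (W k))%N ->
  x <= P l k i -> P l k j <= y -> P l'' k j - P l'' k i <= d x y.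
Proof.
move=> ij jk xi jy; rewrite -[leLHS]/(fine (_%:E)).
rewrite -(@pos_measure nu l'' k i j (fun p => @nuE k p) ij jk).
apply: fine_prob_le; try exact: measurable_itv.
move=> t /=; rewrite !in_itv /= ge_min le_max => /andP[t1 t2].
by rewrite (le_trans xi t1) (le_trans (ltW t2) jy) orbT.
Qed.

Definition tower_set k : set (measurableTypeR R) :=
  \bigcup_(q in [set q | (q < size (W k))%N /\ letterW k q = a]) floor l k q.

Lemma measurable_tower_set k : measurable (tower_set k).
Proof. by apply: bigcup_measurable => q _; exact: measurable_floor. Qed.

Lemma measure_finite_union (m : probability (measurableTypeR R) R)
    (s : seq nat) (A : nat -> set (measurableTypeR R)) : (forall q, measurable (A q)) ->
  fine (m (\big[setU/set0]_(q <- s) A q)) <= \sum_(q <- s) fine (m (A q)).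
Proof.
move=> mA; elim: s => [|q s IH]; first by rewrite !big_nil measure0.
rewrite !big_cons; apply: le_trans (fine_probU _ _ _) _ => //.
  by apply: bigsetU_measurable.
by rewrite lerD2l.
Qed.

Lemma tower_set_compl k : fine (mu (~` tower_set k)) <= 24^-1 * 4^-1 ^+ k.
Proof.
have mI : measurable (`[0, 1[%classic : set (measurableTypeR R)) by exact: measurable_itv.
have carried := floor_measure_carried MN lsys lsys' muE.
have null : mu (~` `[0, 1[%classic) = 0%E.
  by rewrite probability_setC // [X in (1 - X)%E]carried subee.
pose A q := floor l k q : set (measurableTypeR R).
pose bad := [seq q <- iota 0 (size (W k)) | letterW k q != a].
have mA q : measurable (A q) by exact: measurable_floor.
have mB : measurable (\big[setU/set0]_(q <- bad) A q) by exact: bigsetU_measurable.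
apply: (@le_trans _ _ (fine (mu (~` `[0, 1[%classic `|` \big[setU/set0]_(q <- bad) A q)))).
  apply: fine_prob_le.
  - by apply: measurableC; exact: measurable_tower_set.
  - by apply: measurableU => //; exact: measurableC.
  - move=> y yT; have [y01|] := pselect (unit_interval y); last by left.
    right; move: y01; rewrite /unit_interval /= in_itv /= => y01.
    have [q qk yq] := pos_cover MN lsys k y01.
    rewrite -bigcup_seq; exists q => /=; last by rewrite /A /floor /= in_itv.
    rewrite mem_filter mem_iota add0n qk leq0n !andbT; apply/eqP => lq; apply: yT.
    by exists q => //; rewrite /floor /= in_itv.
apply: le_trans (fine_probU _ _ _) _ => //; first exact: measurableC.
rewrite [X in fine X + _]null add0r; apply: le_trans (measure_finite_union _ _ _) _ => //.
rewrite /bad big_filter -(subn0 (size (W k))) -/(index_iota _ _).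
rewrite (_ : \sum_(_ <- _ | _) _ = 1 - height R M N k a * l' k a); last first.
  have /= E := @sum_letters R M N MN (fun b => if b != a then l' k b else 0) k.
  rewrite big_mkord (eq_bigr (fun q : 'I_(size (W k)) => l' k (letterW k q))); last first.
    by move=> q _; rewrite /A muE.
  rewrite big_mkcond /= E -(system_dot lsys' k) /dot; case: (a) => /=; ring.
by have := conc k; lra.
Qed.

Lemma tower_set_compl_small e : 0 < e -> exists k0, forall k, (k0 <= k)%N ->
  fine (mu (~` tower_set k)) <= e.
Proof.
move=> e0; have : (fun n => 24^-1 * 4^-1 ^+ n : R) @ \oo --> 0.
  by apply: cvg_geometric; rewrite ger0_norm ?invr_ge0 // invf_lt1 // ltr1n.
move=> /cvgr_le /(_ _ e0) [k0 _ H]; exists k0 => k k0k.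
by apply: le_trans (tower_set_compl k) _; exact: H.
Qed.

Definition tower_limsup : set (measurableTypeR R) :=
  \bigcap_k \bigcup_(j in [set j | (k <= j)%N]) tower_set j.

Lemma measurable_tower_limsup : measurable tower_limsup.
Proof.
apply: bigcapT_measurable => k; apply: bigcup_measurable => j _.
exact: measurable_tower_set.
Qed.

(** Points that avoid the towers from level k on lie in the complement of each later [tower_set],
    whose mass tends to 0. *)
Lemma tower_limsup_full : mu tower_limsup = 1%E.
Proof.
have mTc k : measurable (~` tower_set k) by apply: measurableC; exact: measurable_tower_set.
suff : mu (~` tower_limsup) = 0%E.
  move=> H; have := probability_setC mu measurable_tower_limsup; rewrite H => E.
  have := fin_num_measure mu _ measurable_tower_limsup; move: E.
  case: (mu tower_limsup) => // r + _; rewrite -EFinB => -[/esym/eqP].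
  by rewrite subr_eq0 => /eqP <-.
apply/negligibleP; first by apply: measurableC; exact: measurable_tower_limsup.
rewrite /tower_limsup setC_bigcap; apply: negligible_bigcup => k.
rewrite setC_bigcup; apply/negligibleP.
  by apply: bigcap_measurable => [|j _]; [exists k => /=|exact: mTc].
have mcap : measurable (\bigcap_(j in [set j | (k <= j)%N]) ~` tower_set j).
  by apply: bigcap_measurable => [|j _]; [exists k => /=|exact: mTc].
rewrite -[LHS]fineK ?fin_num_measure //; congr (_%:E).
apply/eqP; rewrite eq_le fine_ge0 ?measure_ge0 // andbT.
apply/ler_addgt0Pr => e e0; rewrite add0r.
have [k0 Hk0] := tower_set_compl_small e0.
apply: le_trans (Hk0 (maxn k k0) (leq_maxr _ _)).
apply: fine_prob_le => // y; apply; exact: leq_maxl.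
Qed.

Lemma dimension_upper (alpha : R) : 0 <= alpha ->
  (forall s, alpha < s -> exists C K, forall k, (K <= k)%N ->
    height R M N k a * (4 * l'' k a) `^ s <= C * 2^-1 ^+ k) ->
  (hausdorff_dim_measure mu d <= alpha%:E)%E.
Proof.
move=> alpha0 H.
have l0 k b : 0 < l'' k b by exact: system_gt0 lsys'' k b.
have dim_le s : alpha < s -> hausdorff_measure d s tower_limsup = 0%E.
  move=> als; have [C [K HK]] := H s als.
  pose fs k := [seq q <- iota 0 (size (W k)) | letterW k q == a].
  have size_fs k : (size (fs k))%:R = height R M N k a.
    have /= E := @sum_letters R M N MN (fun b => if b == a then 1 else 0) k.
    rewrite size_filter -sum1_count natr_sum -(subn0 (size (W k))) -/(index_iota _ _) big_mkord.
    by rewrite big_mkcond /= E /dot; case: (a) => /=; ring.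
  (* Floors need not be open, so they are replaced by balls around their left ends: the radius
     [2 * l'' k a] exceeds the diameter of the floor, and the diameter of the ball is at most
     [4 * l'' k a]. *)
  apply: (@hausdorff_measure_limsup_cover _ _
    (fun k i => dist_ball nu (P l k (nth 0%N (fs k) i)) (2 * l'' k a))
    (fun k => size (fs k)) (fun k => 4 * l'' k a) s C K).
  - exact: le_trans (ltW als).
  - by move=> k i; exact: dist_ball_open.
  - by move=> k; rewrite mulr_ge0 // ltW.
  - move=> k i; apply: le_trans (dist_ball_diam _ _ _) _; first by rewrite mulr_ge0 // ltW.
    by rewrite lee_fin; lra.
  - move=> e e0; have : (fun n => 4 * 2^-1 ^+ n : R) @ \oo --> 0.
      by apply: cvg_geometric; rewrite ger0_norm ?invr_ge0 // invf_lt1 // ltr1n.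
    move=> /cvgr_le /(_ _ e0) [k0 _ H0]; exists k0 => k k0k; apply: le_trans (H0 k k0k).
    by rewrite ler_pM2l // (system_le_exp2 MN lsys'').
  - by move=> k Kk; rewrite size_fs HK.
  - move=> x k Mx; have [j kj [q [qk lq] xq]] := Mx k I.
    have qfs : q \in fs j by rewrite mem_filter lq eqxx mem_iota.
    exists j, (index q (fs j)); split => //; first by rewrite index_mem.
    rewrite nth_index //; split; first exact: floor_unit xq.
    have pq : floor l j q (P l j q).
      by rewrite /floor /= in_itv /= lexx pos_lt.
    have := floor_dist qk pq xq; rewrite lq; have := l0 j a; lra.
apply/lee_addgt0Pr => e e0.
apply: (@le_trans _ _ (hausdorff_dim d tower_limsup)).
  apply: ereal_inf_lbound; exists tower_limsup => //; split.
  - exact: measurable_tower_limsup.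
  - by move=> x /(_ 0%N I) [j _ [q _]]; exact: floor_unit.
  - exact: tower_limsup_full.
apply: ereal_inf_lbound; exists (alpha + e) => //; split; first by rewrite addr_ge0 // ltW.
by apply: dim_le; rewrite ltrDl.
Qed.

(* Floors all of whose ancestors are floors of the towers [a]. *)
Fixpoint chained (k i : nat) : Prop :=
  if k is k'.+1 then exists p q,
    [/\ (p < size (W k'))%N, (q < size (word_at M N k' (letterW k' p)))%N,
        i = (start M N k' p + q)%N, chained k' p
      & nth La (word_at M N k' (letterW k' p)) q = a]
  else i = index_of a.

Lemma chained_letter k i : chained k i -> (i < size (W k))%N /\ letterW k i = a.
Proof.
case: k => [->|k [p [q [pk qk -> _ nq]]]]; first by case: (a).
by rewrite index_lt // letter_atS.
Qed.

Lemma floor_parent k p q : (p < size (W k))%N ->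
  (q < size (word_at M N k (letterW k p)))%N ->
  floor l k.+1 (start M N k p + q) `<=` floor l k p.
Proof.
move=> pk qk y; rewrite /floor /= !in_itv /= => /andP[y1 y2].
rewrite (le_trans _ y1) /=; last first.
  rewrite -(pos_start MN lsys (ltnW pk)) pos_le // ?leq_addr //.
  by apply: ltnW; exact: index_lt.
apply: (lt_le_trans y2); rewrite -(pos_start MN lsys pk) pos_le //.
  by rewrite startS // -addnS leq_add2l.
by rewrite size_wordsS start_le.
Qed.

Lemma chained_floor k i x : (forall j, tower_set j x) -> (i < size (W k))%N ->
  floor l k i x -> chained k i.
Proof.
move=> Gx; elim: k i => [|k IH] i ik xi.
  have [q [qk lq] xq] := Gx 0%N.
  have <- : q = i by apply: (pos_unique lsys qk ik xq xi).
  by move: lq qk {xq}; case: q => [|[|[|[|]]]] //= <-.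
have [q [qk lq] xq] := Gx k.+1.
have qi : q = i by apply: (pos_unique lsys qk ik xq xi).
have [p [q' [pk q'k ie]]] := index_split ik.
exists p, q'; split => //; last by rewrite -letter_atS // -ie -qi.
by apply: IH => //; move: xi; rewrite ie; exact: floor_parent.
Qed.

Section Lower.
Variable g : nat -> R.
Hypotheses (g0 : forall k, 0 < g k) (g_nonincreasing : forall k, g k.+1 <= g k).
Hypothesis g_exp2 : forall k, g k <= 2^-1 ^+ k.
Hypothesis gap : forall k q q', (q < q')%N -> (q' < size (word_at M N k a))%N ->
  nth La (word_at M N k a) q = a -> nth La (word_at M N k a) q' = a ->
  lensum (l'' k.+1) (take q (word_at M N k a)) + l'' k.+1 a + g k.+1 <=
  lensum (l'' k.+1) (take q' (word_at M N k a)).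

(** Cells with the same parent are separated by [gap]; cells with different parents inherit the gap
    between the parents, which is at least as large. *)
Lemma chained_gap k i i' : chained k i -> chained k i' -> (i < i')%N ->
  P l'' k i.+1 + g k <= P l'' k i'.
Proof.
elim: k i i' => [|k IH] i i'; first by move=> -> ->; rewrite ltnn.
move=> ci ci'; have [ik li] := chained_letter ci; have [ik' li'] := chained_letter ci'.
case: ci ci' => p [q [pk qk ie cp nq]] [p' [q' [pk' qk' ie' cp' nq']]] ii'.
have [pp'|p'p|pp'] := ltngtP p p'.
- apply: (@le_trans _ _ (P l'' k p.+1 + g k)).
    apply: lerD => //; rewrite -(pos_start MN lsys'' pk) pos_le //.
      by rewrite startS // ie -addnS leq_add2l.
    by rewrite size_wordsS start_le.
  apply: le_trans (IH p p' cp cp' pp') _.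
  by rewrite -(pos_start MN lsys'' (ltnW pk')) pos_le // ?ie' ?leq_addr // -ie' ltnW.
- by have := start_lt p'p (ltnW pk) qk'; lia.
- subst p'; have [_ lp] := chained_letter cp.
  rewrite posD1 // li ie ie' !posS //; try exact: ltnW.
  rewrite lp in qk nq qk' nq' *; rewrite -!addrA lerD2l addrA.
  by apply: gap => //; lia.
Qed.

Lemma chained_path_gap k i s : path ltn i s -> (forall j, j \in i :: s -> chained k j) ->
  P l'' k i.+1 + (size s)%:R * (g k + l'' k a) <= P l'' k (last i s).+1.
Proof.
elim: s i => [|j s IH] i /=; first by rewrite mul0r addr0.
move=> /andP[ij js] c.
have ci : chained k i by apply: c; rewrite mem_head.
have cj : chained k j by apply: c; rewrite !inE eqxx orbT.
have := IH j js; have := chained_gap ci cj ij.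
have [jk lj] := chained_letter cj; rewrite [P _ _ j.+1]posD1 // lj => H1 H2.
apply: le_trans (H2 _); last by move=> x xs; apply: c; rewrite inE xs orbT.
rewrite -natr1 mulrDl mul1r.
by move: (_ * (g k + _)) => z; lra.
Qed.

(** The gaps between consecutive cells met by U lie between two points of U, so at most r / g_k of
    them fit, and the cells number one more. *)
Lemma chained_cells k (U : set R) r : U `<=` @unit_interval R -> 0 <= r ->
  (forall x y, U x -> U y -> d x y <= r) ->
  exists V : set (measurableTypeR R),
    [/\ measurable V, U `&` (\bigcap_j tower_set j) `<=` V
      & fine (mu V) <= (1 + r / g k) * l' k a].
Proof.
move=> U01 r0 dU.
pose S := [seq q <- iota 0 (size (W k)) | `[< chained k q /\ floor l k q `&` U !=set0 >]].
have inS q : q \in S -> [/\ (q < size (W k))%N, chained k q & floor l k q `&` U !=set0].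
  rewrite mem_filter => /andP[/asboolP[c n0] _]; split => //.
  by case: (chained_letter c).
exists (\big[setU/set0]_(q <- S) floor l k q); split.
- by apply: bigsetU_measurable => q _; exact: measurable_floor.
- move=> x [Ux Gx]; have [q qk xq] := pos_cover MN lsys k (U01 _ Ux).
  have fq : floor l k q x by rewrite /floor /= in_itv.
  rewrite -bigcup_seq; exists q => //=; rewrite mem_filter mem_iota add0n qk leq0n !andbT.
  apply/asboolP; split; last by exists x.
  by apply: chained_floor fq => // j; exact: Gx.
apply: le_trans (measure_finite_union _ _ _) _.
  by move=> q; exact: measurable_floor.
have l0 b : 0 < l' k b by exact: system_gt0 lsys' k b.
have l0'' b : 0 < l'' k b by exact: system_gt0 lsys'' k b.
rewrite (eq_big_seq (fun=> l' k a)); last first.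
  by move=> q /inS[qk cq _]; rewrite muE //; case: (chained_letter cq) => _ ->.
rewrite big_const_seq count_predT iter_addr_0 -mulr_natl ler_pM2r //.
have : sorted ltn S by apply: sorted_filter; [exact: ltn_trans|exact: iota_ltn_sorted].
case: S inS => [|i s] inS; first by move=> _; rewrite addr_ge0 // divr_ge0 // ltW.
move=> /= srt; rewrite -natr1 addrC lerD2l ler_pdivlMr //.
case: s srt inS => [|j s] srt inS; first by rewrite mul0r.
have [ik ci [y1 [fy1 Uy1]]] := inS i (mem_head _ _).
have [nk cn [y2 [fy2 Uy2]]] := inS (last i (j :: s)) (mem_last _ _).
have chS x : x \in i :: j :: s -> chained k x by move=> /inS[].
have := chained_path_gap srt chS; rewrite [P _ _ (last _ _).+1]posD1 //.
have [_ ->] := chained_letter cn => H.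
have lt_last : (i < last i (j :: s))%N.
  have /andP[ij js] := srt; apply: leq_trans ij _ => /=.
  have := order_path_min ltn_trans js; move/allP => A.
  have := mem_last j s; rewrite inE => /predU1P[->//|/A]; exact: ltnW.
apply: le_trans (dU _ _ Uy1 Uy2).
apply: le_trans (pos_dist (i := i.+1) (j := last i (j :: s)) lt_last (ltnW nk) _ _).
- have : 1 <= (size (j :: s))%:R :> R by rewrite ler1n.
  move: H; move: ((size (j :: s))%:R) => z H z1.
  have : l'' k a <= z * l'' k a by rewrite -[leLHS]mul1r ler_wpM2r // ltW.
  by move: H; rewrite mulrDr; move: (z * _) (z * _) => u v; lra.
- by move: fy1; rewrite /floor /= in_itv /= => /andP[_ /ltW].
- by move: fy2; rewrite /floor /= in_itv /= => /andP[].
Qed.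

(** The losses 24^-1 4^-k sum to less than 1/2. *)
Lemma tower_bigcap_measure : 2^-1 <= fine (mu (\bigcap_k tower_set k)).
Proof.
have mT k := measurable_tower_set k.
have mG : measurable (\bigcap_k tower_set k) by exact: bigcapT_measurable.
suff : (mu (~` \bigcap_k tower_set k) <= (2^-1)%:E)%E.
  rewrite probability_setC // -[mu _]fineK ?fin_num_measure // -EFinB lee_fin; lra.
rewrite setC_bigcap; apply: (@le_trans _ _ (\sum_(0 <= k <oo) mu (~` tower_set k))%E).
  apply: measure_sigma_subadditive => //.
  - by move=> k; exact: measurableC.
  - by apply: bigcup_measurable => k _; exact: measurableC.
apply: (@le_trans _ _ (\sum_(0 <= k <oo) (2^-1 / (2 ^ (k + 1))%:R)%:E)%E); last first.
  have := @cvg_geometric_eseries_half R 2^-1 0; rewrite expr0 divr1 => /cvg_lim.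
  by rewrite /eseries /= => ->.
apply: lee_nneseries => [k _ _|k _]; first exact: measure_ge0.
rewrite -[mu _]fineK ?fin_num_measure //; last exact: measurableC.
rewrite lee_fin; apply: le_trans (tower_set_compl k) _.
rewrite addn1 natrX exprS invfM -exprVn mulrA ler_pM ?invr_ge0 ?exprn_ge0 ?invr_ge0 //; first by lra.
by rewrite lerXn2r ?nnegrE ?invr_ge0 // lef_pV2 ?posrE // ler_nat.
Qed.

Lemma dimension_lower (alpha : R) : alpha <= 1 ->
  (forall s, 0 <= s < alpha -> exists C K, 0 < C /\ forall k, (K <= k)%N ->
    l' k a `^ (1 - s) * (l' k.+1 a / g k.+1) `^ s <= C) ->
  (alpha%:E <= hausdorff_dim_measure mu d)%E.
Proof.
move=> alpha1 H; apply: le_ereal_inf_tmp => _ [S [mS S01 muS] <-].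
apply: le_ereal_inf_tmp => _ [s [s0 Hs] <-]; rewrite lee_fin leNgt; apply/negP => sa.
have [|C [K [C0 HK]]] := H s; first by rewrite s0.
have mG : measurable (\bigcap_k tower_set k).
  by apply: bigcapT_measurable => k; exact: measurable_tower_set.
have small (f : nat -> R) : (forall k, f k <= 2^-1 ^+ k) ->
    forall e, 0 < e -> exists k0, forall k, (k0 <= k)%N -> f k <= e.
  move=> fle e e0; have : (fun n => 2^-1 ^+ n : R) @ \oo --> 0.
    by apply: cvg_expr; rewrite ger0_norm ?invr_ge0 // invf_lt1 // ltr1n.
  move=> /cvgr_le /(_ _ e0) [k0 _ H0]; exists k0 => k k0k.
  exact: le_trans (fle k) (H0 k k0k).
have := @hausdorff_measure_lower R d mu (\bigcap_k tower_set k) (fun k => l' k a) g s C K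
  mG tower_bigcap_measure _ g0 _ _ chained_cells _ C0 HK S mS muS.
rewrite Hs lee_fin => X; suff : (4 * C)^-1 <= 0 by rewrite leNgt invr_gt0 mulr_gt0.
apply: X.
- by move=> k; exact: system_gt0 lsys' k a.
- move=> e e0; have [k0 Hk0] := small (fun k => l' k a) (fun k => system_le_exp2 MN lsys' k a) e e0.
  by exists k0; exact: Hk0.
- move=> e e0; have [k0 Hk0] := small g g_exp2 e e0.
  by exists (maxn K k0); [exact: leq_maxl|apply: Hk0; lia].
- by rewrite s0 /=; apply: ltW; exact: lt_le_trans alpha1.
Qed.

End Lower.
End FloorDimension.

(** * Choice of the parameters *)

Section Asymptotics.
Variables (R : realType) (alpha : R).
Hypothesis alpha01 : 0 <= alpha <= 1.

(* The value [k] realizes 1 / alpha = +oo in the limit. *)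
Definition target_exponent (k : nat) : R := if alpha == 0 then k%:R else alpha^-1.

Variables (H X : nat -> R) (C0 : R).
Hypothesis C0_gt0 : 0 < C0.
Hypothesis H_large : forall k, (0 < k)%N -> 2 ^+ (k * k) <= H k.
Hypothesis X_lower : forall k, (0 < k)%N -> H k `^ target_exponent k <= 2 * X k.
Hypothesis X_upper : forall k, (0 < k)%N ->
  X k <= C0 * (H k `^ target_exponent k + H k `^ (1 + k%:R^-1)).

Let H_ge1 k : (0 < k)%N -> 1 <= H k.
Proof. by move=> k0; apply: le_trans (H_large k0); rewrite exprn_ege1 // ler1n. Qed.

Let X_gt0 k : (0 < k)%N -> 0 < X k.
Proof.
move=> k0; have := X_lower k0.
have : 0 < H k `^ target_exponent k by rewrite powR_gt0 // (lt_le_trans _ (H_ge1 k0)).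
lra.
Qed.

(** The condition k eta >= 1 turns H_k >= 2^(k^2) into H_k^eta >= 2^k. For alpha = 0 the exponent is
    k, and eta = 1 works once k >= 2 / s; otherwise eta = s / alpha - 1. *)
Lemma exponent_margin s : alpha < s -> exists eta K, 0 < eta /\
  forall k, (K <= k)%N -> (0 < k)%N /\ 1 <= k%:R * eta /\ 1 + eta <= s * target_exponent k.
Proof.
move=> als; have s0 : 0 < s by case/andP: alpha01 => a0 _; exact: le_lt_trans als.
rewrite /target_exponent; have [a0|a0] := eqVneq alpha 0.
  exists 1, (maxn 1 (Num.truncn (2 / s)).+1); split => // k kK; split; first by lia.
  have k1 : 1 <= k%:R :> R by rewrite ler1n; lia.
  split; first by rewrite mulr1.
  have : 2 / s <= k%:R.
    apply: le_trans (ltW (truncnS_gt _)) _; rewrite ler_nat.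
    by move: kK; rewrite geq_max => /andP[].
  by rewrite ler_pdivrMr // [s * _]mulrC.
have apos : 0 < alpha by rewrite lt_neqAle eq_sym a0; case/andP: alpha01.
have eta0 : 0 < s / alpha - 1 by rewrite subr_gt0 ltr_pdivlMr // mul1r.
exists (s / alpha - 1), (maxn 1 (Num.truncn (s / alpha - 1)^-1).+1); split => // k kK.
split; first by lia.
split; last by lra.
rewrite -ler_pdivrMr // div1r; apply: le_trans (ltW (truncnS_gt _)) _.
by rewrite ler_nat; move: kK; rewrite geq_max => /andP[].
Qed.

(** With e_k the target exponent, the left side is, up to a constant, at most H_k^(1 - s e_k) <=
    H_k^(-eta) <= 2^(-k^2 eta) <= 2^-k. *)
Lemma asymptotic_upper s c : alpha < s -> 0 < c -> exists C K, forall k, (K <= k)%N ->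
  H k * (c / X k) `^ s <= C * 2^-1 ^+ k.
Proof.
move=> als c0; have s0 : 0 < s by case/andP: alpha01 => a0 _; exact: le_lt_trans als.
have [eta [K [eta0 HK]]] := exponent_margin als.
exists ((2 * c) `^ s), K => k /HK[k0 [ke es]].
have H1 := H_ge1 k0; have Hpos : 0 < H k by exact: lt_le_trans H1.
have Xpos := X_gt0 k0.
have e1 : c / X k <= 2 * c * H k `^ (- target_exponent k).
  rewrite powRN ler_pdivrMr // mulrAC ler_pdivlMr ?powR_gt0 //.
  have -> : 2 * c * X k = c * (2 * X k) by ring.
  by rewrite ler_pM2l // X_lower.
have e2 : (c / X k) `^ s <= (2 * c) `^ s * H k `^ (- (s * target_exponent k)).
  apply: (@le_trans _ _ ((2 * c * H k `^ (- target_exponent k)) `^ s)).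
    by rewrite ge0_ler_powR ?nnegrE ?mulr_ge0 ?powR_ge0 ?invr_ge0 // ltW.
  by rewrite powRM ?powR_ge0 ?mulr_ge0 ?(ltW c0) // -powRrM mulNr [_ * s]mulrC.
apply: le_trans (ler_wpM2l (ltW Hpos) e2) _.
rewrite mulrCA ler_wpM2l ?powR_ge0 //.
have -> : H k * H k `^ (- (s * target_exponent k)) = H k `^ (1 - s * target_exponent k).
  by rewrite -{1}(powRr1 (ltW Hpos)) -powRD // (gt_eqF Hpos) implybT.
apply: (@le_trans _ _ (H k `^ (- eta))); first by rewrite ler_powR //; lra.
rewrite powRN exprVn lef_pV2 ?posrE ?powR_gt0 ?exprn_gt0 //.
apply: (@le_trans _ _ ((2 ^+ (k * k)) `^ eta)); last first.
  by rewrite ge0_ler_powR ?nnegrE ?exprn_ge0 ?H_large // ltW.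
rewrite -!powR_mulrn // -powRrM ler_powR ?ler1n // natrM -mulrA.
by rewrite ler_peMr // ler0n.
Qed.

(** As s < alpha forces alpha > 0, the target exponent is 1 / alpha and H_k^(s / alpha) <= H_k. The
    other term of [X_upper] is harmless once k >= s / (1 - s). *)
Lemma asymptotic_lower s c : 0 <= s < alpha -> 0 < c ->
  exists C K, 0 < C /\ forall k, (K <= k)%N -> (c * X k) `^ s / H k <= C.
Proof.
move=> /andP[s0 sa] c0; have apos : 0 < alpha by exact: le_lt_trans sa.
have s1 : s < 1 by apply: lt_le_trans sa _; case/andP: alpha01.
exists ((c * (C0 * 2)) `^ s), (maxn 1 (Num.truncn (s / (1 - s))).+1).
split; first by rewrite powR_gt0 // !mulr_gt0.
move=> k kK; have k0 : (0 < k)%N by lia.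
have H1 := H_ge1 k0; have Hpos : 0 < H k by exact: lt_le_trans H1.
have kpos : 0 < k%:R :> R by rewrite ltr0n.
have Xpos := X_gt0 k0.
pose A := H k `^ target_exponent k; pose B := H k `^ (1 + k%:R^-1).
have A0 : 0 <= A by exact: powR_ge0.
have B0 : 0 <= B by exact: powR_ge0.
have powH x : x * s <= 1 -> (H k `^ x) `^ s <= H k.
  by move=> xs; rewrite -powRrM -[leRHS]powRr1 ?(ltW Hpos) // ler_powR.
have HA : A `^ s <= H k.
  apply: powH; rewrite /target_exponent gt_eqF // mulrC ler_pdivrMr // mul1r; exact: ltW.
have HB : B `^ s <= H k.
  apply: powH; rewrite mulrDl mul1r.
  have : s / (1 - s) <= k%:R.
    apply: le_trans (ltW (truncnS_gt _)) _; rewrite ler_nat.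
    by move: kK; rewrite geq_max => /andP[].
  rewrite ler_pdivrMr ?subr_gt0 // => sk.
  have : k%:R^-1 * s <= 1 - s by rewrite mulrC ler_pdivrMr // mulrC.
  lra.
have maxH : Num.max A B `^ s <= H k by rewrite /Num.max; case: ifP.
rewrite ler_pdivrMr //; apply: (@le_trans _ _ ((c * (C0 * 2) * Num.max A B) `^ s)).
  rewrite ge0_ler_powR ?nnegrE ?mulr_ge0 ?le_max ?A0 ?(ltW c0) ?(ltW Xpos) ?(ltW C0_gt0) //.
  rewrite -!mulrA ler_pM2l //; apply: le_trans (X_upper k0) _.
  rewrite ler_pM2l // -/A -/B mulr_natl mulr2n lerD //; by rewrite le_max lexx ?orbT.
rewrite powRM ?mulr_ge0 ?le_max ?A0 ?(ltW c0) ?(ltW C0_gt0) //.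
by rewrite ler_wpM2l ?powR_ge0.
Qed.

End Asymptotics.

Lemma growth_keane (M N : nat -> nat) : growth_condition M N ->
  keane_condition (from0 M) (from0 N).
Proof.
move=> MN; have [N0 HM HN] := MN; split.
- by case=> // k _; rewrite /from0 /=; have := growth_M MN k; have := growth_N MN k; lia.
- case=> // k _; rewrite /from0 /=; split; last by have := HN k; lia.
  by have := HM k; have : (0 < 4 ^ k.+1)%N by [rewrite expn_gt0]; move: (4 ^ _)%N => x; nia.
- by rewrite /from0 /=; lia.
Qed.

(** * Explicit sequences of parameters *)

Section KeaneSequences.
Variables (R : realType) (alpha : R).
Local Notation e := (target_exponent alpha).

Lemma root_le (x y : R) k : 0 <= x -> 1 <= y -> x ^+ k.+1 <= y ->
  y * x <= y `^ (1 + k.+1%:R^-1).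
Proof.
move=> x0 y1 xy; have y0 : 0 < y by exact: lt_le_trans y1.
rewrite powRD; last by rewrite (gt_eqF y0) implybT.
rewrite powRr1 ?(ltW y0) // ler_pM2l //.
have -> : x = (x ^+ k.+1) `^ (k.+1%:R^-1).
  by rewrite -powR_mulrn // -powRrM mulfV ?powRr1 // pnatr_eq0.
by rewrite ge0_ler_powR ?nnegrE ?invr_ge0 ?exprn_ge0 // ltW.
Qed.

Section CaseA.

(* [rhoA] is the ratio n_{k+2} / m_{k+1}.  The next [h Lc] does not depend on m_{k+1},
   whence the dummy 0; the power in [mA] makes the additive 16 of [rhoA] negligible. *)
Definition rhoA k (h : letter -> R) (n : nat) : nat :=
  (Num.truncn (h Lb `^ e k / next_height 0 n h Lc) + 16)%N.

Definition mA k (h : letter -> R) (n : nat) : nat :=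
  (16 * 4 ^ k.+1 * n.+1 + (Num.truncn ((rhoA k h n)%:R * next_height 0 n h Lc)).+1 ^ k.+1
   + 2 ^ (k.+1 * k.+1))%N.

(** The heights and N are built together, since [NA k.+1] depends on [MA k], which depends on the
    heights of level k and on [NA k]. *)
Fixpoint stateA k : (letter -> R) * nat :=
  if k is k'.+1 then
    let: (h, n) := stateA k' in
    (next_height (mA k' h n) n h, mA k' h n * rhoA k' h n)%N
  else (fun=> 1, 100%N).

Definition NA k := (stateA k).2.
Definition MA k := mA k (stateA k).1 (NA k).

Lemma heightA k : height R MA NA k = (stateA k).1.
Proof.
elim: k => [|k IH]; first by apply/funext => -[].
by rewrite heightS IH /MA /NA /=; case: (stateA k).
Qed.

Lemma NAS k : NA k.+1 = (MA k * rhoA k (height R MA NA k) (NA k))%N.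
Proof. by rewrite heightA /MA /NA /=; case: (stateA k). Qed.

Lemma growthA : growth_condition MA NA.
Proof.
split => [//|k|k]; first by rewrite /MA /mA -addnA leq_addr.
by rewrite NAS mulnC leq_mul2l /rhoA leq_addl orbT.
Qed.

Local Notation h := (height R MA NA).
Let H k := h k Lb.
Let X k := h k.+2 Lc / (MA k)%:R.
Let rho k := rhoA k (h k) (NA k).

Let hc_next k : next_height 0 (NA k) (h k) Lc = h k.+1 Lc.
Proof. by rewrite heightS. Qed.

Let rho_ge k : H k `^ e k <= (rho k)%:R * h k.+1 Lc.
Proof.
rewrite -ler_pdivrMr ?height_gt0 //; last exact: growthA.
rewrite /rho /rhoA hc_next; apply: le_trans (ltW (truncnS_gt _)) _.
by rewrite ler_nat -addn1 leq_add2l.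
Qed.

Let rho_le k : (rho k)%:R * h k.+1 Lc <= H k `^ e k + 16 * h k.+1 Lc.
Proof.
have h0 := height_gt0 R growthA k.+1 Lc.
rewrite /rho /rhoA hc_next natrD mulrDl lerD2r -ler_pdivlMr //.
by rewrite truncn_le // divr_ge0 ?powR_ge0 // ltW.
Qed.

Let M_root k : ((rho k)%:R * h k.+1 Lc) ^+ k.+1 <= (MA k)%:R.
Proof.
have h0 := height_gt0 R growthA k.+1 Lc.
apply: (@le_trans _ _ ((Num.truncn ((rho k)%:R * h k.+1 Lc)).+1 ^ k.+1)%:R).
  rewrite natrX lerXn2r ?nnegrE ?mulr_ge0 ?(ltW h0) //; exact/ltW/truncnS_gt.
rewrite ler_nat /MA /mA -/(NA k) -heightA -/(rho k) hc_next.
by rewrite -addnA addnCA leq_addr.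
Qed.

Let H_ge_M k : (MA k)%:R <= H k.+1.
Proof.
apply: le_trans (heightSb_ge R growthA k).
by rewrite ler_peMr // height_ge1 //; exact: growthA.
Qed.

Lemma H_largeA k : (0 < k)%N -> 2 ^+ (k * k) <= H k.
Proof.
case: k => // k _; apply: le_trans (H_ge_M k).
by rewrite -natrX ler_nat /MA /mA leq_addl.
Qed.

Lemma X_lowerA k : H k `^ e k <= 2 * X k.
Proof.
have M0 := growth_MR R growthA k; have h0 := height_gt0 R growthA k.+1 Lc.
apply: (le_trans (rho_ge k)); rewrite /X mulrA ler_pdivlMr; last by lra.
have := heightSc_ge R growthA k.+1; rewrite NAS -/(rho k) natrM.
have : 16 <= (rho k)%:R :> R by rewrite (ler_nat _ 16) leq_addl.
move: (rho k)%:R (MA k)%:R M0 (h k.+2 Lc) => r m m0 y r16 le_y.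
apply: (@le_trans _ _ (2 * ((m * r - 1) * h k.+1 Lc))); last by rewrite ler_pM2l.
rewrite mulrAC mulrA ler_pM2r //; nra.
Qed.

(** Up to 4 H_k, X_k is at most rho_k h_(k+1)(c) <= H_k^(e k) + 16 h_(k+1)(c), and h_(k+1)(c) <= 2
    H_k + N_k h_k(c). By [M_root] at the previous level the last product is at most H_k^(1 + 1/k).
    The total is 52 = 4 + 16 * 2 + 16. *)
Lemma X_upperA k : (0 < k)%N -> X k <= 52 * (H k `^ e k + H k `^ (1 + k%:R^-1)).
Proof.
case: k => // j _; set k := j.+1.
have M0 := growth_MR R growthA k; have Mpos : 0 < (MA k)%:R :> R by lra.
have H1 : 1 <= H k by exact: height_ge1 growthA k Lb.
have [r1 r2 r3 [r4 r5 r6 r7]] := height_order R growthA k.+1.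
have [p1 p2 p3 [p4 p5 p6 p7]] := height_order R growthA k.
have HB : H k <= H k `^ (1 + k%:R^-1).
  by rewrite -[leLHS]powRr1 ?(le_trans _ H1) // ler_powR // lerDl invr_ge0.
have step1 : X k <= (rho k)%:R * h k.+1 Lc + 4 * H k.
  rewrite /X ler_pdivrMr // heightS /next_height NAS -/(rho k) natrM.
  have H2 := heightSb_le R growthA k; rewrite -/(H k) in H2.
  have : 2 * h k.+1 Lb <= 4 * H k * (MA k)%:R.
    by apply: le_trans (ler_wpM2l _ H2) _ => //; rewrite le_eqVlt; apply/orP; left; apply/eqP; ring.
  have c0 := height_gt0 R growthA k.+1 Lc.
  move: (h k.+1 La) (h k.+1 Lb) (h k.+1 Lc) (h k.+1 Ld) (H k) r3 r5 c0 => a b c dd hk ab db c0.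
  by move: (rho k)%:R (MA k)%:R => r m hb; lra.
have step2 : h k.+1 Lc <= 2 * H k + (NA k)%:R * h k Lc.
  by rewrite heightS /next_height /H; lra.
have step3 : (NA k)%:R * h k Lc <= H k `^ (1 + k%:R^-1).
  rewrite NAS -/(rho j) natrM -mulrA.
  have MH := H_ge_M j; rewrite -/k in MH.
  have rh0 : 0 <= (rho j)%:R * h k Lc by rewrite mulr_ge0 // ltW // height_gt0 //; exact: growthA.
  have M1 : 1 <= (MA j)%:R :> R by have := growth_MR R growthA j; lra.
  apply: le_trans (root_le rh0 M1 (M_root j)) _.
  have ex0 : 0 <= 1 + k%:R^-1 :> R by rewrite addr_ge0 // invr_ge0 ler0n.
  have Hk0 : 0 <= H k by exact: le_trans H1.
  by apply: ge0_ler_powR => //; rewrite nnegrE.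
have := rho_le k; have : 0 <= H k `^ e k by exact: powR_ge0.
move: (H k `^ e k) (H k `^ (1 + k%:R^-1)) HB step3 => u v HB step3 u0 r_le.
move: step1 step2 step3 r_le; move: (_ * h k Lc) ((rho k)%:R * _) => a b.
by lra.
Qed.

End CaseA.
Section CaseB.

(* [rhoB] is the ratio m_{k+1} / n_{k+1}; n_{k+1} is chosen beyond a power of the
   threshold, which makes the additive term of the next [rhoB] negligible. *)
Definition rhoB k (h : letter -> R) : nat :=
  (Num.truncn (h Lc `^ e k / h Lb) + 128 * 4 ^ k)%N.

(** Half of [NB k] times this bounds (128 * 4^(k+1) + 2) h_(k+1)(b), which is the error caused by
    the additive term of the next [rhoB]; this uses h_(k+1)(b) <= 2 m_(k+1) h_k(b) and m_(k+1) =
    n_(k+1) rho_k. *)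
Definition thresholdB k (h : letter -> R) : R :=
  4 * (128 * 4 ^+ k.+1 + 2) * (rhoB k h)%:R * h Lb.

Definition nB k (h : letter -> R) : nat :=
  (100 + (Num.truncn (16 * h Lb)).+1 + 2 * (Num.truncn (thresholdB k h)).+1 ^ k.+1
   + 2 * 2 ^ (k.+1 * k.+1))%N.

Definition mB k (h : letter -> R) : nat := (nB k h * rhoB k h)%N.

Fixpoint stateB k : letter -> R :=
  if k is k'.+1 then next_height (mB k' (stateB k')) (nB k' (stateB k')) (stateB k')
  else fun=> 1.

Definition NB k := nB k (stateB k).
Definition MB k := mB k (stateB k).

Lemma heightB k : height R MB NB k = stateB k.
Proof.
elim: k => [|k IH]; first by apply/funext => -[].
by rewrite heightS IH.
Qed.

Lemma NB_ge100 k : (100 <= NB k)%N.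
Proof. by rewrite /NB /nB -!addnA leq_addr. Qed.

Lemma rhoB_ge k h : (128 * 4 ^ k <= rhoB k h)%N.
Proof. exact: leq_addl. Qed.

Lemma MB_ge k : (32 * 4 ^ k.+1 * NB k <= MB k)%N.
Proof.
rewrite /MB /mB -/(NB k) [leqRHS]mulnC leq_mul2r; apply/orP; right.
by apply: leq_trans (rhoB_ge k _); rewrite expnS mulnA.
Qed.

(** Proved from the recursion itself: the general bounds on heights presuppose [growthB], which is
    derived from this one. *)
Lemma stateB_ge1 k a : 1 <= stateB k a.
Proof.
elim: k a => [//|k IH] a.
have N1 : 100 <= (NB k)%:R :> R by rewrite (ler_nat _ 100) NB_ge100.
have M1 : 100 <= (MB k)%:R :> R.
  rewrite (ler_nat _ 100); apply: leq_trans (NB_ge100 k) _.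
  by apply: leq_trans (MB_ge k); rewrite leq_pmull // muln_gt0 /= expn_gt0.
have := IH La; have := IH Lb; have := IH Lc; have := IH Ld.
rewrite [stateB k.+1]/= -/(MB k) -/(NB k).
case: a; rewrite /next_height.
all: move: (stateB k La) (stateB k Lb) (stateB k Lc) (stateB k Ld) (MB k)%:R (NB k)%:R M1 N1.
all: by move=> a b c dd m n m1 n1 d1 c1 b1 a1; nra.
Qed.

Lemma growthB : growth_condition MB NB.
Proof.
split=> [|k|k]; first exact: NB_ge100.
  apply: leq_trans (MB_ge k); have := NB_ge100 k.
  by move: (4 ^ k.+1)%N (NB k) => x n n0; nia.
have NS : (Num.truncn (16 * stateB k.+1 Lb) < NB k.+1)%N.
  by rewrite /NB /nB; move: (Num.truncn _) (_ ^ _)%N (_ ^ _)%N => x y z; lia.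
have : 16 * stateB k.+1 Lb < (NB k.+1)%:R.
  by apply: lt_le_trans (truncnS_gt _) _; rewrite ler_nat.
rewrite -(ler_nat R) natrM [stateB k.+1]/= -/(MB k) -/(NB k) /next_height.
have := stateB_ge1 k Lb; have := stateB_ge1 k Lc; have := stateB_ge1 k Ld.
have : 0 <= (MB k)%:R :> R by [].
have : 0 <= (NB k)%:R :> R by [].
move: (stateB k Lb) (stateB k Lc) (stateB k Ld) => b c dd n0 m0 d1 c1 b1 lt.
have : (MB k)%:R * 1 <= (MB k)%:R * b by rewrite ler_wpM2l.
have : 0 <= (NB k)%:R * c by rewrite mulr_ge0 //; lra.
by lra.
Qed.

Local Notation h := (height R MB NB).
Let H k := h k Lc.
Let X k := h k.+1 Lb / (NB k)%:R.
Let rho k := rhoB k (h k).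

Let MB_rho k : MB k = (NB k * rho k)%N.
Proof. by rewrite /rho heightB. Qed.

Let rho_ge k : H k `^ e k <= (rho k)%:R * h k Lb.
Proof.
rewrite -ler_pdivrMr ?height_gt0 //; last exact: growthB.
rewrite /rho /rhoB; apply: le_trans (ltW (truncnS_gt _)) _.
by rewrite ler_nat -addn1 leq_add2l muln_gt0 /= expn_gt0.
Qed.

Let rho_le k : (rho k)%:R * h k Lb <= H k `^ e k + 128 * 4 ^+ k * h k Lb.
Proof.
have h0 := height_gt0 R growthB k Lb.
rewrite /rho /rhoB natrD mulrDl natrM natrX lerD2r -ler_pdivlMr //.
by rewrite truncn_le // divr_ge0 ?powR_ge0 // ltW.
Qed.

Let Y k := thresholdB k (h k).

Let Y_ge0 k : 0 <= Y k.
Proof.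
have h0 := height_gt0 R growthB k Lb.
by rewrite /Y /thresholdB !mulr_ge0 ?addr_ge0 ?mulr_ge0 ?exprn_ge0 // ltW.
Qed.

Let N_root k : 2 * Y k ^+ k.+1 <= (NB k)%:R.
Proof.
apply: (@le_trans _ _ (2 * (Num.truncn (Y k)).+1 ^ k.+1)%:R).
  rewrite natrM natrX ler_pM2l // lerXn2r ?nnegrE ?Y_ge0 //; exact/ltW/truncnS_gt.
rewrite ler_nat /NB /nB -heightB -/(Y k).
by move: (_ ^ _)%N (2 ^ _)%N => x y; lia.
Qed.

Let H_ge_N k : (NB k)%:R <= 2 * H k.+1.
Proof.
have := heightSc_ge R growthB k; have := growth_NR R growthB k.
have := height_ge1 R growthB k Lc; rewrite /H.
move: (h k.+1 Lc) (h k Lc) (NB k)%:R => x y n y1 n1.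
have : (n - 1) * 1 <= (n - 1) * y by rewrite ler_wpM2l //; lra.
by lra.
Qed.

Lemma H_largeB k : (0 < k)%N -> 2 ^+ (k * k) <= H k.
Proof.
case: k => // k _; rewrite -(ler_pM2l (ltr0n R 2)); apply: le_trans (H_ge_N k).
by rewrite -natrX -natrM ler_nat /NB /nB leq_addl.
Qed.

Lemma X_lowerB k : H k `^ e k <= 2 * X k.
Proof.
have N0 := growth_NR R growthB k; have Npos : 0 < (NB k)%:R :> R by lra.
have hb := height_gt0 R growthB k Lb; have hc := height_gt0 R growthB k Lc.
have hd := height_gt0 R growthB k Ld.
have X1 : (rho k)%:R * h k Lb <= X k.
  rewrite /X ler_pdivlMr // heightS /next_height MB_rho natrM.
  have : 0 <= (NB k)%:R * h k Lc by rewrite mulr_ge0 // ltW.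
  by lra.
have := rho_ge k; have : 0 <= (rho k)%:R * h k Lb by rewrite mulr_ge0 // ltW.
by move: X1; move: (_ * h k Lb) => z; lra.
Qed.

(** X_k is at most rho_k h_k(b) + 2 h_k(b). Apart from H_k^(e k), what remains is (128 * 4^k + 2)
    h_k(b) <= H_k Y_(k-1), and [N_root] gives Y_(k-1)^k <= H_k, so [root_le] applies. *)
Lemma X_upperB k : (0 < k)%N -> X k <= H k `^ e k + H k `^ (1 + k%:R^-1).
Proof.
case: k => // j _; set k := j.+1.
have N0 := growth_NR R growthB k; have Npos : 0 < (NB k)%:R :> R by lra.
have H1 : 1 <= H k by exact: height_ge1 growthB k Lc.
have Hk0 : 0 < H k by exact: lt_le_trans H1.
have [r1 r2 r3 [r4 r5 r6 r7]] := height_order R growthB k.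
have hb := height_gt0 R growthB k Lb.
have step1 : X k <= (rho k)%:R * h k Lb + 2 * h k Lb.
  rewrite /X ler_pdivrMr // heightS /next_height MB_rho natrM.
  have : (NB k)%:R * h k Lc <= (NB k)%:R * h k Lb by rewrite ler_wpM2l //; lra.
  have : 1 * h k Ld <= (NB k)%:R * h k Lb by apply: ler_pM => //; lra.
  by lra.
have step2 : (128 * 4 ^+ k + 2) * h k Lb <= 2^-1 * (NB j)%:R * Y j.
  have c0 : 0 <= 128 * 4 ^+ k + 2 :> R by rewrite addr_ge0 // mulr_ge0 // exprn_ge0.
  apply: le_trans (ler_wpM2l c0 (heightSb_le R growthB j)) _.
  rewrite MB_rho natrM /Y /thresholdB -/(rho j) -/k.
  by rewrite le_eqVlt; apply/orP; left; apply/eqP; field.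
have step3 : 2^-1 * (NB j)%:R * Y j <= H k * Y j.
  by rewrite ler_wpM2r ?Y_ge0 //; have := H_ge_N j; rewrite -/k; lra.
have step4 : H k * Y j <= H k `^ (1 + k%:R^-1).
  apply: root_le; [exact: Y_ge0|exact: H1|].
  by have := N_root j; have := H_ge_N j; rewrite -/k; lra.
have := rho_le k; move: step1 step2 step3 step4.
move: (_ * Y j) (H k * Y j) ((rho k)%:R * _) => u v w.
by lra.
Qed.

End CaseB.
End KeaneSequences.

(** * Dimensions of the ergodic measures *)

Section Gaps.
Variables (R : realType) (v : letter -> R).
Hypothesis v0 : forall a, 0 <= v a.

Lemma lensum_take_le s i j : (i <= j)%N -> lensum v (take i s) <= lensum v (take j s).
Proof.
move=> ij; rewrite -(subnKC ij) takeD lensum_cat lerDl.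
exact: lensum_ge0.
Qed.

Lemma lensum_takeS s i : (i < size s)%N ->
  lensum v (take i.+1 s) = lensum v (take i s) + v (nth La s i).
Proof.
by move=> si; rewrite (take_nth La) // -cats1 lensum_cat lensum_cons lensum_nil addr0.
Qed.

Lemma lensum_gap s i j i' a b : (i < j)%N -> (j < i')%N -> (i' < size s)%N ->
  nth La s i = a -> nth La s j = b ->
  lensum v (take i s) + v a + v b <= lensum v (take i' s).
Proof.
move=> ij ji' si' <- <-; have sj := ltn_trans ji' si'; have si := ltn_trans ij sj.
rewrite -lensum_takeS //; apply: le_trans (lensum_take_le s ji').
by rewrite [leRHS]lensum_takeS // lerD2r lensum_take_le.
Qed.

(** The word alternates b and a, so two letters b are separated by an a. *)
Lemma gap_b m n o i i' : (i < i')%N -> (i' < size (child_word o m n Lb))%N ->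
  nth La (child_word o m n Lb) i = Lb -> nth La (child_word o m n Lb) i' = Lb ->
  lensum v (take i (child_word o m n Lb)) + v Lb + v La <=
  lensum v (take i' (child_word o m n Lb)).
Proof.
move=> ii' si' ni ni'; have si := ltn_trans ii' si'.
have sz : size (child_word o m n Lb) = (m.*2).-1 by rewrite size_mkseq.
have E q : (q < size (child_word o m n Lb))%N ->
    nth La (child_word o m n Lb) q = patternb q.
  by rewrite sz => qm; rewrite nth_mkseq.
move: ni ni'; rewrite !E // /patternb; case: ifP => // oi _; case: ifP => // oi' _.
have ii1 : (i.+1 < i')%N.
  by rewrite ltn_neqAle ii' andbT; apply/eqP => e; move: oi'; rewrite -e /= oi.
apply: (@lensum_gap _ i i.+1 i') => //; rewrite E // /patternb ?oi //=.
  by rewrite oi.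
exact: ltn_trans si'.
Qed.

(** In both orientations c stands at the positions 3 mod 4 and b at 1 mod 4. Among the letters
    between two c, b is the one whose lambda_2-length [limit_length_half] bounds below. *)
Lemma gap_c m n o i i' : (i < i')%N -> (i' < size (child_word o m n Lc))%N ->
  nth La (child_word o m n Lc) i = Lc -> nth La (child_word o m n Lc) i' = Lc ->
  lensum v (take i (child_word o m n Lc)) + v Lc + v Lb <=
  lensum v (take i' (child_word o m n Lc)).
Proof.
move=> ii' si' ni ni'; have si := ltn_trans ii' si'.
have sz : size (child_word o m n Lc) = (4 * n).-1 by rewrite size_mkseq.
have E q : (q < size (child_word o m n Lc))%N ->
    nth La (child_word o m n Lc) q = patternc o q.
  by rewrite sz => qm; rewrite nth_mkseq.
have mod3 q : patternc o q = Lc -> (q %% 4 = 3)%N.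
  rewrite /patternc; have : (q %% 4 < 4)%N by rewrite ltn_mod.
  by case: (q %% 4)%N => [|[|[|[|]]]] //; case: (o).
rewrite !E // in ni ni'; have := mod3 _ ni; have := mod3 _ ni' => m' mi.
have ii2 : (i.+2 < i')%N by lia.
apply: (@lensum_gap _ i i.+2 i') => //; rewrite E //; last exact: ltn_trans si'.
rewrite /patternc (_ : i.+2 %% 4 = 1)%N; last by lia.
by case: (o).
Qed.

End Gaps.

(** The exponents 1 - s and s add up to 1, so exactly one factor 1 / h comes out. *)
Lemma scale_bound (R : realType) (u q h x s : R) : 0 <= s <= 1 -> 0 < h -> 0 <= x ->
  0 < u -> 0 <= q -> u <= h^-1 -> q <= x * h^-1 ->
  u `^ (1 - s) * q `^ s <= x `^ s / h.
Proof.
move=> /andP[s0 s1] h0 x0 u0 q0 uh qh.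
have hV : 0 < h^-1 by rewrite invr_gt0.
have e : h^-1 = h^-1 `^ (1 - s) * h^-1 `^ s.
  by rewrite -powRD ?(gt_eqF hV) ?implybT // subrK powRr1 // ltW.
rewrite [X in _ / X](_ : h = (h^-1)^-1) ?invrK // {1}e mulrCA.
rewrite -powRM ?(ltW hV) //.
rewrite ler_pM ?powR_ge0 // ge0_ler_powR ?nnegrE ?subr_ge0 ?mulr_ge0 ?(ltW hV) ?(ltW u0) //.
Qed.

Section KeaneMeasures.
Variables (R : realType) (M N : nat -> nat).
Hypothesis MN : growth_condition M N.
Variable c : R.
Hypothesis c01 : 0 <= c <= 1.
Local Notation l2 := (limit_length R M N Lb).
Local Notation l3 := (limit_length R M N Lc).
Local Notation h := (height R M N).
Let l k a := c * l2 k a + (1 - c) * l3 k a.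

Let sys2 : length_system M N l2. Proof. exact: limit_length_system. Qed.
Let sys3 : length_system M N l3. Proof. exact: limit_length_system. Qed.
Let sys : length_system M N l. Proof. exact: length_system_convex. Qed.

Lemma iet_interval_floor (j : 'I_4) :
  iet_interval (to_vector (l 0)) j = floor M N l 0 (index_of (letter_of j)).
Proof.
rewrite /iet_interval /floor iet_left_before mxE posD1; last by case: (letter_of j).
by rewrite pos_index_of; case: (letter_of j).
Qed.

(** Both measures live on the floors of the single exchange with lengths [l]; only the masses they
    give to these floors differ, and these masses do not involve c. *)
Lemma exists_keane_measures : exists lam2 lam3 : probability (measurableTypeR R) R,
  [/\ keane_measures (from0 M) (from0 N) c lam2 lam3,
      forall k p, (p < size (words M N k))%N ->
        lam2 (floor M N l k p) = (l2 k (letter_at M N k p))%:E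
    & forall k p, (p < size (words M N k))%N ->
        lam3 (floor M N l k p) = (l3 k (letter_at M N k p))%:E].
Proof.
have [lam2 lam2E] := exists_floor_measure MN sys sys2.
have [lam3 lam3E] := exists_floor_measure MN sys sys3.
exists lam2, lam3; split => //.
exists (to_vector (l2 0)), (to_vector (l3 0)) => /=.
have -> : c *: to_vector (l2 0%N) + (1 - c) *: to_vector (l3 0%N) = to_vector (l 0).
  by apply/colP => j; rewrite !mxE.
split.
- split; apply: keane_limit_length => //; by rewrite /letter_of inordK.
- by split; [exact: floor_measure_carried lam2E|exact: floor_measure_carried lam3E].
- split.
    apply: (floor_measure_ergodic MN sys sys2 lam2E (a := Lb)) => k.
    exact: height_limit_length.
  apply: (floor_measure_ergodic MN sys sys3 lam3E (a := Lc)) => k.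
  exact: height_limit_length.
- move=> j; rewrite iet_interval_floor lam2E ?mxE; last by case: (letter_of j).
  by case: (letter_of j).
- move=> j; rewrite iet_interval_floor lam3E ?mxE; last by case: (letter_of j).
  by case: (letter_of j).
Qed.

Variables (lam2 lam3 : probability (measurableTypeR R) R).
Hypothesis lam2E : forall k p, (p < size (words M N k))%N ->
  lam2 (floor M N l k p) = (l2 k (letter_at M N k p))%:E.
Hypothesis lam3E : forall k p, (p < size (words M N k))%N ->
  lam3 (floor M N l k p) = (l3 k (letter_at M N k p))%:E.
Variables (alpha C0 : R).
Hypotheses (alpha01 : 0 <= alpha <= 1) (C0_gt0 : 0 < C0).
Local Notation e := (target_exponent alpha).

Lemma dimension_lam2 :
  (forall k, (0 < k)%N -> 2 ^+ (k * k) <= h k Lb) ->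
  (forall k, (0 < k)%N -> h k Lb `^ e k <= 2 * (h k.+2 Lc / (M k)%:R)) ->
  (forall k, (0 < k)%N -> h k.+2 Lc / (M k)%:R <=
     C0 * (h k Lb `^ e k + h k Lb `^ (1 + k%:R^-1))) ->
  hausdorff_dim_measure lam2 (measure_dist lam3) = alpha%:E.
Proof.
move=> h1 h2 h3; have [a0 a1] : 0 <= alpha /\ alpha <= 1 by apply/andP.
have conc k : 1 - 24^-1 * 4^-1 ^+ k <= h k Lb * l2 k Lb by exact: height_limit_length.
have [E3 P3 _] := sys3.
have M1 k : 100 <= (M k)%:R :> R := growth_MR R MN k.
have M0 k : 0 < (M k)%:R :> R by have := M1 k; lra.
apply/eqP; rewrite eq_le; apply/andP; split.
  apply: (dimension_upper MN sys sys2 sys3 lam2E lam3E conc a0) => s als.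
  have s0 : 0 <= s by apply: le_trans (ltW als).
  (* 32 is 4 from the covering balls times 8 from [limit_lengthc_upper]. *)
  have [C [K HK]] := asymptotic_upper alpha01 C0_gt0 h1 h2 als (ltr0n R 32).
  exists C, K => k Kk; apply: le_trans (HK k Kk).
  rewrite ler_pM2l ?height_gt0 // ge0_ler_powR ?nnegrE //.
  - by rewrite mulr_ge0 // ltW.
  - by rewrite divr_ge0 // divr_ge0 // ltW // height_gt0.
  - have := limit_lengthc_upper R MN k.
    rewrite invf_div -mulrA; move: (_ / _) => z; lra.
apply: (dimension_lower MN sys sys2 sys3 lam2E lam3E conc (g := fun k => l3 k La)) => //.
- move=> k; rewrite E3 [leRHS]E3 /= (E3 k.+1 Ld) /=.
  by have := P3 k.+2 La; have := P3 k.+2 Lb; have := P3 k.+1 Lc; rewrite (E3 k.+1 Lc) /=; lra.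
- by move=> k; exact: (system_le_exp2 MN sys3 k La).
- move=> k q q' qq' q's; rewrite /word_at in q's *.
  by apply: gap_b => // b; exact/ltW/P3.
- move=> s /[dup] /andP[s0 sa] s_range; have s1 : s <= 1 by lra.
  have [C [K [C_gt0 HK]]] := asymptotic_lower alpha01 C0_gt0 h1 h2 h3 s_range (ltr0n R 2).
  exists C, K; split => // k Kk; apply: le_trans (HK k Kk).
  have hb := height_gt0 R MN k Lb; have hb' := height_gt0 R MN k.+1 Lb.
  have hc := height_gt0 R MN k.+2 Lc.
  apply: scale_bound; rewrite ?s0 //.
  + by rewrite mulr_ge0 // divr_ge0 // ltW.
  + by rewrite (system_gt0 sys2).
  + by rewrite divr_ge0 // ltW // ?P3 // (system_gt0 sys2).
  + exact: (system_le_height MN sys2 k Lb).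
  (* Mass over gap at level k + 1: at most 1 / (M_k h_k(b)) over at least 1 / (2 h_(k+2)(c)), that
     is 2 X_k / H_k. *)
  + rewrite ler_pdivrMr ?P3 //.
    apply: le_trans (system_le_height MN sys2 k.+1 Lb) _.
    apply: (@le_trans _ _ (((M k)%:R * h k Lb)^-1)).
      by rewrite lef_pV2 ?posrE ?mulr_gt0 // heightSb_ge.
    apply: (@le_trans _ _ (2 * (h k.+2 Lc / (M k)%:R) / h k Lb * (2 * h k.+2 Lc)^-1)).
      by rewrite le_eqVlt; apply/orP; left; apply/eqP; field; rewrite !gt_eqF.
    rewrite ler_wpM2l ?limit_lengthc_lower // mulr_ge0 ?invr_ge0 ?(ltW hb) //.
    by rewrite mulr_ge0 // divr_ge0 // ltW.
Qed.

Lemma dimension_lam3 :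
  (forall k, (0 < k)%N -> 2 ^+ (k * k) <= h k Lc) ->
  (forall k, (0 < k)%N -> h k Lc `^ e k <= 2 * (h k.+1 Lb / (N k)%:R)) ->
  (forall k, (0 < k)%N -> h k.+1 Lb / (N k)%:R <=
     C0 * (h k Lc `^ e k + h k Lc `^ (1 + k%:R^-1))) ->
  hausdorff_dim_measure lam3 (measure_dist lam2) = alpha%:E.
Proof.
move=> h1 h2 h3; have [a0 a1] : 0 <= alpha /\ alpha <= 1 by apply/andP.
have conc k : 1 - 24^-1 * 4^-1 ^+ k <= h k Lc * l3 k Lc by exact: height_limit_length.
have [E2 P2 _] := sys2.
have N1 k : 100 <= (N k)%:R :> R := growth_NR R MN k.
have N0 k : 0 < (N k)%:R :> R by have := N1 k; lra.
apply/eqP; rewrite eq_le; apply/andP; split.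
  apply: (dimension_upper MN sys sys3 sys2 lam3E lam2E conc a0) => s als.
  have s0 : 0 <= s by apply: le_trans (ltW als).
  (* 20 is 4 from the covering balls times 5 from [limit_lengthb_upper]. *)
  have [C [K HK]] := asymptotic_upper alpha01 C0_gt0 h1 h2 als (ltr0n R 20).
  exists C, K => k Kk; apply: le_trans (HK k Kk).
  rewrite ler_pM2l ?height_gt0 // ge0_ler_powR ?nnegrE //.
  - by rewrite mulr_ge0 // ltW.
  - by rewrite divr_ge0 // divr_ge0 // ltW // height_gt0.
  - have := limit_lengthb_upper R MN k.
    rewrite invf_div -mulrA; move: (_ / _) => z; lra.
apply: (dimension_lower MN sys sys3 sys2 lam3E lam2E conc (g := fun k => l2 k Lb)) => //.
- move=> k; rewrite [leRHS]E2 /=; have M1 := growth_MR R MN k.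
  by have := P2 k.+1 La; have := P2 k.+1 Lb; move: (l2 _ _) (l2 _ _) => x y; nra.
- by move=> k; exact: (system_le_exp2 MN sys2 k Lb).
- move=> k q q' qq' q's; rewrite /word_at in q's *.
  by apply: gap_c => // b; exact/ltW/P2.
- move=> s /[dup] /andP[s0 sa] s_range; have s1 : s <= 1 by lra.
  (* 4 = 2 * 2: one factor comes from h_(k+1)(c) >= N_k h_k(c) / 2, the other from
     [limit_length_half] for the gap. *)
  have [C [K [C_gt0 HK]]] := asymptotic_lower alpha01 C0_gt0 h1 h2 h3 s_range (ltr0n R 4).
  exists C, K; split => // k Kk; apply: le_trans (HK k Kk).
  have hc := height_gt0 R MN k Lc; have hc' := height_gt0 R MN k.+1 Lc.
  have hb := height_gt0 R MN k.+1 Lb.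
  apply: scale_bound; rewrite ?s0 //.
  + by rewrite mulr_ge0 // divr_ge0 // ltW.
  + by rewrite (system_gt0 sys3).
  + by rewrite divr_ge0 // ltW // ?P2 // (system_gt0 sys3).
  + exact: (system_le_height MN sys3 k Lc).
  + rewrite ler_pdivrMr ?P2 //.
    apply: le_trans (system_le_height MN sys3 k.+1 Lc) _.
    apply: (@le_trans _ _ ((2^-1 * (N k)%:R * h k Lc)^-1)).
      rewrite lef_pV2 ?posrE ?mulr_gt0 //; apply: le_trans (heightSc_ge R MN k).
      by rewrite ler_pM2r //; have := N1 k; lra.
    apply: (@le_trans _ _ (4 * (h k.+1 Lb / (N k)%:R) / h k Lc * (2 * h k.+1 Lb)^-1)).
      by rewrite le_eqVlt; apply/orP; left; apply/eqP; field; rewrite !gt_eqF.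
    rewrite ler_wpM2l ?limit_length_half // mulr_ge0 ?invr_ge0 ?(ltW hc) //.
    by rewrite mulr_ge0 // divr_ge0 // ltW.
Qed.

End KeaneMeasures.

Theorem theorem1 (R : realType) :
  (forall alpha : R, 0 <= alpha <= 1 ->
    exists m n : nat -> nat, keane_condition m n /\
      forall c : R, 0 <= c <= 1 ->
        exists lam2 lam3 : probability (measurableTypeR R) R,
          keane_measures m n c lam2 lam3 /\
          hausdorff_dim_measure lam2 (measure_dist lam3) = alpha%:E)
  /\
  (forall alpha : R, 0 <= alpha <= 1 ->
    exists m n : nat -> nat, keane_condition m n /\
      forall c : R, 0 <= c <= 1 ->
        exists lam2 lam3 : probability (measurableTypeR R) R,
          keane_measures m n c lam2 lam3 /\
          hausdorff_dim_measure lam3 (measure_dist lam2) = alpha%:E).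
Proof.
split=> alpha alpha01.
  have MN := growthA alpha.
  exists (from0 (MA alpha)), (from0 (NA alpha)); split; first exact: growth_keane.
  move=> c c01; have [lam2 [lam3 [K E2 E3]]] := exists_keane_measures MN c01.
  exists lam2, lam3; split=> //.
  apply: (dimension_lam2 MN c01 E2 E3 alpha01 (ltr0n R 52)).
  - by move=> k k0; exact: H_largeA.
  - by move=> k _; exact: X_lowerA.
  - by move=> k k0; exact: X_upperA.
have MN := growthB alpha.
exists (from0 (MB alpha)), (from0 (NB alpha)); split; first exact: growth_keane.
move=> c c01; have [lam2 [lam3 [K E2 E3]]] := exists_keane_measures MN c01.
exists lam2, lam3; split=> //.
apply: (dimension_lam3 MN c01 E2 E3 alpha01 ltr01).
- by move=> k k0; exact: H_largeB.
- by move=> k _; exact: X_lowerB.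
- by move=> k k0; rewrite mul1r; exact: X_upperB.
Qed.
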